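(* Let $d\in\{2,3\}$, $\lambda>0$, $0<\sigma<\frac{2}{(d-2)_+}$, $m,l>0$, and let $V$ satisfy the potential assumptions in the context. Let $u\in S(m,l)$ be a minimizer of the global problem $$e(m,l)=\inf_{w\in S(m,l)}E(w).$$ If $\frac lm\notin\mathbb Z$, then $u$ is regular. In addition, regularity also holds if $\frac lm=n\in\mathbb Z$ and $u$ is not an eigenfunction of $L_z$ with eigenvalue $n$. On the other hand, if $u$ is an eigenfunction of $L_z$ with some eigenvalue $n\in\mathbb Z$, then there exists $\omega\in\mathbb R$ such that $u$ solves $$-\tfrac12\Delta u+V(x)u-\omega u=\lambda|u|^{2\sigma}u .$$
   Context: Functions are complex valued; $\frac{2}{(d-2)_+}=+\infty$ if $d=2$. Potential assumptions: $V\in C^\infty(\mathbb R^d,\mathbb R)$ is radially symmetric, $V\ge 0$, $V(x)\to+\infty$ as $|x|\to\infty$; there exist $k>2$, $R>0$ and constants $c_0>0$, $C_\alpha>0$ ($\alpha\in\mathbb N^d$) such that for $|x|>R$, $V(x)\ge c_0\langle x\rangle^k$ and $|\partial^\alpha V(x)|\le C_\alpha\langle x\rangle^{k-|\alpha|}$ for all $\alpha\in\mathbb N^d$, where $\langle x\rangle=(1+|x|^2)^{1/2}$; and $\langle\nabla V(x),x\rangle>0$ for all $x\in\mathbb R^d\setminus\{0\}$. Energy space: $\mathcal H^1$ is the completion of $C_0^\infty(\mathbb R^d)$ under $\|u\|_{\mathcal H^1}=\|\nabla u\|_2+\|V^{1/2}u\|_2+\|u\|_2$. Energy: $E(u)=\int_{\mathbb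 R^d}\frac12|\nabla u|^2+V(x)|u|^2-\frac{\lambda}{\sigma+1}|u|^{2\sigma+2}\,dx$. Angular momentum operator: $L_zu=-\mathrm i(x_1\partial_{x_2}u-x_2\partial_{x_1}u)$, where coordinates are $(x_1,x_2)$ in $\mathbb R^2$ and $(x_1,x_2,z)$ in $\mathbb R^3$. Constraints: $G_1(u)=\int|u|^2\,dx-m$, $G_2(u)=\int(L_zu)\overline u\,dx-l$, $S(m,l)=\{u\in\mathcal H^1:G_1(u)=0,\ G_2(u)=0\}$. An element $u\in S(m,l)$ is called regular if the derivatives $G_1'(u)$ and $G_2'(u)$ are linearly independent (over $\mathbb R$, equivalently $\lambda_1u+\lambda_2L_zu=0$ with $\lambda_1,\lambda_2\in\mathbb R$ implies $\lambda_1=\lambda_2=0$). The equation is understood weakly in $\mathcal H^1$. *)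

(* Defs.v *)
From HB Require Import structures.
From mathcomp Require Import all_boot all_order all_algebra.
From mathcomp Require Import complex.
From mathcomp Require Import all_classical all_reals all_analysis.
Set Implicit Arguments.
Unset Strict Implicit.
Unset Printing Implicit Defensive.
Import Order.TTheory GRing.Theory Num.Theory.
Import numFieldNormedType.Exports.
Local Open Scope classical_set_scope.
Local Open Scope ring_scope.

Definition rV_display : measure_display -> measure_display.
Proof. exact. Qed.

Section measurable_rV.
Context {R : realType} {n : nat}.

Let coords : 'I_n -> 'rV[R]_n -> measurableTypeR R := fun i x => x ord0 i.

Let rV_set0 : g_sigma_preimage coords set0.
Proof. exact: sigma_algebra0. Qed.

Let rV_setC A : g_sigma_preimage coords A -> g_sigma_preimage coords (~` A).
Proof. exact: sigma_algebraC. Qed.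

Let rV_bigcup (F : _^nat) : (forall i, g_sigma_preimage coords (F i)) ->
  g_sigma_preimage coords (\bigcup_i (F i)).
Proof. exact: sigma_algebra_bigcup. Qed.

(* The product sigma-algebra, i.e. the Borel sets of R^n. *)
HB.instance Definition _ := @isMeasurable.Build (rV_display default_measure_display)
  'rV[R]_n (g_sigma_preimage coords) rV_set0 rV_setC rV_bigcup.

Lemma measurable_rV_coord (i : 'I_n) :
  measurable_fun setT (fun x : 'rV[R]_n => x ord0 i : measurableTypeR R).
Proof.
move=> _ Y mY; rewrite setTI; apply: sub_sigma_algebra => /=.
rewrite -bigcup_seq/=; exists i => /=; first by rewrite mem_index_enum.
by exists Y => //; rewrite setTI.
Qed.

Lemma measurable_fun_rV d (T : measurableType d) (f : T -> 'rV[R]_n) :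
  (forall i, measurable_fun setT (fun t => f t ord0 i : measurableTypeR R)) ->
  measurable_fun setT f.
Proof.
move=> mf; have fP : g_sigma_preimage (fun i => coords i \o f) `<=` measurable.
  apply: smallest_sub; first exact: sigma_algebra_measurable.
  by rewrite -bigcup_seq => A [i _ [B mB <-]]; exact: mf.
move=> _ A mA; apply: fP; rewrite g_sigma_preimage_comp.
by exists A.
Qed.

End measurable_rV.

Section lebesgue_rV.
Context {R : realType}.

Definition consrv n (z : measurableTypeR R * 'rV[R]_n) : 'rV[R]_n.+1 :=
  \row_j oapp (z.2 ord0) z.1 (unlift ord0 j).

Lemma measurable_consrv n : measurable_fun setT (@consrv n).
Proof.
apply: measurable_fun_rV => j; case: (unliftP ord0 j) => [k|] ->.
  rewrite (_ : (fun _ => _) = (fun x : 'rV[R]_n => x ord0 k) \o snd).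
    by apply: measurableT_comp => //; exact: measurable_rV_coord.
  by apply/funext => z; rewrite mxE liftK.
rewrite (_ : (fun _ => _) = fst) //.
by apply/funext => z; rewrite mxE unlift_none.
Qed.

Section step.
Variables (n : nat) (mu : {sigma_finite_measure set 'rV[R]_n -> \bar R}).

Definition lebesgue_cons : set 'rV[R]_n.+1 -> \bar R :=
  pushforward (lebesgue_measure \x mu)%E (@consrv n).


Let lebesgue_cons0 : lebesgue_cons set0 = 0%E.
Proof. by rewrite /lebesgue_cons/pushforward preimage_set0 measure0. Qed.

Let lebesgue_cons_ge0 A : (0 <= lebesgue_cons A)%E.
Proof. by rewrite /lebesgue_cons /pushforward measure_ge0. Qed.

Let lebesgue_cons_sigma_additive : semi_sigma_additive lebesgue_cons.
Proof.
move=> F mF tF mUF; rewrite /lebesgue_cons/pushforward preimage_bigcup.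
have mc B : measurable B -> measurable (@consrv n @^-1` B).
  by move=> mB; rewrite -[X in measurable X]setTI; exact: measurable_consrv.
apply: measure_semi_sigma_additive.
- by move=> k; exact: mc.
- apply/trivIsetP => /= i j _ _ ij; rewrite -preimage_setI.
  by move/trivIsetP : tF => /(_ _ _ _ _ ij) ->//; rewrite preimage_set0.
- by rewrite -preimage_bigcup; exact: mc.
Qed.

HB.instance Definition _ := isMeasure.Build _ _ _ lebesgue_cons
  lebesgue_cons0 lebesgue_cons_ge0 lebesgue_cons_sigma_additive.

Lemma lebesgue_consE (A : set (measurableTypeR R)) (B : set 'rV[R]_n) :
  measurable A -> measurable B ->
  lebesgue_cons [set x | A (x ord0 ord0) /\ B (\row_j x ord0 (lift ord0 j))] =
  (lebesgue_measure A * mu B)%E.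
Proof.
move=> mA mB; rewrite -product_measure1E// /lebesgue_cons /pushforward.
congr (_ _); apply/seteqP; split => -[a t] /=; rewrite mxE unlift_none /=.
  by move=> [? Bt]; split => //; move: Bt; congr B; apply/rowP => j;
    rewrite !mxE liftK.
by move=> [? Bt]; split => //; move: Bt; congr B; apply/rowP => j;
  rewrite !mxE liftK.
Qed.

Let lebesgue_cons_sigma_finite : sigma_finite setT lebesgue_cons.
Proof.
have /sigma_finiteP[F [TF ndF Foo]] := sigma_finiteT (@lebesgue_measure R).
have /sigma_finiteP[G [TG ndG Goo]] := sigma_finiteT mu.
exists (fun k => [set x : 'rV[R]_n.+1 | F k (x ord0 ord0) /\
                          G k (\row_j x ord0 (lift ord0 j))]).
  apply/esym/seteqP; split => // x _.
  have [i _ Fi] : (\bigcup_i F i) (x ord0 ord0) by rewrite -TF.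
  have [k _ Gk] : (\bigcup_i G i) (\row_j x ord0 (lift ord0 j)) by rewrite -TG.
  exists (maxn i k) => //; split.
    by move: Fi; exact/subsetPset/ndF/leq_maxl.
  by move: Gk; exact/subsetPset/ndG/leq_maxr.
move=> k; have [mF Fk] := Foo k; have [mG Gk] := Goo k; split; last first.
  by rewrite lebesgue_consE// lte_mul_pinfty// ge0_fin_numE.
apply: measurableI.
  by rewrite -[X in measurable X]setTI; exact: measurable_rV_coord.
rewrite -[X in measurable X]setTI.
apply: (measurable_fun_rV (f := fun x : 'rV[R]_n.+1 => \row_j x ord0 (lift ord0 j))) => //.
move=> i; rewrite (_ : (fun _ => _) = (fun x : 'rV[R]_n.+1 => x ord0 (lift ord0 i))).
  exact: measurable_rV_coord.
by apply/funext => x; rewrite mxE.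
Qed.

HB.instance Definition _ := Measure_isSigmaFinite.Build _ _ _ lebesgue_cons
  lebesgue_cons_sigma_finite.

End step.

Fixpoint lebesgue_rV n : {sigma_finite_measure set 'rV[R]_n -> \bar R} :=
  if n is n'.+1 return {sigma_finite_measure set 'rV[R]_n -> \bar R}
  then lebesgue_cons (lebesgue_rV n') else dirac (0 : 'rV[R]_0).

Lemma lebesgue_rV_box n (A : 'I_n -> set (measurableTypeR R)) :
  (forall i, measurable (A i)) ->
  lebesgue_rV n [set x | forall i, A i (x ord0 i)] =
  (\prod_(i < n) lebesgue_measure (A i))%E.
Proof.
elim: n A => [|n IH] A mA.
  by rewrite big_ord0 /= diracE mem_set// => -[].
rewrite big_ord_recl -IH => [|i]; last exact: mA.
have mB : measurable [set x : 'rV[R]_n | forall i, A (lift ord0 i) (x ord0 i)].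
  rewrite (_ : [set _ | _] = \bigcap_(i in [set: 'I_n])
    (fun x : 'rV[R]_n => x ord0 i) @^-1` A (lift ord0 i)).
    apply: fin_bigcap_measurable => // i _.
    by rewrite -[X in measurable X]setTI; exact: measurable_rV_coord.
  by apply/seteqP; split => x /= Ax i; [move=> _|]; exact: Ax.
rewrite /= -lebesgue_consE//.
congr (lebesgue_cons _ _); apply/seteqP; split => x /=.
  by move=> Ax; split => // i; rewrite mxE.
by move=> [A0 Ax] i; case: (unliftP ord0 i) => [j|] -> //; move: (Ax j); rewrite mxE.
Qed.

End lebesgue_rV.

Section euclidean_calculus.
Context {R : realType} {d : nat}.
Implicit Types (x : 'rV[R]_d) (f : 'rV[R]_d -> R) (u : 'rV[R]_d -> R[i]).

(* The library norm on 'rV[R]_d is the sup norm. *)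
Definition enorm x : R := Num.sqrt (\sum_i x ord0 i ^+ 2).

Definition japanese x : R := Num.sqrt (1 + enorm x ^+ 2).

Definition basis_vector (i : 'I_d) : 'rV[R]_d := delta_mx ord0 i.

Definition partial (i : 'I_d) f : 'rV[R]_d -> R := fun x => 'D_(basis_vector i) f x.

Definition partials (s : seq 'I_d) f := foldr partial f s.

(* C^oo: iterated partial derivatives, in any order, exist and are continuous *)
Definition smooth f : Prop := forall s : seq 'I_d,
  continuous (partials s f) /\
  forall (i : 'I_d) x, derivable (partials s f) x (basis_vector i).

Definition multi_partial (alpha : {ffun 'I_d -> nat}) f :=
  partials (flatten [seq nseq (alpha i) i | i <- enum 'I_d]) f.

Definition multi_order (alpha : {ffun 'I_d -> nat}) : nat := (\sum_i alpha i)%N.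

Record admissible_potential (V : 'rV[R]_d -> R) : Prop := {
  potential_smooth : smooth V;
  potential_radial : forall x y, enorm x = enorm y -> V x = V y;
  potential_ge0 : forall x, 0 <= V x;
  potential_coercive : forall A : R, exists r : R,
    forall x, r < enorm x -> A < V x;
  potential_growth : exists k r c0 : R, [/\ 2 < k, 0 < r, 0 < c0,
    forall x, r < enorm x -> c0 * japanese x `^ k <= V x &
    forall alpha, exists2 C : R, 0 < C & forall x, r < enorm x ->
      `|multi_partial alpha V x| <=
        C * japanese x `^ (k - (multi_order alpha)%:R)];
  potential_monotone : forall x, x != 0 ->
    0 < \sum_i partial i V x * x ord0 i
}.

Local Notation mu := (@lebesgue_rV R d).

Definition cmeasurable u : Prop :=
  measurable_fun setT (fun x => complex.Re (u x) : measurableTypeR R) /\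
  measurable_fun setT (fun x => complex.Im (u x) : measurableTypeR R).

Definition cintegral u : R[i] :=
  Complex (\int[mu]_x complex.Re (u x)) (\int[mu]_x complex.Im (u x)).

Definition cderive (W : normedModType R) (f : W -> R[i]) (a v : W) : R[i] :=
  Complex ('D_v (fun w => complex.Re (f w)) a)
          ('D_v (fun w => complex.Im (f w)) a).

Definition cgrad u : 'I_d -> 'rV[R]_d -> R[i] :=
  fun i x => cderive u x (basis_vector i).

Definition test_function u : Prop :=
  [/\ smooth (fun x => complex.Re (u x)), smooth (fun x => complex.Im (u x)) &
      exists r : R, forall x, r < enorm x -> u x = 0].

Definition cabs (z : R[i]) : R := ComplexField.Normc.normc z.

Definition grad_abs (g : 'I_d -> 'rV[R]_d -> R[i]) x : R :=
  Num.sqrt (\sum_i cabs (g i x) ^+ 2).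

Definition L2norm f : \bar R := ('N[mu]_2%:E[EFin \o f])%E.

Section energy_space.
Variable V : 'rV[R]_d -> R.

Local Open Scope ereal_scope.

(* |g|_2 + |V^(1/2) u|_2 + |u|_2, where g stands for the gradient of u *)
Definition H1norm u (g : 'I_d -> 'rV[R]_d -> R[i]) : \bar R :=
  L2norm (grad_abs g) + L2norm (fun x => Num.sqrt (V x) * cabs (u x))%R +
  L2norm (fun x => cabs (u x)).

(* The completion of C_0^oo is realized inside L^2: it consists of the limits u
   of sequences of test functions phi_n for which phi_n, V^(1/2) phi_n and
   grad phi_n all converge in L^2, and the gradient of such a u is the limit g
   of grad phi_n. It is unique almost everywhere and is the weak gradient. *)
Definition H1_gradient u (g : 'I_d -> 'rV[R]_d -> R[i]) : Prop :=
  [/\ cmeasurable u, forall i, cmeasurable (g i) &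
      exists phi : nat -> 'rV[R]_d -> R[i],
        (forall n, test_function (phi n)) /\
        H1norm (fun x => phi n x - u x)%R
               (fun i x => cgrad (phi n) i x - g i x)%R @[n --> \oo] --> 0].

Definition H1space : set ('rV[R]_d -> R[i]) := [set u | exists g, H1_gradient u g].

Definition grad u : 'I_d -> 'rV[R]_d -> R[i] :=
  xget (fun _ _ => 0%R) [set g | H1_gradient u g].

(* Kept in \bar R, so that its infimum may be -oo; it is finite on H^1 for
   sigma below the critical exponent. *)
Definition energy (lam sigma : R) u : \bar R :=
  \int[mu]_x (2^-1 * grad_abs (grad u) x ^+ 2 + V x * cabs (u x) ^+ 2
              - lam / (sigma + 1) * cabs (u x) `^ (2 * sigma + 2))%:E.

End energy_space.

(* -1/2 Delta u + V u - omega u = lam |u|^(2 sigma) u, weakly in H^1 *)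
Definition weak_solution V (lam sigma omega : R) u : Prop :=
  forall phi, H1space V phi ->
    cintegral (fun x => 2^-1 * (\sum_i grad V u i x * (grad V phi i x)^*)
                        + (V x)%:C%C * u x * (phi x)^*
                        - omega%:C%C * u x * (phi x)^*) =
    cintegral (fun x => (lam * cabs (u x) `^ (2 * sigma))%:C%C
                        * u x * (phi x)^*).

End euclidean_calculus.

(* 2 / (d - 2)_+ *)
Definition critical_exponent (R : realType) (d : nat) : \bar R :=
  if (d <= 2)%N then +oo%E else (2 / (d%:R - 2))%:E.

(* Dimension d = n + 2, so that the coordinates x_1 and x_2 exist. *)
Section angular_momentum.
Context {R : realType} {n : nat}.
Implicit Types (V : 'rV[R]_n.+2 -> R) (u h : 'rV[R]_n.+2 -> R[i]).

Local Notation mu := (@lebesgue_rV R n.+2).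

Definition axis1 : 'I_n.+2 := ord0.
Definition axis2 : 'I_n.+2 := lift ord0 ord0.

Definition Lz V u : 'rV[R]_n.+2 -> R[i] := fun x =>
  - 'i * ((x ord0 axis1)%:C%C * grad V u axis2 x
          - (x ord0 axis2)%:C%C * grad V u axis1 x).

Definition Lz_eigenfunction V u (nu : R) : Prop :=
  [/\ H1space V u, ~ {ae mu, forall x, u x = 0} &
      {ae mu, forall x, Lz V u x = nu%:C%C * u x}].

Definition G1 (m : R) u : R := (\int[mu]_x (cabs (u x) ^+ 2)) - m.

(* Complex-valued; the imaginary part vanishes on H^1 because L_z is symmetric. *)
Definition G2 V (l : R) u : R[i] :=
  cintegral (fun x => Lz V u x * (u x)^*) - l%:C%C.

Definition constraint_set V (m l : R) : set ('rV[R]_n.+2 -> R[i]) :=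
  [set u | [/\ H1space V u, G1 m u = 0 & G2 V l u = 0]].

Definition inf_energy V (lam sigma m l : R) : \bar R :=
  ereal_inf [set energy V lam sigma w | w in constraint_set V m l].

(* G_j'(u)h, the derivative at t = 0 of the quadratic polynomial G_j(u + t h) *)
Definition dG1 (m : R) u h : R :=
  'D_1 (fun t : R => G1 m (fun x => u x + t%:C%C * h x)) 0.

Definition dG2 V (l : R) u h : R[i] :=
  cderive (fun t : R^o => G2 V l (fun x => u x + t%:C%C * h x)) 0 1.

(* G_1'(u), G_2'(u) are linearly independent over R as functionals on H^1. *)
Definition regular V (m l : R) u : Prop :=
  forall a b : R,
    (forall h, H1space V h -> (a * dG1 m u h)%:C%C + b%:C%C * dG2 V l u h = 0) ->
    a = 0 /\ b = 0.

End angular_momentum.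

(* Main.v *)
Require Import Defs.
From mathcomp Require Import all_boot all_order all_algebra.
From mathcomp Require Import complex.
From mathcomp Require Import all_classical all_reals all_analysis.
From mathcomp Require Import ring lra.
From mathcomp Require Import measurable_realfun.
Set Implicit Arguments.
Unset Strict Implicit.
Unset Printing Implicit Defensive.
Import Order.TTheory GRing.Theory Num.Theory.
Import numFieldNormedType.Exports.
Local Open Scope classical_set_scope.
Local Open Scope ring_scope.

(** Why the theorem is true.

    Regularity. Suppose that the derivatives of the two constraints at u are
    dependent. Tested against test functions, the dependence reads
    a u + b L_z u = 0 with b nonzero, so u is an eigenfunction of L_z, and the
    constraints force the eigenvalue to be l/m ([not_regular_eigen]). Now an
    eigenvalue of L_z is an integer ([eigenvalue_natural]): for a test function
    f, the integral of u against f rotated by the angle t solves the equation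
    of a uniform rotation whose speed is the eigenvalue, and it is 2 pi
    periodic in t. Both regularity claims are contrapositives of these facts.

    The equation. If L_z u = kappa u then u is not regular, so there are no
    Lagrange multipliers; the equation comes from second-order information. The
    quadratic form Q h = <L_z h, h> - kappa <h, h> has u in its kernel. Hence,
    if h is orthogonal to u and Q h = 0, every normalized u + t h satisfies both
    constraints exactly, and minimality makes the energy stationary in the
    direction h ([variation]). Only inequalities are needed: as r^(2 sigma + 2)
    is convex, the nonlinear term lies above its tangent ([nlin_convex]), so
    that no derivative of it is ever taken. With the right omega, the
    Euler-Lagrange residual is thus a real linear functional that vanishes on
    the null cone of Q ([EL_null]). The form Q is indefinite: it equals
    - kappa |f|^2 on a real f, and (M - kappa) |h|^2 on h = f (x1 + i x2)^M. A
    line joining points where Q has opposite signs crosses the cone twice, so a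
    linear functional vanishing on the cone vanishes everywhere ([EL_zero]).
    At h and at i h this is the real and the imaginary part of the equation
    ([weak_solutionP]).

    The analysis behind it. A function of H^1 is a pair of real functions, each
    an L^2 limit of test functions together with its gradient. The form of L_z
    is defined and symmetric on H^1 because V dominates |x|^2, as k > 2
    ([potential_dominates_sqr], [ang_antisym]). The power |u|^(2 sigma + 2) is
    integrable by Sobolev inequalities, proved by slicing in dimensions two and
    three ([subcritical_power], [rH1_power_integ]). *)

(** * Square-integrable functions *)

Section L2.
Context d (T : measurableType d) (R : realType).
Variable mu : {measure set T -> \bar R}.
Implicit Types f g h : T -> R.

Definition integ f : Prop := mu.-integrable setT (EFin \o f).

Lemma integ_meas f : integ f -> measurable_fun setT f.
Proof. by move=> /measurable_int /measurable_EFinP. Qed.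

Lemma integD f g : integ f -> integ g -> integ (fun x => f x + g x).
Proof. by move=> hf hg; apply: (integrableD _ hf hg). Qed.

Lemma integZ k f : integ f -> integ (fun x => k * f x).
Proof. by move=> hf; apply: (integrableZl _ k hf). Qed.

Lemma integB f g : integ f -> integ g -> integ (fun x => f x - g x).
Proof. by move=> hf hg; apply: (integrableB _ hf hg). Qed.

Lemma integ_le f g : measurable_fun setT f -> integ g ->
  (forall x, `|f x| <= `|g x|) -> integ f.
Proof.
move=> mf hg fg; apply: (le_integrable _ _ _ hg) => //; first exact/measurable_EFinP.
by move=> x _ /=; rewrite lee_fin fg.
Qed.

Lemma integ_lty f : measurable_fun setT f -> (forall x, 0 <= f x) ->
  (\int[mu]_x (f x)%:E < +oo)%E -> integ f.
Proof.
move=> mf f0 foo; apply/integrableP; split; first exact/measurable_EFinP.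
by under eq_integral do rewrite /= ger0_norm//.
Qed.

Lemma RintD f g : integ f -> integ g ->
  \int[mu]_x (f x + g x) = \int[mu]_x f x + \int[mu]_x g x.
Proof. by move=> *; rewrite RintegralD. Qed.
Lemma RintB f g : integ f -> integ g ->
  \int[mu]_x (f x - g x) = \int[mu]_x f x - \int[mu]_x g x.
Proof. by move=> *; rewrite RintegralB. Qed.
Lemma RintZ k f : integ f -> \int[mu]_x (k * f x) = k * \int[mu]_x f x.
Proof. by move=> *; rewrite RintegralZl. Qed.
Lemma Rint_fin f : integ f -> (\int[mu]_x (f x)%:E = (\int[mu]_x f x)%:E)%E.
Proof. by move=> hf; rewrite /Rintegral fineK// integrable_fin_num. Qed.
Lemma Rint_le f g : integ f -> integ g -> (forall x, f x <= g x) ->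
  \int[mu]_x f x <= \int[mu]_x g x.
Proof. by move=> hf hg fg; apply: le_Rintegral. Qed.
Lemma Rint_ge0 f : (forall x, 0 <= f x) -> 0 <= \int[mu]_x f x.
Proof. by move=> hf; apply: Rintegral_ge0. Qed.

Lemma Rint_eq0 f : integ f -> (forall x, 0 <= f x) -> \int[mu]_x f x = 0 ->
  {ae mu, forall x, f x = 0}.
Proof.
move=> hf f0 If.
have : (\int[mu]_x `| (EFin \o f) x | = 0)%E.
  by under eq_integral do rewrite /= ger0_norm//; rewrite Rint_fin// If.
move/(ae_eq_integral_abs _ measurableT (measurable_int _ hf)) => H.
by apply: filterS H => x /= /(_ I) [].
Qed.

Lemma Rint_ae f g : integ f -> measurable_fun setT g ->
  {ae mu, forall x, f x = g x} -> integ g /\ \int[mu]_x f x = \int[mu]_x g x.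
Proof.
move=> hf mg fg.
have E : (\int[mu]_x `|(g x)%:E| = \int[mu]_x `|(f x)%:E|)%E.
  apply: ae_eq_integral => //.
  - by apply/measurable_EFinP/measurableT_comp.
  - by apply/measurable_EFinP/measurableT_comp => //; exact: integ_meas.
  - by apply: filterS fg => x /= -> _.
split.
  apply/integrableP; split; first exact/measurable_EFinP.
  by rewrite /= E; move/integrableP: hf => [].
rewrite /Rintegral; congr fine; apply: ae_eq_integral => //.
- exact/measurable_EFinP/integ_meas.
- exact/measurable_EFinP.
- by apply: filterS fg => x /= -> _.
Qed.

Definition sqint f := measurable_fun setT f /\ integ (fun x => f x ^+ 2).

Lemma sqintM f g : sqint f -> sqint g -> integ (fun x => f x * g x).
Proof.
move=> [mf hf] [mg hg]; apply: (integ_le _ (integD hf hg)).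
  exact: measurable_funM.
move=> x; rewrite (ger0_norm (addr_ge0 (sqr_ge0 _) (sqr_ge0 _))) normrM.
rewrite -(real_normK (num_real (f x))) -(real_normK (num_real (g x))).
by have := sqr_ge0 (`|f x| - `|g x|); nra.
Qed.

Lemma sqintD f g : sqint f -> sqint g -> sqint (fun x => f x + g x).
Proof.
move=> hf hg; split; first by apply: measurable_funD; [case: hf|case: hg].
rewrite (_ : (fun _ => _) = (fun x => (f x ^+ 2 + 2 * (f x * g x)) + g x ^+ 2)).
  by apply: integD; [apply: integD; [case: hf|apply: integZ; exact: sqintM]|case: hg].
by apply/funext => x; ring.
Qed.

Lemma sqintZ k f : sqint f -> sqint (fun x => k * f x).
Proof.
move=> [mf hf]; split; first exact: measurable_funM.
rewrite (_ : (fun _ => _) = (fun x => k ^+ 2 * f x ^+ 2)); first exact: integZ.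
by apply/funext => x; ring.
Qed.

Lemma sqint_le f g : measurable_fun setT f -> integ g ->
  (forall x, f x ^+ 2 <= g x) -> sqint f.
Proof.
move=> mf hg fg; split => //; apply: (integ_le _ hg) => [|x].
  exact: measurable_funX.
by rewrite ger0_norm ?sqr_ge0// (le_trans (fg x)) ?ler_norm.
Qed.

Lemma Cauchy_Schwarz f g : sqint f -> sqint g ->
  (\int[mu]_x (f x * g x)) ^+ 2 <= \int[mu]_x (f x ^+ 2) * \int[mu]_x (g x ^+ 2).
Proof.
move=> hf hg; set B := \int[mu]_x (f x * g x).
set A := \int[mu]_x (f x ^+ 2); set C := \int[mu]_x (g x ^+ 2).
have key s t : 0 <= s ^+ 2 * A + 2 * s * t * B + t ^+ 2 * C.
  have -> : s ^+ 2 * A + 2 * s * t * B + t ^+ 2 * C =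
      \int[mu]_x ((s * f x + t * g x) ^+ 2).
    have If : integ (fun x => s ^+ 2 * f x ^+ 2) by apply: integZ; case: hf.
    have Ig : integ (fun x => t ^+ 2 * g x ^+ 2) by apply: integZ; case: hg.
    have Ifg := sqintM hf hg.
    have Ifg' : integ (fun x => (2 * s * t) * (f x * g x)) by apply: integZ.
    rewrite /A /B /C -!RintZ//; [|by case: hg|by case: hf].
    rewrite -RintD// -RintD//; last exact: integD.
    by congr Rintegral; apply/funext => x; ring.
  by apply: Rint_ge0 => x; exact: sqr_ge0.
have A0 : 0 <= A by apply: Rint_ge0 => x; exact: sqr_ge0.
have C0 : 0 <= C by apply: Rint_ge0 => x; exact: sqr_ge0.
(* The first two choices minimize the form; the last two settle A = C = 0. *)
have := key B (- A); have := key C (- B); have := key B (-1); have := key 1 (-B).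
rewrite le_eqVlt in A0; case/orP : A0 => [/eqP <-|A0]; last first.
  move=> _ _ _ h; rewrite -subr_ge0 -(pmulr_rge0 _ A0).
  suff -> : A * (A * C - B ^+ 2) = B ^+ 2 * A + 2 * B * - A * B + (- A) ^+ 2 * C by [].
  by ring.
rewrite le_eqVlt in C0; case/orP : C0 => [/eqP <-|C0]; first by nra.
move=> _ _ h _; rewrite -subr_ge0 -(pmulr_rge0 _ C0).
suff -> : C * (0 * C - B ^+ 2) = C ^+ 2 * 0 + 2 * C * - B * B + (- B) ^+ 2 * C by [].
by ring.
Qed.

Lemma sqint_eq0 f : sqint f -> \int[mu]_x (f x * f x) = 0 -> {ae mu, forall x, f x = 0}.
Proof.
move=> sf /(Rint_eq0 (sqintM sf sf)) => /(_ (fun x => sqr_ge0 _)).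
by apply: filterS => x /eqP; rewrite mulf_eq0 orbb => /eqP.
Qed.

Definition L2cvg (F : nat -> T -> R) f :=
  [/\ forall n, sqint (F n), sqint f &
      \int[mu]_x ((F n x - f x) ^+ 2) @[n --> \oo] --> (0 : R)].

Lemma sqintB f g : sqint f -> sqint g -> sqint (fun x => f x - g x).
Proof.
move=> hf hg; rewrite (_ : (fun _ => _) = (fun x => f x + -1 * g x)).
  by apply: sqintD => //; exact: sqintZ.
by apply/funext => x; ring.
Qed.

Lemma L2cvg_cst f : sqint f -> L2cvg (fun=> f) f.
Proof.
move=> hf; split => //; apply: cvg_near_cst; apply: nearW => n.
under eq_Rintegral do rewrite subrr expr0n /=.
by rewrite Rintegral_cst// mul0r.
Qed.

(** A pointwise bound on the squared errors is all that is asked: linear combinations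
    and multiplication by weights are both instances. *)
Lemma L2cvg_dom F f G g H h C : L2cvg F f -> L2cvg G g ->
  (forall n, sqint (H n)) -> sqint h ->
  (forall n x, (H n x - h x) ^+ 2 <= C * ((F n x - f x) ^+ 2 + (G n x - g x) ^+ 2)) ->
  L2cvg H h.
Proof.
move=> [hF hf cF] [hG hg cG] hH hh le; split => //.
have c0 : C * (\int[mu]_x ((F n x - f x) ^+ 2) + \int[mu]_x ((G n x - g x) ^+ 2))
    @[n --> \oo] --> C * (0 + 0).
  by apply: cvgMr; apply: cvgD.
rewrite addr0 mulr0 in c0.
apply: squeeze_cvgr c0; last exact: cvg_cst.
apply: nearW => n; apply/andP; split; first by apply: Rint_ge0 => x; exact: sqr_ge0.
have [_ IF] := sqintB (hF n) hf; have [_ IG] := sqintB (hG n) hg.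
rewrite -RintD// -RintZ; last exact: integD.
apply: Rint_le => //; first by case: (sqintB (hH n) hh).
by apply: integZ; exact: integD.
Qed.

Lemma L2cvg_lin F f G g a b : L2cvg F f -> L2cvg G g ->
  L2cvg (fun n x => a * F n x + b * G n x) (fun x => a * f x + b * g x).
Proof.
move=> cF cG; have [hF hf _] := cF; have [hG hg _] := cG.
apply: (L2cvg_dom (C := 2 * (a ^+ 2 + b ^+ 2)) cF cG).
- by move=> n; apply: sqintD; exact: sqintZ.
- by apply: sqintD; exact: sqintZ.
- move=> n x; set p := F n x - f x; set q := G n x - g x.
  rewrite (_ : _ - _ = a * p + b * q); last by rewrite /p /q; ring.
  rewrite -subr_ge0 (_ : _ - _ = (a * p - b * q) ^+ 2 + 2 * (a * q) ^+ 2 + 2 * (b * p) ^+ 2); last by ring.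
  by rewrite !addr_ge0 ?sqr_ge0// mulr_ge0 ?sqr_ge0.
Qed.

Lemma L2cvg_inner F f G g : L2cvg F f -> L2cvg G g ->
  \int[mu]_x (F n x * G n x) @[n --> \oo] --> \int[mu]_x (f x * g x).
Proof.
move=> [hF hf cF] [hG hg cG].
pose p n := \int[mu]_x ((F n x - f x) ^+ 2).
pose q n := \int[mu]_x ((G n x - g x) ^+ 2).
pose A := \int[mu]_x (f x ^+ 2).
pose B := \int[mu]_x (g x ^+ 2).
apply/cvgrPdist_lt => e e0.
have c : Num.sqrt (p n) * Num.sqrt B + Num.sqrt A * Num.sqrt (q n) + Num.sqrt (p n) * Num.sqrt (q n)
   @[n --> \oo] --> (Num.sqrt 0 * Num.sqrt B + Num.sqrt A * Num.sqrt 0 + Num.sqrt 0 * Num.sqrt 0 : R).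
  have sp : Num.sqrt (p n) @[n --> \oo] --> (Num.sqrt 0 : R).
    by apply: continuous_cvg cF; exact: sqrt_continuous.
  have sq : Num.sqrt (q n) @[n --> \oo] --> (Num.sqrt 0 : R).
    by apply: continuous_cvg cG; exact: sqrt_continuous.
  apply: cvgD; first apply: cvgD.
  - by apply: cvgMl.
  - by apply: cvgMr.
  - by apply: cvgM.
rewrite sqrtr0 !(mul0r,mulr0,addr0) in c.
move/cvgrPdist_lt : c => /(_ e e0); apply: filterS => n /=.
rewrite sub0r normrN => h; apply: le_lt_trans h.
rewrite [leRHS]ger0_norm; last by rewrite !addr_ge0 ?mulr_ge0 ?sqrtr_ge0.
have df := sqintB (hF n) hf; have dg := sqintB (hG n) hg.
have cs a b : sqint a -> sqint b -> `|\int[mu]_x (a x * b x)| <=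
   Num.sqrt (\int[mu]_x (a x ^+ 2)) * Num.sqrt (\int[mu]_x (b x ^+ 2)).
  move=> ha hb; rewrite -sqrtrM; last by apply: Rint_ge0 => x; exact: sqr_ge0.
  by rewrite -sqrtr_sqr ler_wsqrtr// Cauchy_Schwarz.
have -> : \int[mu]_x (f x * g x) - \int[mu]_x (F n x * G n x) =
   - (\int[mu]_x ((F n x - f x) * g x) + \int[mu]_x (f x * (G n x - g x)) +
     \int[mu]_x ((F n x - f x) * (G n x - g x))).
  have i1 := sqintM df hg; have i2 := sqintM hf dg; have i3 := sqintM df dg.
  rewrite -RintB; [|exact: sqintM|exact: sqintM].
  rewrite -RintD// -RintD//; last exact: integD.
  rewrite -mulN1r -RintZ; last by apply: integD => //; exact: integD.
  by congr Rintegral; apply/funext => x; ring.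
rewrite normrN; apply: le_trans (ler_normD _ _) _; apply: lerD; last exact: cs.
by apply: le_trans (ler_normD _ _) _; apply: lerD; exact: cs.
Qed.

End L2.

(** * Integration on R^n by slices *)

Section rV_top.
Context {R : realType} {n : nat}.
Implicit Types x y : 'rV[R]_n.

Lemma rV_norm_le x (r : R) : 0 <= r -> (`|x| <= r) <-> (forall i, `|x ord0 i| <= r).
Proof.
move=> r0; split => h.
  move=> i; apply: le_trans h; rewrite /Num.norm /= mx_normrE.
  by apply: (le_bigmax_cond _ (fun k : 'I_1 * 'I_n => `|x k.1 k.2|) (j := (ord0, i))).
rewrite /Num.norm /= mx_normrE; apply: bigmax_le => // -[i j] _ /=.
by rewrite (ord1 i).
Qed.

Lemma rV_coord_le x i : `|x ord0 i| <= `|x|.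
Proof. by have /(_ (lexx _)) := (rV_norm_le x (normr_ge0 x)).1; apply. Qed.

Lemma rV_norm_lt x (r : R) : 0 < r -> (forall i, `|x ord0 i| < r) -> `|x| < r.
Proof.
move=> r0 h; rewrite /Num.norm /= mx_normrE; apply: bigmax_lt => // -[i j] _ /=.
by rewrite (ord1 i).
Qed.

Lemma coord_cont i : continuous (fun x => x ord0 i).
Proof. by move=> x; exact: coord_continuous. Qed.

Let meas_coord_lt (q : R) (e : R) i : measurable [set x : 'rV[R]_n | `|q - x ord0 i| < e].
Proof.
rewrite (_ : [set _ | _] = (fun x : 'rV[R]_n => x ord0 i : measurableTypeR R) @^-1` [set t | `|q - t| < e]) //.
rewrite -[X in measurable X]setTI; apply: measurable_rV_coord => //.
apply: open_measurable; rewrite (_ : [set _ | _] = ball q e); last by rewrite -ball_normE.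
exact: ball_open.
Qed.

(** The sigma-algebra is generated by the coordinates, so an open set has to be a
    countable union of boxes: rational centres and radii 1/(k+1) suffice. *)
Lemma rV_open_measurable (U : set 'rV[R]_n) : open U -> measurable U.
Proof.
move=> oU.
pose box (q : 'rV[rat]_n) (k : nat) : set 'rV[R]_n :=
  [set x | forall i, `|ratr (q ord0 i) - x ord0 i| < k.+1%:R^-1].
have mbox q k : measurable (box q k).
  rewrite (_ : box q k = \bigcap_(i in [set: 'I_n])
      [set x : 'rV[R]_n | `|ratr (q ord0 i) - x ord0 i| < k.+1%:R^-1]).
    by apply: fin_bigcap_measurable => // i _; exact: meas_coord_lt.
  by apply/seteqP; split => x /= Ax i; [move=> _|]; exact: Ax.
(* Boxes inside U, enumerated through a code of centre and radius. *)
pose B (N : nat) : set 'rV[R]_n :=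
  match (unpickle N : option ('rV[rat]_n * nat)) with
  | Some qk => if `[< box qk.1 qk.2 `<=` U >] then box qk.1 qk.2 else set0
  | None => set0 end.
have -> : U = \bigcup_N B N.
  apply/seteqP; split => x.
    move=> Ux; have /nbhs_ballP[e /= e0 eU] : nbhs x U by exact: open_nbhs_nbhs.
    have [k ke] : exists k : nat, 2 * k.+1%:R^-1 < e.
      have [k] := @ltr_add_invr R 0 (e / 2) (divr_gt0 e0 (ltr0n _ 2)).
      by rewrite add0r => h; exists k; rewrite mulrC -ltr_pdivlMr.
    have k0 : 0 < k.+1%:R^-1 :> R by rewrite invr_gt0.
    have /choice[q Hq] i : exists q : rat, `|ratr q - x ord0 i| < k.+1%:R^-1.
      have [q] := @rat_in_itvoo R (x ord0 i - k.+1%:R^-1) (x ord0 i + k.+1%:R^-1)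
        ltac:(by rewrite ltrD2l gtrN).
      by rewrite in_itv /= => /andP[h1 h2]; exists q; rewrite ltr_distl h1 h2.
    pose qv : 'rV[rat]_n := \row_i q i.
    exists (pickle (qv, k)) => //; rewrite /B pickleK /= asboolT.
      by move=> i; rewrite mxE.
    move=> y yq; apply: eU; rewrite -ball_normE /=; apply: rV_norm_lt => // i.
    rewrite !mxE; apply: le_lt_trans ke; rewrite mulr_natl mulr2n.
    have := yq i; rewrite mxE => h; have h' := Hq i.
    rewrite (_ : _ - _ = - (ratr (q i) - x ord0 i) + (ratr (q i) - y ord0 i)); last by ring.
    by apply: le_trans (ler_normD _ _) _; rewrite normrN lerD// ltW.
  by move=> [N _]; rewrite /B; case: unpickle => // -[q k] /=; case: asboolP => // h /h.
apply: bigcupT_measurable => N; rewrite /B; case: unpickle => // -[q k] /=.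
by case: asboolP.
Qed.

Lemma cont_meas (f : 'rV[R]_n -> R) : continuous f -> measurable_fun setT f.
Proof.
move=> cf; apply: (measurability _ (RGenOpens.measurableE R)).
move=> _ [_ [a [b ->] <-]]; rewrite setTI; apply: rV_open_measurable.
apply: open_comp; last exact: interval_open.
by move=> x _; exact: cf.
Qed.

Definition bsupp (f : 'rV[R]_n -> R) := exists r, forall x, r < `|x| -> f x = 0.

Lemma bsupp_gt0 f : bsupp f -> exists2 r, 0 < r & forall x, r < `|x| -> f x = 0.
Proof.
move=> [r hr]; exists (`|r| + 1); first by rewrite ltr_wpDl.
move=> x h; apply: hr; apply: le_lt_trans h.
by rewrite (le_trans (ler_norm _))// lerDl.
Qed.

Lemma cont_bsupp_bounded f : continuous f -> bsupp f -> exists2 M, 0 <= M & forall x, `|f x| <= M.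
Proof.
move=> cf /bsupp_gt0[r r0 hr].
have cB : compact [set x : 'rV[R]_n | `|x| <= r].
  apply: bounded_closed_compact.
    exists r; split; first exact: num_real.
    by move=> y ry x /= h; apply: le_trans h (ltW ry).
  rewrite (_ : [set _ | _] = (fun x : 'rV[R]_n => `|x|) @^-1` [set y | y <= r]) //.
  apply: closed_comp; last exact: closed_le.
  by move=> x _; exact: norm_continuous.
have [c _ hc] : exists2 c, c \in [set x : 'rV[R]_n | `|x| <= r] &
    forall t, t \in [set x : 'rV[R]_n | `|x| <= r] -> `|f t| <= `|f c|.
  apply: (compact_EVT_max _ cB); first by exists 0; rewrite /= normr0 ltW.
  apply: continuous_subspaceT => x.
  by apply: continuous_comp; [exact: cf|exact: norm_continuous].
exists `|f c| => // x; case: (lerP `|x| r) => h; first by apply: hc; rewrite inE.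
by rewrite hr// normr0.
Qed.

End rV_top.

Section rV_int.
Context {R : realType}.
Local Notation leb n := (@lebesgue_rV R n).

Lemma leb_cube_lty n (r : R) : (leb n [set x : 'rV[R]_n | forall i, x ord0 i \in `[(- r)%R, r]] < +oo)%E.
Proof.
rewrite (lebesgue_rV_box (A := fun=> `[-r, r]%classic)) //.
suff /andP[] : (0 <= \prod_(i < n) lebesgue_measure `[(- r)%R, r] < +oo)%E by [].
elim/big_ind : _ => [|x y /andP[x0 xoo] /andP[y0 yoo]|i _].
- by rewrite lee01 ltry.
- by rewrite mule_ge0//= lte_mul_pinfty// ge0_fin_numE.
- by rewrite measure_ge0 /= lebesgue_measure_itv /=; case: ifP; rewrite ltry.
Qed.

Lemma measurable_cube n (r : R) : measurable [set x : 'rV[R]_n | forall i, x ord0 i \in `[(- r)%R, r]].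
Proof.
rewrite (_ : [set _ | _] = \bigcap_(i in [set: 'I_n])
      ((fun x : 'rV[R]_n => x ord0 i : measurableTypeR R) @^-1` `[-r, r]%classic)).
  apply: fin_bigcap_measurable => // i _.
  by rewrite -[X in measurable X]setTI; apply: measurable_rV_coord.
by apply/seteqP; split => x /= Ax i; [move=> _|]; exact: Ax.
Qed.

Lemma cont_bsupp_integ n (f : 'rV[R]_n -> R) : continuous f -> bsupp f -> integ (leb n) f.
Proof.
move=> cf bf; have [M M0 fM] := cont_bsupp_bounded cf bf; have [r r0 hr] := bsupp_gt0 bf.
pose Q := [set x : 'rV[R]_n | forall i, x ord0 i \in `[(- r)%R, r]].
have mQ : measurable Q by exact: measurable_cube.
apply: (integ_le (g := fun x => M * \1_Q x)).
- exact: cont_meas.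
- apply: integZ; apply: integ_lty => //.
  by rewrite integral_indic// setIT; exact: leb_cube_lty.
- move=> x; rewrite normrM (ger0_norm M0) indicE.
  case: (boolP (x \in Q)) => xQ; first by rewrite /= normr1 mulr1.
  rewrite hr ?normr0 ?mulr0//; rewrite ltNge; apply/negP => h.
  move/negP: xQ; apply; rewrite inE => i; rewrite in_itv /= -ler_norml.
  exact: le_trans (rV_coord_le _ _) h.
Qed.

Lemma cont_bsupp_sqint n (f : 'rV[R]_n -> R) : continuous f -> bsupp f -> sqint (leb n) f.
Proof.
move=> cf bf; split; first exact: cont_meas.
apply: cont_bsupp_integ.
  by move=> x; apply: continuousM; exact: cf.
by case: bf => r hr; exists r => x /hr ->; rewrite expr0n.
Qed.

(** The measure on R^(n+1) is the image of a product, so Fubini holds in both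
    orders; inductions on the dimension go through these lemmas. *)
Lemma fubini_cons_ge0 n (f : 'rV[R]_n.+1 -> R) : measurable_fun setT f -> (forall x, 0 <= f x) ->
  (\int[leb n.+1]_x (f x)%:E = \int[lebesgue_measure]_t \int[leb n]_y (f (consrv (t, y)))%:E)%E.
Proof.
move=> mf f0; have mc := @measurable_consrv R n.
rewrite -(fubini_tonelli1 (fun z => (f (consrv z))%:E))/=.
- rewrite (ge0_integral_pushforward mc) //; first exact/measurable_EFinP.
  by move=> y _; rewrite lee_fin.
- by apply/measurable_EFinP; apply: measurableT_comp.
- by move=> z; rewrite lee_fin.
Qed.

Lemma fubini_cons_ge0_swap n (f : 'rV[R]_n.+1 -> R) : measurable_fun setT f -> (forall x, 0 <= f x) ->
  (\int[leb n.+1]_x (f x)%:E = \int[leb n]_y \int[lebesgue_measure]_t (f (consrv (t, y)))%:E)%E.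
Proof.
move=> mf f0; have mc := @measurable_consrv R n.
rewrite -(fubini_tonelli2 (fun z => (f (consrv z))%:E))/=.
- rewrite (ge0_integral_pushforward mc) //; first exact/measurable_EFinP.
  by move=> y _; rewrite lee_fin.
- by apply/measurable_EFinP; apply: measurableT_comp.
- by move=> z; rewrite lee_fin.
Qed.

Lemma integ_consrv n (f : 'rV[R]_n.+1 -> R) : integ (leb n.+1) f ->
  (lebesgue_measure \x leb n)%E.-integrable setT (fun z => (f (consrv z))%:E).
Proof.
move=> hf; have mc := @measurable_consrv R n.
have mf := integ_meas hf.
have /integrableP[_ Hf] := hf.
apply/integrableP; split.
  by apply/measurable_EFinP; apply: measurableT_comp.
move: Hf; rewrite (ge0_integral_pushforward mc) //.
by apply: measurableT_comp => //; exact/measurable_EFinP.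
Qed.

Lemma fubini_cons n (f : 'rV[R]_n.+1 -> R) : integ (leb n.+1) f ->
  (\int[leb n.+1]_x (f x)%:E = \int[lebesgue_measure]_t \int[leb n]_y (f (consrv (t, y)))%:E)%E.
Proof.
move=> hf; have mc := @measurable_consrv R n; have hc := integ_consrv hf.
rewrite (integral12_prod_meas1 hc)/=.
rewrite (integral_pushforward mc)//.
by apply/measurable_EFinP; exact: integ_meas hf.
Qed.

Lemma fubini_cons_swap n (f : 'rV[R]_n.+1 -> R) : integ (leb n.+1) f ->
  (\int[leb n.+1]_x (f x)%:E = \int[leb n]_y \int[lebesgue_measure]_t (f (consrv (t, y)))%:E)%E.
Proof.
move=> hf; have mc := @measurable_consrv R n; have hc := integ_consrv hf.
rewrite (integral21_prod_meas1 hc)/=.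
rewrite (integral_pushforward mc)//.
by apply/measurable_EFinP; exact: integ_meas hf.
Qed.

End rV_int.

Section line.
Context {R : realType}.
Implicit Types g : R -> R.
Local Notation leb1 := (@lebesgue_measure R).

Lemma FTC_seg g g' (a b : R) : a < b -> (forall t, is_derive t (1:R) g (g' t)) -> continuous g' ->
  (\int[leb1]_(x in `[a, b]) (g' x)%:E = (g b)%:E - (g a)%:E)%E.
Proof.
move=> ab dg cg'.
have cg : continuous g.
  move=> t; apply: differentiable_continuous; apply/derivable1_diffP.
  by case: (dg t).
apply: continuous_FTC2 => //.
- exact: continuous_subspaceT.
- split.
  + by move=> x _; case: (dg x).
  + exact/cvg_at_right_filter/cg.
  + exact/cvg_at_left_filter/cg.
- by move=> x _; rewrite derive1E; apply: derive_val.
Qed.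

Lemma line_der0 g g' (r : R) : (forall t, is_derive t (1:R) g (g' t)) ->
  (forall t, r < `|t| -> g t = 0) -> forall t, r < `|t| -> g' t = 0.
Proof.
move=> dg hr t rt.
have -> : g' t = 'D_1 g t by rewrite derive_val.
rewrite (_ : 'D_1 g t = 'D_1 (cst (0:R)) t); first exact: derive_cst.
apply: near_eq_derive.
have : \forall s \near t, r < `|s|.
  have /cvgr_gt := @norm_continuous _ R t; exact.
by apply: filterS => s /hr.
Qed.

Lemma line_int0 g g' (r : R) : (forall t, is_derive t (1:R) g (g' t)) -> continuous g' ->
  (forall t, r < `|t| -> g t = 0) -> (\int[leb1]_t (g' t)%:E = 0)%E.
Proof.
move=> dg cg' hr; have g'0 := line_der0 dg hr.
pose M : R := `|r| + 1.
have M0 : 0 < M by rewrite ltr_wpDl.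
have rM : r < M by rewrite (le_lt_trans (ler_norm _))// ltrDl.
have -> : (\int[leb1]_t (g' t)%:E = \int[leb1]_(t in `[(- M)%R, M]) (g' t)%:E)%E.
  rewrite [RHS]integral_mkcond; apply: eq_integral => t _.
  rewrite patchE; case: ifPn => // /negP h; rewrite g'0//.
  rewrite ltNge; apply/negP => h'; apply: h.
  by rewrite inE /= in_itv /= -ler_norml (le_trans h')// ltW.
rewrite (FTC_seg (g := g)) ?gtrN//.
by rewrite !hr ?subee// ?normrN ger0_norm// ltW.
Qed.

(** Integrate from a point so far to the left that g vanishes there. *)
Lemma line_bound g g' (r t : R) : (forall t, is_derive t (1:R) g (g' t)) -> continuous g' ->
  (forall t, r < `|t| -> g t = 0) -> (`|g t|%:E <= \int[leb1]_s `|g' s|%:E)%E.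
Proof.
move=> dg cg' hr.
pose M : R := `|r| + `|t| + 1.
have Mt : - M < t.
  rewrite ltrNl (le_lt_trans (ler_norm _))// normrN /M -addrA.
  by rewrite ltr_wpDl// ltrDl.
have gM : g (- M) = 0.
  apply: hr; rewrite normrN ger0_norm ?addr_ge0//.
  by rewrite (le_lt_trans (ler_norm _))// /M -addrA ltrDl ltr_wpDl.
have E := FTC_seg Mt dg cg'.
rewrite gM sube0 in E.
have mg' : measurable_fun setT g' by exact: continuous_measurable_fun.
have -> : (`|g t|%:E = `| \int[leb1]_(x in `[(- M)%R, t]) (g' x)%:E |)%E by rewrite E.
apply: le_trans (le_abse_integral _ _ _) _ => //.
  by apply/measurable_EFinP; apply: measurable_funTS.
apply: ge0_subset_integral => //.
by apply/measurable_EFinP; apply: measurableT_comp.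
Qed.

End line.

Section slices.
Context {R : realType}.
Local Notation leb n := (@lebesgue_rV R n).

Lemma consrv0 n (t : R) (y : 'rV[R]_n) : consrv (t, y) ord0 ord0 = t.
Proof. by rewrite mxE unlift_none. Qed.

Lemma consrvS n (t : R) (y : 'rV[R]_n) j : consrv (t, y) ord0 (lift ord0 j) = y ord0 j.
Proof. by rewrite mxE liftK. Qed.

Lemma consrvP n (x y : 'rV[R]_n.+1) : x ord0 ord0 = y ord0 ord0 ->
  (forall j, x ord0 (lift ord0 j) = y ord0 (lift ord0 j)) -> x = y.
Proof. by move=> h0 h; apply/rowP => i; case: (unliftP ord0 i) => [j ->|->]. Qed.

Lemma consrv_lin n (t t' s : R) (y y' : 'rV[R]_n) :
  consrv (t, y) + s *: consrv (t', y') = consrv (t + s * t', y + s *: y').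
Proof.
apply: consrvP => [|j]; first by rewrite !mxE !unlift_none.
by rewrite !mxE !liftK /= !mxE.
Qed.

Lemma consrvB n (t t' : R) (y y' : 'rV[R]_n) :
  consrv (t, y) - consrv (t', y') = consrv (t - t', y - y').
Proof. by rewrite -scaleN1r consrv_lin mulN1r scaleN1r. Qed.

Lemma basis0 n : basis_vector ord0 = consrv (1, 0) :> 'rV[R]_n.+1.
Proof.
apply: consrvP => [|j]; first by rewrite !mxE unlift_none eqxx.
by rewrite !mxE liftK /= mxE.
Qed.

Lemma basisS n (j : 'I_n) : basis_vector (lift ord0 j) = consrv (0, basis_vector j) :> 'rV[R]_n.+1.
Proof.
apply: consrvP => [|k]; first by rewrite !mxE unlift_none.
by rewrite !mxE liftK /= mxE (inj_eq lift_inj).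
Qed.

Lemma consrv_norm_ge n (t : R) (y : 'rV[R]_n) : `|t| <= `|consrv (t, y)| /\ `|y| <= `|consrv (t, y)|.
Proof.
split; first by rewrite -{1}(consrv0 t y); exact: rV_coord_le.
by apply/rV_norm_le => // i; rewrite -(consrvS t y); exact: rV_coord_le.
Qed.

Lemma consrv_norm_le n (t : R) (y : 'rV[R]_n) (r : R) : 0 <= r -> `|t| <= r -> `|y| <= r ->
  `|consrv (t, y)| <= r.
Proof.
move=> r0 tr yr; apply/rV_norm_le => // i; case: (unliftP ord0 i) => [j|] ->.
  by rewrite consrvS; exact: le_trans (rV_coord_le _ _) yr.
by rewrite consrv0.
Qed.

Lemma consrv_contr n (t : R) : continuous (fun y : 'rV[R]_n => consrv (t, y)).
Proof.
move=> y; apply/(@cvgrPdist_le _ _ _ (nbhs y)) => e e0.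
have /(@cvgrPdist_le _ _ _ (nbhs y))/(_ e e0) : (fun z : 'rV[R]_n => z) @ y --> y by exact: cvg_id.
apply: filterS => z h; rewrite consrvB subrr; apply: consrv_norm_le => //; first exact: ltW.
by rewrite normr0 ltW.
Qed.

Lemma consrv_contl n (y : 'rV[R]_n) : continuous (fun t : R => consrv (t, y)).
Proof.
move=> t; apply/cvgrPdist_le => e e0.
have /cvgrPdist_le/(_ e e0) : (fun z : R => z) @ t --> t by exact: cvg_id.
apply: filterS => z h; rewrite consrvB subrr; apply: consrv_norm_le => //; first exact: ltW.
by rewrite normr0 ltW.
Qed.

Lemma is_derive_line n (f : 'rV[R]_n -> R) x v (t df : R) :
  is_derive (x + t *: v) v f df <-> is_derive t (1:R) (fun s => f (x + s *: v)) df.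
Proof.
have E : (fun h : R => h^-1 *: ((f \o shift (x + t *: v)) (h *: v) - f (x + t *: v))) =
  (fun h : R => h^-1 *: (((fun s => f (x + s *: v)) \o shift t) (h *: (1:R)) - f (x + t *: v))).
  apply/funext => h /=; congr (_ *: (f _ - _)).
  by rewrite scalerDl [h *: 1]mulr1 addrCA addrA.
have E1 : derivable f (x + t *: v) v = derivable (fun s : R => f (x + s *: v)) t (1:R) :=
  congr1 (fun F : R -> R => cvg (F @ (0 : R)^')) E.
have E2 : 'D_v f (x + t *: v) = 'D_(1:R) (fun s : R => f (x + s *: v)) t :=
  congr1 (fun F : R -> R => lim (F @ (0 : R)^')) E.
by split => -[d1 d2]; split; rewrite ?E1 ?E2// -?E1 -?E2.
Qed.

(** The derivative is a function supplied from outside, so that derivatives of sums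
    and products can be written down without unfolding limits. *)
Definition hasD n (i : 'I_n) (f f' : 'rV[R]_n -> R) :=
  forall x, is_derive x (basis_vector i) f (f' x).

Lemma hasD_bsupp n (i : 'I_n) f f' : hasD i f f' -> bsupp f -> bsupp f'.
Proof.
move=> hd [r hr]; exists r => x rx.
have <- : 'D_(basis_vector i) f x = f' x by case: (hd x).
rewrite (_ : 'D_(basis_vector i) f x = 'D_(basis_vector i) (cst (0:R)) x); first exact: derive_cst.
apply: near_eq_derive.
have : \forall s \near x, r < `|s|.
  have /cvgr_gt := @norm_continuous _ _ x; exact.
by apply: filterS => s /hr.
Qed.

Lemma hasD_sliceS n (j : 'I_n) (f f' : 'rV[R]_n.+1 -> R) t : hasD (lift ord0 j) f f' ->
  hasD j (fun y => f (consrv (t, y))) (fun y => f' (consrv (t, y))).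
Proof.
move=> hd y; have := hd (consrv (t, y)).
rewrite -[consrv (t, y)]addr0 -[X in _ + X](scale0r (basis_vector (lift ord0 j))).
move/is_derive_line => h.
rewrite -[X in is_derive X]addr0 -[X in _ + X](scale0r (basis_vector j)).
apply/is_derive_line; rewrite scale0r addr0.
rewrite scale0r addr0 in h; move: h; congr is_derive.
by apply/funext => s; rewrite basisS consrv_lin mulr0 addr0.
Qed.

Lemma hasD_slice0 n (f f' : 'rV[R]_n.+1 -> R) y : hasD ord0 f f' ->
  forall t, is_derive t (1:R) (fun t => f (consrv (t, y))) (f' (consrv (t, y))).
Proof.
move=> hd t; have := hd (consrv (t, y)).
have E s : consrv (s, y) = consrv (0, y) + s *: basis_vector ord0 :> 'rV[R]_n.+1.
  by rewrite basis0 consrv_lin mulr1 add0r scaler0 addr0.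
rewrite [X in is_derive X _ _ _]E => /is_derive_line; congr is_derive.
by apply/funext => s; rewrite -E.
Qed.

Lemma bsupp_sliceS n (f : 'rV[R]_n.+1 -> R) t : bsupp f -> bsupp (fun y => f (consrv (t, y))).
Proof.
by move=> [r hr]; exists r => y ry; apply: hr; apply: lt_le_trans ry (consrv_norm_ge _ _).2.
Qed.

Lemma cont_sliceS n (f : 'rV[R]_n.+1 -> R) t : continuous f -> continuous (fun y => f (consrv (t, y))).
Proof.
move=> cf y; apply: (continuous_comp (f := fun y => consrv (t, y))); first exact: consrv_contr.
exact: cf.
Qed.

Lemma cont_slice0 n (f : 'rV[R]_n.+1 -> R) (y : 'rV[R]_n) (cf : continuous f) : continuous (fun t => f (consrv (t, y))).
Proof.
move=> t; apply: (continuous_comp (f := fun t => consrv (t, y))); first exact: consrv_contl.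
exact: cf.
Qed.

(** Induction on the dimension: the first coordinate is integrated along its own
    lines, any other one inside the slices. *)
Lemma int_partial n (i : 'I_n) f f' : hasD i f f' -> continuous f -> continuous f' -> bsupp f ->
  \int[leb n]_x f' x = 0.
Proof.
elim: n i f f' => [[]//|n IH] i f f' hd cf cf' bf.
have bf' := hasD_bsupp hd bf.
have If' := cont_bsupp_integ cf' bf'.
apply/EFin_inj; rewrite -Rint_fin//; case: (unliftP ord0 i) hd => [j|] -> hd.
  rewrite fubini_cons//; under eq_integral => t _.
    rewrite Rint_fin; last by apply: cont_bsupp_integ; [exact: cont_sliceS|exact: bsupp_sliceS].
    rewrite (IH j (fun y => f (consrv (t, y)))).
    - over.
    - exact: hasD_sliceS.
    - exact: cont_sliceS.
    - exact: cont_sliceS.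
    - exact: bsupp_sliceS.
  by rewrite integral0.
rewrite fubini_cons_swap//; have [r hr] := bf.
under eq_integral => y _.
  rewrite (line_int0 (hasD_slice0 y hd) (cont_slice0 (f := f') (y := y) cf') (r := r)).
    over.
  by move=> t rt; apply: hr; apply: lt_le_trans rt (consrv_norm_ge _ _).1.
by rewrite integral0.
Qed.

Lemma slice_bound n f f' t (y : 'rV[R]_n) : hasD ord0 f f' -> continuous f' -> bsupp f ->
  (`|f (consrv (t, y))|%:E <= \int[lebesgue_measure]_s `|f' (consrv (s, y))|%:E)%E.
Proof.
move=> hd cf' [r hr].
apply: (line_bound (r := r) t (hasD_slice0 y hd)); first exact: cont_slice0.
by move=> s rs; apply: hr; apply: lt_le_trans rs (consrv_norm_ge _ _).1.
Qed.

End slices.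

(** * Smooth functions, test functions and the chain rule *)

Section smooth.
Context {R : realType} {d : nat}.
Implicit Types (f g : 'rV[R]_d -> R) (i : 'I_d).

Lemma hasD_cst c i : hasD i (fun _ => c : R) (fun=> 0).
Proof. by move=> x; exact: is_derive_cst. Qed.

Lemma hasDD i f f' g g' : hasD i f f' -> hasD i g g' ->
  hasD i (fun x => f x + g x) (fun x => f' x + g' x).
Proof. by move=> hf hg x; have H1 := hf x; have H2 := hg x; exact: is_deriveD. Qed.

Lemma hasDM i f f' g g' : hasD i f f' -> hasD i g g' ->
  hasD i (fun x => f x * g x) (fun x => f x * g' x + g x * f' x).
Proof. by move=> hf hg x; have H1 := hf x; have H2 := hg x; exact: is_deriveM. Qed.

Lemma hasDZ i f f' c : hasD i f f' -> hasD i (fun x => c * f x) (fun x => c * f' x).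
Proof.
move=> hf x; have := hasDM (hasD_cst c i) hf x; rewrite mulr0 addr0; exact.
Qed.

Lemma hasD_coord i j : hasD i (fun x : 'rV[R]_d => x ord0 j) (fun=> (i == j)%:R).
Proof.
move=> x; rewrite -[x]addr0 -[X in _ + X](scale0r (basis_vector i)).
apply/is_derive_line.
rewrite (_ : (fun s : R => _) = (fun s => x ord0 j + s * (i == j)%:R)); last first.
  by apply/funext => s; rewrite !mxE eqxx /= eq_sym.
have H := is_deriveM (is_derive_id (0:R) (1:R)) (is_derive_cst ((i == j)%:R : R) (0:R) (1:R)).
have H' := is_deriveD (is_derive_cst (x ord0 j) (0:R) (1:R)) H.
apply: is_derive_eq H' _.
by rewrite add0r scaler0 add0r /GRing.scale /= mulr1.
Qed.

Lemma hasD_partial i f f' : hasD i f f' -> partial i f = f'.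
Proof. by move=> hf; apply/funext => x; case: (hf x). Qed.

Lemma derivable_hasD i f : (forall x, derivable f x (basis_vector i)) -> hasD i f (partial i f).
Proof. by move=> h x; apply: DeriveDef. Qed.

(** Unlike the iterated partial derivatives that define smooth, this recursive form
    passes to products and inverses by induction on k. *)
Fixpoint Ck k f := continuous f /\
  (if k is k'.+1 then forall i, exists2 f', hasD i f f' & Ck k' f' else True).

Lemma smoothP f : smooth f <-> forall k, Ck k f.
Proof.
split => [sf k|].
  elim: k f sf => [|k IH] f sf; first by split => //; case: (sf [::]).
  split; first by case: (sf [::]).
  move=> i; exists (partial i f).
    by apply: derivable_hasD; case: (sf [::]).
  apply: IH => s; have := sf (rcons s i); rewrite /partials foldr_rcons; exact.
move=> H s; elim/last_ind: s f H => [|s i IH] f H.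
  split; first by case: (H 0).
  by move=> i x; have [_ /(_ i)[f' hf _]] := H 1; case: (hf x).
rewrite /partials foldr_rcons; apply: IH => k.
by have [_ /(_ i)[f' /hasD_partial -> ]] := H k.+1.
Qed.

Lemma CkW k f : Ck k.+1 f -> Ck k f.
Proof.
elim: k f => [|k IH] f [cf H]; first by split.
split=> // i; have [f' hf cf'] := H i; exists f' => //; exact: IH.
Qed.

Lemma Ck_cst k c : Ck k (fun _ => c).
Proof.
elim: k c => [|k IH] c; split => //; try by move=> x; exact: cst_continuous.
by move=> i; exists (fun=> 0) => //; exact: hasD_cst.
Qed.

Lemma CkD k f g : Ck k f -> Ck k g -> Ck k (fun x => f x + g x).
Proof.
elim: k f g => [|k IH] f g [cf hf] [cg hg]; split => //.
- by move=> x; apply: continuousD; [exact: cf|exact: cg].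
- by move=> x; apply: continuousD; [exact: cf|exact: cg].
- move=> i; have [f' df cf'] := hf i; have [g' dg cg'] := hg i.
  exists (fun x => f' x + g' x); [exact: hasDD|exact: IH].
Qed.

Lemma CkM k f g : Ck k f -> Ck k g -> Ck k (fun x => f x * g x).
Proof.
elim: k f g => [|k IH] f g Hf Hg; have [cf hf] := Hf; have [cg hg] := Hg; split => //.
- by move=> x; apply: continuousM; [exact: cf|exact: cg].
- by move=> x; apply: continuousM; [exact: cf|exact: cg].
- move=> i; have [f' df cf'] := hf i; have [g' dg cg'] := hg i.
  exists (fun x => f x * g' x + g x * f' x); first exact: hasDM.
  by apply: CkD; apply: IH => //; exact: CkW.
Qed.

Lemma Ck_coord k j : Ck k (fun x : 'rV[R]_d => x ord0 j).
Proof.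
case: k => [|k]; split => //; [exact: coord_cont|exact: coord_cont|].
move=> i; exists (fun=> (i == j)%:R); [exact: hasD_coord|exact: Ck_cst].
Qed.

Lemma CkV k f : (forall x, f x != 0) -> Ck k f -> Ck k (fun x => (f x)^-1).
Proof.
move=> f0; elim: k => [|k IH] Hf; have [cf hf] := Hf; split => //.
- by move=> x; apply: continuousV; [exact: f0|exact: cf].
- by move=> x; apply: continuousV; [exact: f0|exact: cf].
- move=> i; have [f' df cf'] := hf i.
  exists (fun x => -1 * ((f x)^-1 * (f x)^-1 * f' x)).
    move=> x; have [h1 h2] := df x; split; first exact: derivableV.
    by rewrite deriveV// h2 mulN1r scaleNr -invfM -expr2.
  have Hf' := CkW Hf.
  by apply: CkM; [exact: Ck_cst|apply: CkM => //; apply: CkM; exact: IH].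
Qed.

Lemma smooth_cst c : smooth (fun _ : 'rV[R]_d => c). Proof. by apply/smoothP => k; exact: Ck_cst. Qed.
Lemma smooth_coord j : smooth (fun x : 'rV[R]_d => x ord0 j).
Proof. by apply/smoothP => k; exact: Ck_coord. Qed.
Lemma smoothD f g : smooth f -> smooth g -> smooth (fun x => f x + g x).
Proof. by move=> /smoothP hf /smoothP hg; apply/smoothP => k; exact: CkD. Qed.
Lemma smoothM f g : smooth f -> smooth g -> smooth (fun x => f x * g x).
Proof. by move=> /smoothP hf /smoothP hg; apply/smoothP => k; exact: CkM. Qed.
Lemma smoothV f : (forall x, f x != 0) -> smooth f -> smooth (fun x => (f x)^-1).
Proof. by move=> f0 /smoothP hf; apply/smoothP => k; exact: CkV. Qed.
Lemma smooth_partial i f : smooth f -> smooth (partial i f).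
Proof. by move=> sf s; have := sf (rcons s i); rewrite /partials foldr_rcons; exact. Qed.
Lemma smooth_cont f : smooth f -> continuous f.
Proof. by move=> sf; case: (sf [::]). Qed.
Lemma smooth_hasD i f : smooth f -> hasD i f (partial i f).
Proof. by move=> sf; apply: derivable_hasD; case: (sf [::]) => _ ; exact. Qed.
Lemma smooth_sum (I : Type) (s : seq I) (F : I -> 'rV[R]_d -> R) :
  (forall j, smooth (F j)) -> smooth (fun x => \sum_(j <- s) F j x).
Proof.
move=> h; elim: s => [|j s IH].
  rewrite (_ : (fun _ => _) = fun=> 0); first exact: smooth_cst.
  by apply/funext => x; rewrite big_nil.
rewrite (_ : (fun _ => _) = fun x => F j x + \sum_(j <- s) F j x); first exact: smoothD.
by apply/funext => x; rewrite big_cons.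
Qed.

Definition ctest f := smooth f /\ bsupp f.

Lemma ctestD f g : ctest f -> ctest g -> ctest (fun x => f x + g x).
Proof.
move=> [sf [r hr]] [sg [s hs]]; split; first exact: smoothD.
by exists (Num.max r s) => x; rewrite gt_max => /andP[/hr -> /hs ->]; rewrite addr0.
Qed.
Lemma ctestM f g : ctest f -> smooth g -> ctest (fun x => f x * g x).
Proof.
move=> [sf [r hr]] sg; split; first exact: smoothM.
by exists r => x /hr ->; rewrite mul0r.
Qed.
Lemma ctestZ c f : ctest f -> ctest (fun x => c * f x).
Proof.
move=> [sf [r hr]]; split; first by apply: smoothM => //; exact: smooth_cst.
by exists r => x /hr ->; rewrite mulr0.
Qed.
Lemma ctest0 : ctest (fun _ : 'rV[R]_d => 0).
Proof. by split; [exact: smooth_cst|exists 0]. Qed.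
Lemma ctest_partial i f : ctest f -> ctest (partial i f).
Proof.
move=> [sf bf]; split; first exact: smooth_partial.
apply: hasD_bsupp bf; exact: smooth_hasD.
Qed.
Lemma ctest_sqint f : ctest f -> sqint (lebesgue_rV d) f.
Proof. by move=> [sf bf]; apply: cont_bsupp_sqint => //; exact: smooth_cont. Qed.

Lemma enorm_ge (x : 'rV[R]_d) : `|x| <= enorm x.
Proof.
apply/rV_norm_le => [|i]; first exact: sqrtr_ge0.
rewrite -sqrtr_sqr ler_wsqrtr// (bigD1 i)//= lerDl sumr_ge0// => j _; exact: sqr_ge0.
Qed.

Lemma enorm_sqr (x : 'rV[R]_d) : enorm x ^+ 2 = \sum_i x ord0 i ^+ 2.
Proof. by rewrite sqr_sqrtr// sumr_ge0// => j _; exact: sqr_ge0. Qed.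

Lemma enorm_le (x : 'rV[R]_d) : enorm x <= d%:R * `|x|.
Proof.
rewrite -ler_sqr ?nnegrE ?sqrtr_ge0 ?mulr_ge0// enorm_sqr.
have -> : (d%:R * `|x|) ^+ 2 = d%:R * (\sum_(i < d) `|x| ^+ 2).
  by rewrite sumr_const card_ord -mulr_natl; ring.
have h : \sum_i x ord0 i ^+ 2 <= \sum_(i < d) `|x| ^+ 2.
  apply: ler_sum => i _; rewrite -real_normK ?num_real//.
  by rewrite ler_sqr ?nnegrE// rV_coord_le.
apply: le_trans h _; case: (posnP d) => [d0|d0].
  by rewrite big1 ?mulr0// => -[i hi]; exfalso; rewrite d0 in hi.
by rewrite ler_peMl ?sumr_ge0 ?ler1n// => i _; exact: sqr_ge0.
Qed.

Lemma enorm_bsupp f : (exists r, forall x, r < enorm x -> f x = 0) <-> bsupp f.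
Proof.
split => -[r hr].
  by exists r => x rx; apply: hr; apply: lt_le_trans rx (enorm_ge x).
case: (posnP d) => [d0|d0].
  exists 0 => x; rewrite ltNge => /negP[]; apply: le_trans (enorm_le x) _.
  have -> : d%:R = 0 :> R by rewrite d0.
  by rewrite mul0r.
exists (d%:R * r) => x; move=> /lt_le_trans/(_ (enorm_le x)).
by rewrite ltr_pM2l ?ltr0n// => /hr.
Qed.

End smooth.

Section chain.
Context {R : realType}.

(** First-order expansions compose well, difference quotients do not. *)
Lemma is_derive1P (g : R -> R) (t l : R) : is_derive t (1:R) g l <->
  forall e : R, 0 < e -> exists2 del : R, 0 < del &
    forall h, `|h| < del -> `|g (t + h) - g t - h * l| <= e * `|h|.
Proof.
split => [[dg gl] e e0|H].
  have : h^-1 *: ((g \o shift t) (h *: (1:R)) - g t) @[h --> (0:R)^'] --> l by rewrite -gl; exact: dg.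
  move=> /cvgrPdist_le/(_ e e0) [del /= del0 hd]; exists del => // h hh.
  have [->|h0] := eqVneq h 0; first by rewrite addr0 subrr mul0r subrr normr0 mulr0.
  have := hd h; rewrite /= sub0r normrN => /(_ hh h0).
  rewrite [h *: 1]mulr1 [h + t]addrC => hl.
  rewrite (_ : _ - _ - _ = - h * (l - h^-1 *: (g (t + h) - g t))); last first.
    by rewrite /GRing.scale /= mulrBr mulNr mulNr opprK mulrA mulfV// mul1r addrC.
  by rewrite normrM normrN mulrC ler_wpM2r.
have C : h^-1 *: ((g \o shift t) (h *: (1:R)) - g t) @[h --> (0:R)^'] --> l.
  apply/cvgrPdist_le => e e0; have [del del0 hd] := H e e0.
  exists del => // h; rewrite /= sub0r normrN => hh h0.
  have := hd h hh; rewrite [h *: 1]mulr1 [h + t]addrC => hl.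
  rewrite (_ : l - _ = - h^-1 * (g (t + h) - g t - h * l)); last first.
    by rewrite /GRing.scale /=; field.
  by rewrite normrM normrN normfV mulrC ler_pdivrMr ?normr_gt0.
split; first by apply/cvg_ex; exists l.
exact/cvg_lim.
Qed.

Lemma MVT_pt (g g' : R -> R) (a : R) : (forall t, is_derive t (1:R) g (g' t)) ->
  exists2 c, `|c| <= `|a| & g a - g 0 = a * g' c.
Proof.
move=> dg.
have cg : continuous g.
  move=> t; apply: differentiable_continuous; apply/derivable1_diffP.
  by case: (dg t).
have [a0|a0|<-] := ltgtP 0 a.
- have [c] := @MVT _ g g' _ _ a0 (fun x _ => dg x) (continuous_subspaceT cg).
  + rewrite in_itv /= => /andP[c0 ca] E; exists c; last by rewrite E subr0 mulrC.
    by rewrite !gtr0_norm// ltW.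
- have [c] := @MVT _ g g' _ _ a0 (fun x _ => dg x) (continuous_subspaceT cg).
  + rewrite in_itv /= => /andP[c0 ca] E; exists c; last first.
      by rewrite -opprB E sub0r mulrN opprK mulrC.
    by rewrite !ltr0_norm// lerN2 ltW.
- by exists 0 => //; rewrite subrr mul0r.
Qed.

Variable d : nat.
Variables (i j : 'I_d) (f fi fj : 'rV[R]_d -> R).
Hypotheses (hi : hasD i f fi) (hj : hasD j f fj) (ci : continuous fi) (cj : continuous fj).

Lemma basis_norm (k : 'I_d) : `|basis_vector k : 'rV[R]_d| <= 1.
Proof.
by apply/rV_norm_le => // l; rewrite mxE; rewrite eqxx /=; case: (l == k); rewrite ?normr1 ?normr0.
Qed.

Lemma hasD_line k (g g' : 'rV[R]_d -> R) x : hasD k g g' ->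
  forall t, is_derive t (1:R) (fun s : R => g (x + s *: basis_vector k)) (g' (x + t *: basis_vector k)).
Proof. by move=> hg t; apply/is_derive_line; exact: hg. Qed.

(** Change one coordinate at a time and apply the mean value theorem to each change;
    continuity of the two partial derivatives controls the intermediate points. *)
Lemma first_order2 (z : 'rV[R]_d) (e : R) : 0 < e -> exists2 del : R, 0 < del &
  forall a b : R, `|a| < del -> `|b| < del ->
  `|f (z + a *: basis_vector i + b *: basis_vector j) - f z - a * fi z - b * fj z| <= e * (`|a| + `|b|).
Proof.
move=> e0.
have H (g : 'rV[R]_d -> R) : continuous g -> exists2 del, 0 < del & forall w, `|w| < del -> `|g (z + w) - g z| <= e.
  move=> cg; have /cvgrPdist_le/(_ e e0)/nbhs_ballP[del /= del0 hd] := cg z.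
  exists del => // w hw; rewrite distrC; apply: hd.
  by rewrite -ball_normE /= opprD addrA subrr sub0r normrN.
have [d1 d10 h1] := H fi ci; have [d2 d20 h2] := H fj cj.
exists (Num.min d1 d2 / 2); first by rewrite divr_gt0 // lt_min d10 d20.
move=> a b ha hb.
have [c ca Ea] := MVT_pt a (hasD_line z hi).
have [c' cb Eb] := MVT_pt b (hasD_line (z + a *: basis_vector i) hj).
rewrite !scale0r !addr0 in Ea Eb.
rewrite (_ : _ - _ - _ - _ = a * (fi (z + c *: basis_vector i) - fi z) +
   b * (fj (z + a *: basis_vector i + c' *: basis_vector j) - fj z)); last first.
  by rewrite !mulrBr -Ea -Eb; ring.
have nb (k : 'I_d) (s : R) : `|s *: (basis_vector k : 'rV[R]_d)| <= `|s|.
  by rewrite normrZ ler_piMr// basis_norm.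
have m1 : Num.min d1 d2 <= d1 by rewrite ge_min lexx.
have m2 : Num.min d1 d2 <= d2 by rewrite ge_min lexx orbT.
have m0 : 0 < Num.min d1 d2 by rewrite lt_min d10 d20.
apply: le_trans (ler_normD _ _) _; rewrite !normrM mulrDr; apply: lerD; rewrite mulrC ler_wpM2r//.
- apply: h1; apply: le_lt_trans (nb _ _) _; lra.
- rewrite -addrA; apply: h2; apply: le_lt_trans (ler_normD _ _) _.
  have := nb i a; have := nb j c'; lra.
Qed.

(** A rotation only moves a point in the plane of two coordinates, so the chain rule
    along curves in such planes is enough. *)
Lemma chain_rule2 (x : 'rV[R]_d) (p q : R -> R) (t p' q' : R) :
  is_derive t (1:R) p p' -> is_derive t (1:R) q q' ->
  let z := x + p t *: basis_vector i + q t *: basis_vector j in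
  is_derive t (1:R) (fun s => f (x + p s *: basis_vector i + q s *: basis_vector j))
    (p' * fi z + q' * fj z).
Proof.
move=> /is_derive1P dp /is_derive1P dq z; apply/is_derive1P => e e0.
set F := `|fi z| + `|fj z| + 1; set P := `|p'| + `|q'| + 2.
have F0 : 0 < F by rewrite ltr_wpDl// addr_ge0.
have P0 : 0 < P by rewrite ltr_wpDl// addr_ge0.
(* The errors of p and q, controlled by eta, and that of f, controlled by e', each
   account for half of e. *)
set eta := Num.min 1 (e / (2 * F)).
have eta0 : 0 < eta by rewrite lt_min ltr01 divr_gt0// mulr_gt0.
have eta1 : eta <= 1 by rewrite ge_min lexx.
have etaF : eta * F <= e / 2.
  rewrite -ler_pdivlMr// (_ : e / 2 / F = e / (2 * F)); last by rewrite invfM mulrA.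
  by rewrite ge_min lexx orbT.
have e'0 : 0 < e / (2 * P) by rewrite divr_gt0// mulr_gt0.
have e'P : e / (2 * P) * P = e / 2 by rewrite invfM !mulrA divfK// gt_eqF.
set e' := e / (2 * P) in e'0 e'P.
have [d3 d30 h3] := first_order2 z e'0.
have [d1 d10 h1] := dp _ eta0; have [d2 d20 h2] := dq _ eta0.
exists (Num.min (d3 / P) (Num.min d1 d2)); first by rewrite !lt_min d10 d20 divr_gt0.
move=> h; rewrite !lt_min => /and3P[H3 /h1 H1 /h2 H2].
set a := p (t + h) - p t in H1; set b := q (t + h) - q t in H2.
have ha : `|a| <= (`|p'| + 1) * `|h|.
  rewrite -[a](subrK (h * p')); apply: le_trans (ler_normD _ _) _.
  rewrite normrM mulrDl mul1r addrC [`|h| * _]mulrC lerD2l; apply: le_trans H1 _.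
  by rewrite ler_piMl.
have hb : `|b| <= (`|q'| + 1) * `|h|.
  rewrite -[b](subrK (h * q')); apply: le_trans (ler_normD _ _) _.
  rewrite normrM mulrDl mul1r addrC [`|h| * _]mulrC lerD2l; apply: le_trans H2 _.
  by rewrite ler_piMl.
have hP : P * `|h| < d3 by rewrite mulrC -ltr_pdivlMr.
have n0 := normr_ge0 h; have n1 := normr_ge0 p'; have n2 := normr_ge0 q'.
have Pge : (`|p'| + 1) * `|h| + (`|q'| + 1) * `|h| = P * `|h| by rewrite /P; ring.
have Pa : 0 <= (`|p'| + 1) * `|h| by rewrite mulr_ge0// addr_ge0.
have Pb : 0 <= (`|q'| + 1) * `|h| by rewrite mulr_ge0// addr_ge0.
have := h3 a b ltac:(lra) ltac:(lra).
have -> : z + a *: basis_vector i + b *: basis_vector j =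
  x + p (t + h) *: basis_vector i + q (t + h) *: basis_vector j.
  by rewrite /z /a /b; apply/rowP => k; rewrite !mxE; ring.
set A := f _; rewrite -/z => h4.
rewrite (_ : A - f z - _ = (A - f z - a * fi z - b * fj z) + ((a - h * p') * fi z + (b - h * q') * fj z)); last by ring.
apply: le_trans (ler_normD _ _) _.
have h5 : `|(a - h * p') * fi z + (b - h * q') * fj z| <= eta * `|h| * F.
  apply: le_trans (ler_normD _ _) _; rewrite !normrM /F.
  have g1 : `|a - h * p'| * `|fi z| <= eta * `|h| * `|fi z| by rewrite ler_wpM2r.
  have g2 : `|b - h * q'| * `|fj z| <= eta * `|h| * `|fj z| by rewrite ler_wpM2r.
  have g3 : 0 <= eta * `|h| by rewrite mulr_ge0// ltW.
  lra.
have h6 : e' * (`|a| + `|b|) <= e' * (P * `|h|) by rewrite ler_pM2l//; lra.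
have h7 : e' * (P * `|h|) = e / 2 * `|h| by rewrite mulrA e'P.
have h8 : eta * `|h| * F <= e / 2 * `|h|.
  by rewrite mulrAC ler_wpM2r.
lra.
Qed.

End chain.

(** * The real energy space and the angular derivative *)

Lemma seq_lim_eq (R : realType) (u v : nat -> R) (l k : R) :
  u n @[n --> \oo] --> l -> v n @[n --> \oo] --> k -> (forall n, u n = v n) -> l = k.
Proof.
move=> cu cv uv; have E : u = v by apply/funext.
rewrite -(cvg_lim _ cu)// -(cvg_lim _ cv)// E//.
Qed.

Section ibp.
Context {R : realType} {d : nat}.
Local Notation mu := (@lebesgue_rV R d).
Implicit Types f g a b : 'rV[R]_d -> R.

Lemma meas_coord i : measurable_fun setT (fun x : 'rV[R]_d => x ord0 i).
Proof. by apply: (@cont_meas R d (fun x => x ord0 i)); exact: coord_cont. Qed.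

Lemma rV_contM f g : continuous f -> continuous g -> continuous (fun x => f x * g x).
Proof. by move=> cf cg x; apply: continuousM; [exact: cf|exact: cg]. Qed.

Lemma rV_contD f g : continuous f -> continuous g -> continuous (fun x => f x + g x).
Proof. by move=> cf cg x; apply: continuousD; [exact: cf|exact: cg]. Qed.

Lemma ibp i f f' g g' : hasD i f f' -> hasD i g g' -> continuous f -> continuous f' ->
  continuous g -> continuous g' -> bsupp f ->
  \int[mu]_x (f' x * g x) = - \int[mu]_x (f x * g' x).
Proof.
move=> df dg cf cf' cg cg' bf; have [r hr] := bf; have [r' hr'] := hasD_bsupp df bf.
have cM (u v : 'rV[R]_d -> R) : continuous u -> continuous v -> continuous (fun x => u x * v x).
  by move=> cu cv x; apply: continuousM; [exact: cu|exact: cv].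
have I1 : integ mu (fun x => f' x * g x).
  by apply: cont_bsupp_integ; [exact: cM|exists r' => x /hr' ->; rewrite mul0r].
have I2 : integ mu (fun x => f x * g' x).
  by apply: cont_bsupp_integ; [exact: cM|exists r => x /hr ->; rewrite mul0r].
apply/eqP; rewrite -addr_eq0 -RintD//; apply/eqP.
have H := hasDM df dg.
rewrite -[RHS](int_partial H).
- by congr Rintegral; apply/funext => x; ring.
- exact: cM.
- by apply: rV_contD; exact: cM.
- by exists r => x /hr ->; rewrite mul0r.
Qed.

Lemma bsuppM f g : bsupp f -> bsupp (fun x => g x * f x).
Proof. by move=> [r hr]; exists r => x /hr ->; rewrite mulr0. Qed.

End ibp.

Section rH1.
Context {R : realType} {d : nat}.
Local Notation mu := (@lebesgue_rV R d).
Implicit Types f g a b : 'rV[R]_d -> R.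
Variable V : 'rV[R]_d -> R.
Hypothesis cV : continuous V.
Hypothesis V0 : forall x, 0 <= V x.

Let sV x := Num.sqrt (V x).

Lemma sV_cont : continuous sV.
Proof.
move=> x; apply: (continuous_comp (f := V)); first exact: cV.
exact: sqrt_continuous.
Qed.

(** The real energy space: a is in the completion of the test functions, and p is the
    limit of the gradients. *)
Definition rH1 a (p : 'I_d -> 'rV[R]_d -> R) := exists f : nat -> 'rV[R]_d -> R,
  [/\ forall n, ctest (f n), L2cvg mu f a,
      L2cvg mu (fun n x => sV x * f n x) (fun x => sV x * a x) &
      forall i, L2cvg mu (fun n => partial i (f n)) (p i)].

Lemma sV_test f : ctest f -> sqint mu (fun x => sV x * f x).
Proof.
move=> [sf bf]; apply: cont_bsupp_sqint; last exact: bsuppM.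
by move=> x; apply: continuousM; [exact: sV_cont|exact: smooth_cont].
Qed.

Lemma rH1_test f : ctest f -> rH1 f (partial^~ f).
Proof.
move=> cf; exists (fun=> f); split => //.
- exact/L2cvg_cst/ctest_sqint.
- exact/L2cvg_cst/sV_test.
- by move=> i; exact/L2cvg_cst/ctest_sqint/ctest_partial.
Qed.

Lemma partial_lin i f g (s t : R) : smooth f -> smooth g ->
  partial i (fun x => s * f x + t * g x) = (fun x => s * partial i f x + t * partial i g x).
Proof.
by move=> sf sg; apply: hasD_partial; apply: hasDD; apply: hasDZ; exact: smooth_hasD.
Qed.

Lemma rH1_lin a p b q (s t : R) : rH1 a p -> rH1 b q ->
  rH1 (fun x => s * a x + t * b x) (fun i x => s * p i x + t * q i x).
Proof.
move=> [f [tf fa fVa fp]] [g [tg gb gVb gq]].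
exists (fun n x => s * f n x + t * g n x); split.
- by move=> n; apply: ctestD; exact: ctestZ.
- exact: L2cvg_lin.
- have := L2cvg_lin s t fVa gVb; congr (L2cvg mu _ _); [apply/funext => n|];
    by apply/funext => x; ring.
- move=> i; have := L2cvg_lin s t (fp i) (gq i); congr (L2cvg mu _ _).
  apply/funext => n; rewrite partial_lin//; [by case: (tf n)|by case: (tg n)].
Qed.

Lemma rH1_sqint a p : rH1 a p ->
  [/\ sqint mu a, sqint mu (fun x => sV x * a x) & forall i, sqint mu (p i)].
Proof. by move=> [f [_ [_ h1 _] [_ h2 _] h3]]; split => // i; case: (h3 i). Qed.

Lemma rH1_ibp a p i f f' : rH1 a p -> hasD i f f' -> continuous f -> continuous f' ->
  bsupp f -> \int[mu]_x (p i x * f x) = - \int[mu]_x (a x * f' x).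
Proof.
move=> [g [tg ga _ gp]] df cf cf' bf.
have c1 := L2cvg_inner (gp i) (L2cvg_cst (cont_bsupp_sqint cf bf)).
have c2 := L2cvg_inner ga (L2cvg_cst (cont_bsupp_sqint cf' (hasD_bsupp df bf))).
have c3 : (- \int[mu]_x (g n x * f' x)) @[n --> \oo] --> - \int[mu]_x (a x * f' x) by exact: cvgN.
apply: (seq_lim_eq c1 c3) => n; have [sg bg] := tg n.
exact: (ibp (smooth_hasD i sg) df (smooth_cont sg) (smooth_cont (smooth_partial i sg)) cf cf' bg).
Qed.

(** Integration by parts makes p i orthogonal to test functions, of which it is a
    limit; so it is orthogonal to itself. *)
Lemma rH1_grad0 a p i : rH1 a p -> {ae mu, forall x, a x = 0} -> {ae mu, forall x, p i x = 0}.
Proof.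
move=> H a0; have [sa _ sp] := rH1_sqint H.
have Z f : ctest f -> \int[mu]_x (p i x * f x) = 0.
  move=> tf; have [sf bf] := tf.
  rewrite (rH1_ibp H (smooth_hasD i sf))//; last first.
  - exact/smooth_cont/smooth_partial.
  - exact: smooth_cont.
  have I1 := sqintM sa (ctest_sqint (ctest_partial i tf)).
  have [] := Rint_ae (f := fun x => a x * partial i f x) (g := cst 0) I1 => //.
    by apply: filterS a0 => x -> ; rewrite mul0r.
  by move=> _ ->; rewrite Rintegral_cst// mul0r oppr0.
have [f [tf _ _ /(_ i) fp]] := H.
have c := L2cvg_inner (L2cvg_cst (sp i)) fp.
have E : \int[mu]_x (p i x * p i x) = 0.
  apply: (seq_lim_eq c (cvg_cst 0)) => n; apply: Z; exact: ctest_partial.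
exact: sqint_eq0.
Qed.

Lemma rH1_grad_unique a p a' p' i : rH1 a p -> rH1 a' p' -> {ae mu, forall x, a x = a' x} ->
  {ae mu, forall x, p i x = p' i x}.
Proof.
move=> H H' aa'; have := rH1_grad0 i (rH1_lin 1 (-1) H H').
have a0 : {ae mu, forall x, 1 * a x + -1 * a' x = 0}.
  by apply: filterS aa' => x ->; rewrite mul1r mulN1r subrr.
by move=> /(_ a0); apply: filterS => x; rewrite mul1r mulN1r => /subr0_eq.
Qed.

Hypothesis Vg : exists2 C, 0 <= C & forall (x : 'rV[R]_d) i, (x ord0 i) ^+ 2 <= C * (1 + V x).

(** This is what makes angular momentum a form on the whole energy space. *)
Lemma coord_sqint a i : sqint mu a -> sqint mu (fun x => sV x * a x) -> sqint mu (fun x => x ord0 i * a x).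
Proof.
move=> [ma ia] [_ iVa]; have [C C0 hC] := Vg.
apply: (sqint_le (g := fun x => C * (a x ^+ 2 + (sV x * a x) ^+ 2))).
- by apply: measurable_funM => //; exact: meas_coord.
- exact/integZ/integD.
- move=> x; rewrite !exprMn /sV sqr_sqrtr//.
  have := ler_wpM2r (sqr_ge0 (a x)) (hC x i); lra.
Qed.

Lemma coord_L2cvg (f : nat -> 'rV[R]_d -> R) a i : (forall n, ctest (f n)) -> L2cvg mu f a ->
  L2cvg mu (fun n x => sV x * f n x) (fun x => sV x * a x) ->
  L2cvg mu (fun n x => x ord0 i * f n x) (fun x => x ord0 i * a x).
Proof.
move=> tf c1 c2; have [C C0 hC] := Vg.
have [h1 h2 _] := c1; have [h3 h4 _] := c2.
apply: (L2cvg_dom (C := C) c1 c2).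
- by move=> n; exact: coord_sqint.
- exact: coord_sqint.
- move=> n x; rewrite -!mulrBr !exprMn /sV sqr_sqrtr//.
  have := ler_wpM2r (sqr_ge0 (f n x - a x)) (hC x i); lra.
Qed.

End rH1.

Section angular.
Context {R : realType} {n : nat}.
Local Notation d := n.+2.
Local Notation mu := (@lebesgue_rV R d).
Implicit Types f g a b : 'rV[R]_d -> R.
Variable V : 'rV[R]_d -> R.
Hypothesis cV : continuous V.
Hypothesis V0 : forall x, 0 <= V x.
Hypothesis Vg : exists2 C, 0 <= C & forall (x : 'rV[R]_n.+2) i, (x ord0 i) ^+ 2 <= C * (1 + V x).
Local Notation x1 x := (x ord0 (@axis1 n)).
Local Notation x2 x := (x ord0 (@axis2 n)).

(** The rotation field x1 d2 - x2 d1 applied to a function of gradient p. *)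
Definition ang (p : 'I_d -> 'rV[R]_d -> R) (x : 'rV[R]_d) : R :=
  x1 x * p (@axis2 n) x - x2 x * p (@axis1 n) x.

Lemma ang_meas p : (forall i, measurable_fun setT (p i)) -> measurable_fun setT (ang p).
Proof.
by move=> mp; apply: measurable_funB; apply: measurable_funM => //; exact: meas_coord.
Qed.

Lemma ang_integ a p b q : rH1 V a p -> rH1 V b q -> integ mu (fun x => ang p x * b x).
Proof.
move=> /rH1_sqint[_ _ sp] /rH1_sqint[sb sVb _].
have h1 := sqintM (sp (@axis2 n)) (coord_sqint V0 Vg (@axis1 n) sb sVb).
have h2 := sqintM (sp (@axis1 n)) (coord_sqint V0 Vg (@axis2 n) sb sVb).
have := integB h1 h2; congr (integ mu _); apply/funext => x; rewrite /ang; ring.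
Qed.

Lemma ang_intE a p b q : rH1 V a p -> rH1 V b q ->
  \int[mu]_x (ang p x * b x) = \int[mu]_x (p (@axis2 n) x * (x1 x * b x)) -
                               \int[mu]_x (p (@axis1 n) x * (x2 x * b x)).
Proof.
move=> /rH1_sqint[_ _ sp] /rH1_sqint[sb sVb _].
have h1 := sqintM (sp (@axis2 n)) (coord_sqint V0 Vg (@axis1 n) sb sVb).
have h2 := sqintM (sp (@axis1 n)) (coord_sqint V0 Vg (@axis2 n) sb sVb).
rewrite -RintB//; congr Rintegral; apply/funext => x; rewrite /ang; ring.
Qed.

(** The rotation field is divergence free, each derivative being multiplied by the
    other coordinate. *)
Lemma ang_ibp a p f (f' : 'I_d -> 'rV[R]_d -> R) : rH1 V a p ->
  hasD (@axis1 n) f (f' (@axis1 n)) -> hasD (@axis2 n) f (f' (@axis2 n)) -> continuous f ->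
  continuous (f' (@axis1 n)) -> continuous (f' (@axis2 n)) -> bsupp f ->
  \int[mu]_x (ang p x * f x) = - \int[mu]_x (a x * ang f' x).
Proof.
move=> H df1 df2 cf cf1 cf2 bf; have [sa _ sp] := rH1_sqint H.
have cx i : continuous (fun x : 'rV[R]_d => x ord0 i) by exact: coord_cont.
have sxf i : sqint mu (fun x => x ord0 i * f x).
  by apply: cont_bsupp_sqint; [exact: rV_contM|exact: bsuppM].
have sxf' i j : hasD j f (f' j) -> continuous (f' j) -> sqint mu (fun x => x ord0 i * f' j x).
  by move=> df cf'; apply: cont_bsupp_sqint; [exact: rV_contM|apply: bsuppM; exact: hasD_bsupp bf].
have key i j : i != j -> hasD j f (f' j) -> continuous (f' j) ->
    \int[mu]_x (p j x * (x ord0 i * f x)) = - \int[mu]_x (a x * (x ord0 i * f' j x)).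
  move=> ij df cf'; apply: (rH1_ibp H).
  - have := hasDM (hasD_coord j i) df; rewrite [j == i]eq_sym (negbTE ij) /=.
    by congr (hasD j _ _); apply/funext => x; rewrite mulr0 addr0.
  - exact: rV_contM.
  - exact: rV_contM.
  - exact: bsuppM.
have -> : \int[mu]_x (ang p x * f x) = \int[mu]_x (p (@axis2 n) x * (x1 x * f x)) -
                               \int[mu]_x (p (@axis1 n) x * (x2 x * f x)).
  rewrite -RintB; [|exact: sqintM|exact: sqintM].
  by congr Rintegral; apply/funext => x; rewrite /ang; ring.
rewrite (key _ _ _ df1 cf1)// (key _ _ _ df2 cf2)//.
have s1 := sqintM sa (sxf' (@axis1 n) _ df2 cf2); have s2 := sqintM sa (sxf' (@axis2 n) _ df1 cf1).
transitivity (- (\int[mu]_x (a x * (x1 x * f' (@axis2 n) x)) - \int[mu]_x (a x * (x2 x * f' (@axis1 n) x)))).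
  by rewrite opprB opprK addrC.
by rewrite -RintB//; congr (- Rintegral _ _ _); apply/funext => x; rewrite /ang; ring.
Qed.

(** Approximate b by test functions, for which this is integration by parts. *)
Lemma ang_antisym a p b q : rH1 V a p -> rH1 V b q ->
  \int[mu]_x (ang p x * b x) = - \int[mu]_x (ang q x * a x).
Proof.
move=> H H'; rewrite (ang_intE H H') (ang_intE H' H).
have [f [tf fb fVb fq]] := H'; have [sa sVa sp] := rH1_sqint H.
have cxb i := coord_L2cvg V0 Vg i tf fb fVb.
have sxa i := coord_sqint V0 Vg i sa sVa.
have c1 : (\int[mu]_x (p (@axis2 n) x * (x1 x * f k x)) - \int[mu]_x (p (@axis1 n) x * (x2 x * f k x)))
  @[k --> \oo] --> \int[mu]_x (p (@axis2 n) x * (x1 x * b x)) - \int[mu]_x (p (@axis1 n) x * (x2 x * b x)).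
  by apply: cvgB; apply: L2cvg_inner => //; exact: L2cvg_cst.
have c2 : (- (\int[mu]_x (partial (@axis2 n) (f k) x * (x1 x * a x)) - \int[mu]_x (partial (@axis1 n) (f k) x * (x2 x * a x))))
  @[k --> \oo] --> - (\int[mu]_x (q (@axis2 n) x * (x1 x * a x)) - \int[mu]_x (q (@axis1 n) x * (x2 x * a x))).
  by apply: cvgN; apply: cvgB; apply: L2cvg_inner => //; exact: L2cvg_cst.
apply: (seq_lim_eq c1 c2) => k.
have T := rH1_test cV (tf k); have [sf bf] := tf k.
rewrite -(ang_intE H T) -(ang_intE T H) (ang_ibp H (f' := partial^~ (f k))) //.
- by congr (- Rintegral _ _ _); apply/funext => x; rewrite mulrC.
- exact: smooth_hasD.
- exact: smooth_hasD.
- exact: smooth_cont.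
- exact/smooth_cont/smooth_partial.
- exact/smooth_cont/smooth_partial.
Qed.

Lemma weight_smooth : smooth (fun x : 'rV[R]_d => (1 + \sum_i x ord0 i * x ord0 i)^-1).
Proof.
apply: smoothV.
  move=> x; rewrite gt_eqF// ltr_wpDr// sumr_ge0// => i _; rewrite -expr2; exact: sqr_ge0.
apply: smoothD; first exact: smooth_cst.
by apply: smooth_sum => j; apply: smoothM; exact: smooth_coord.
Qed.

Lemma ang_test f : ctest f -> ctest (ang (partial^~ f)).
Proof.
move=> tf.
have h1 := ctestM (ctest_partial (@axis2 n) tf) (smooth_coord (@axis1 n)).
have h2 := ctestZ (-1) (ctestM (ctest_partial (@axis1 n) tf) (smooth_coord (@axis2 n))).
have := ctestD h1 h2; congr ctest; apply/funext => x; rewrite /ang; ring.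
Qed.

(** The function w = s a + t (ang q) need not be square-integrable, as it contains
    coordinates times a gradient. Divided by (1 + |x|^2)^(1/2) it is, and it is then a
    limit of test functions treated in the same way; testing against these, with one
    more such factor, gives int w^2 / (1 + |x|^2) = 0. *)
Lemma ang_fundamental a p b q (s t : R) : rH1 V a p -> rH1 V b q ->
  (forall h, ctest h -> \int[mu]_x ((s * a x + t * ang q x) * h x) = 0) ->
  {ae mu, forall x, s * a x + t * ang q x = 0}.
Proof.
move=> H H' Z; have [f [tf fa fVa fp]] := H; have [g [tg gb gVb gq]] := H'.
have [sa sVa sp] := rH1_sqint H; have [sb sVb sq] := rH1_sqint H'.
pose om (x : 'rV[R]_d) : R := (1 + \sum_i x ord0 i * x ord0 i)^-1.
have S0 x : 0 <= \sum_i x ord0 i * x ord0 i :> R.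
  by rewrite sumr_ge0// => i _; rewrite -expr2 sqr_ge0.
have om0 x : 0 < om x by rewrite invr_gt0 ltr_wpDr.
have om1 x : om x <= 1 by rewrite invf_le1 ?lerDl// ltr_wpDr.
have omx x i : om x * x ord0 i ^+ 2 <= 1.
  rewrite mulrC ler_pdivrMr ?ltr_wpDr// mul1r (bigD1 i)//= -expr2.
  rewrite addrCA lerDl addr_ge0// sumr_ge0// => j _; rewrite -expr2 sqr_ge0//.
have smo : smooth om by exact: weight_smooth.
have mom : measurable_fun setT om by exact: (cont_meas (smooth_cont smo)).
pose som x := Num.sqrt (om x).
have msom : measurable_fun setT som.
  exact: (measurableT_comp (continuous_measurable_fun (@sqrt_continuous R)) mom).
have mcoord i : measurable_fun setT (fun x : 'rV[R]_d => x ord0 i) by exact: meas_coord.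
have bd (m : 'rV[R]_d -> R) F u : measurable_fun setT m -> (forall x, m x ^+ 2 <= 1) ->
    L2cvg mu F u -> L2cvg mu (fun k x => m x * F k x) (fun x => m x * u x).
  move=> mm m1 cF; have [h1 h2 _] := cF.
  have sm v : sqint mu v -> sqint mu (fun x => m x * v x).
    move=> [mv iv]; apply: (sqint_le (g := fun x => v x ^+ 2)) => //.
      exact: measurable_funM.
    by move=> x; rewrite exprMn ler_piMl// sqr_ge0.
  apply: (L2cvg_dom (C := 1) cF cF).
  - by move=> k; exact: sm.
  - exact: sm.
  - move=> k x; rewrite -mulrBr exprMn mul1r.
    by rewrite (@le_trans _ _ ((F k x - u x) ^+ 2))// ?ler_piMl ?sqr_ge0// lerDl sqr_ge0.
pose W k x := s * f k x + t * ang (partial^~ (g k)) x.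
pose w x := s * a x + t * ang q x.
have somE x : som x ^+ 2 = om x by rewrite sqr_sqrtr// ltW.
have cW : L2cvg mu (fun k x => som x * W k x) (fun x => som x * w x).
  have c1 := bd som _ _ msom (fun x => ltac:(by rewrite somE om1)) fa.
  have B i x : (som x * x ord0 i) ^+ 2 <= 1 by rewrite exprMn somE omx.
  have c2 i j := bd _ _ _ (measurable_funM msom (mcoord i)) (B i) (gq j).
  have c3 := L2cvg_lin t (- t) (c2 (@axis1 n) (@axis2 n)) (c2 (@axis2 n) (@axis1 n)).
  have := L2cvg_lin s 1 c1 c3; congr (L2cvg mu _ _); [apply/funext => k|];
    by apply/funext => x; rewrite /W /w /ang /=; ring.
have [_ sw _] := cW.
have c := L2cvg_inner (L2cvg_cst sw) cW.
have E : \int[mu]_x ((som x * w x) * (som x * w x)) = 0.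
  apply: (seq_lim_eq c (cvg_cst 0)) => k.
  have tW : ctest (fun x => W k x * om x).
    apply: ctestM smo.
    by apply: ctestD; apply: ctestZ => //; exact: ang_test.
  rewrite -[RHS](Z _ tW); congr Rintegral; apply/funext => x; rewrite -/(w x) -somE; ring.
apply: filterS (sqint_eq0 sw E) => x /eqP; rewrite mulf_eq0 => /orP[|/eqP//].
by rewrite gt_eqF// sqrtr_gt0.
Qed.

End angular.

(** * Complex energy space: reduction to real and imaginary parts *)

Lemma cvgD0 (R : realType) (u v : nat -> R) : u k @[k --> \oo] --> (0 : R) ->
  v k @[k --> \oo] --> (0 : R) -> u k + v k @[k --> \oo] --> (0 : R).
Proof. by move=> hu hv; have := cvgD hu hv; rewrite addr0; exact. Qed.

Lemma cvgeD0 (R : realType) (u v : nat -> \bar R) : u k @[k --> \oo] --> 0%E ->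
  v k @[k --> \oo] --> 0%E -> (u k + v k)%E @[k --> \oo] --> 0%E.
Proof. by move=> hu hv; have := @cvgeD _ _ _ _ _ _ 0%E 0%E isT hu hv; rewrite adde0; exact. Qed.

Lemma eq_cvg_seq (T : topologicalType) (u v : nat -> T) (l : T) : (forall k, u k = v k) ->
  u k @[k --> \oo] --> l -> v k @[k --> \oo] --> l.
Proof. by move=> /funext ->. Qed.

Section L2norm_lemmas.
Context {R : realType} {d : nat}.
Local Notation mu := (@lebesgue_rV R d).
Implicit Types f g : 'rV[R]_d -> R.

Lemma cabs_sqr (z : R[i]) : cabs z ^+ 2 = complex.Re z ^+ 2 + complex.Im z ^+ 2.
Proof. by case: z => a b /=; rewrite sqr_sqrtr// addr_ge0 ?sqr_ge0. Qed.

Lemma cabs_ge0 (z : R[i]) : 0 <= cabs z.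
Proof. by case: z => a b /=; rewrite sqrtr_ge0. Qed.

Lemma grad_abs_sqr (g : 'I_d -> 'rV[R]_d -> R[i]) x :
  grad_abs g x ^+ 2 = \sum_i (complex.Re (g i x) ^+ 2 + complex.Im (g i x) ^+ 2).
Proof.
rewrite sqr_sqrtr; first by apply: eq_bigr => i _; exact: cabs_sqr.
by apply: sumr_ge0 => i _; exact: sqr_ge0.
Qed.

Lemma meas_sqrt (d' : measure_display) (T : measurableType d') (f : T -> R) :
  measurable_fun setT f -> measurable_fun setT (fun x => Num.sqrt (f x)).
Proof. exact: (measurableT_comp (continuous_measurable_fun (@sqrt_continuous R))). Qed.

Lemma meas_cabs (u : 'rV[R]_d -> R[i]) : cmeasurable u -> measurable_fun setT (fun x => cabs (u x)).
Proof.
move=> [m1 m2].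
rewrite (_ : (fun _ => _) = fun x => Num.sqrt (complex.Re (u x) ^+ 2 + complex.Im (u x) ^+ 2)).
  by apply: meas_sqrt; apply: measurable_funD; exact: measurable_funX.
by apply/funext => x; case: (u x).
Qed.

Lemma meas_grad_abs (g : 'I_d -> 'rV[R]_d -> R[i]) : (forall i, cmeasurable (g i)) ->
  measurable_fun setT (grad_abs g).
Proof.
move=> mg; apply: meas_sqrt; apply: measurable_sum => i.
by apply: measurable_funX; exact: meas_cabs.
Qed.

Lemma L2normE f : L2norm f = ((\int[mu]_x (f x ^+ 2)%:E) `^ 2^-1)%E.
Proof.
rewrite /L2norm unlock; congr (_ `^ _)%E; apply: eq_integral => x _ /=.
by rewrite powR_mulrn// real_normK// num_real.
Qed.

Lemma L2norm_ge0 f : (0 <= L2norm f)%E.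
Proof. by rewrite L2normE poweR_ge0. Qed.

Lemma L2norm_sqint f : sqint mu f -> L2norm f = (Num.sqrt (\int[mu]_x (f x ^+ 2)))%:E.
Proof.
move=> [mf hf]; rewrite L2normE Rint_fin// poweR_EFin powR12_sqrt//.
by apply: Rint_ge0 => x; exact: sqr_ge0.
Qed.

Lemma L2norm_lty f : measurable_fun setT f -> (L2norm f < +oo)%E -> sqint mu f.
Proof.
move=> mf; rewrite L2normE => /lty_poweRy h; split => //.
apply: integ_lty; first exact: measurable_funX.
  by move=> x; exact: sqr_ge0.
by apply: h; rewrite invr_eq0 pnatr_eq0.
Qed.

Lemma L2norm_cvg (F D : nat -> 'rV[R]_d -> R) f : (forall k, sqint mu (F k)) ->
  measurable_fun setT f -> (forall k, measurable_fun setT (D k)) ->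
  (forall k x, (F k x - f x) ^+ 2 <= D k x ^+ 2) ->
  L2norm (D k) @[k --> \oo] --> 0%E -> L2cvg mu F f.
Proof.
move=> sF mf mD le c0.
have fin : \forall k \near \oo, sqint mu (D k).
  have : \forall k \near \oo, (L2norm (D k) < +oo)%E.
    have /fine_cvgP[h _] := c0.
    by apply: filterS h => k; rewrite fin_numE => /andP[_]; rewrite lt_neqAle leey => ->.
  by apply: filterS => k; exact: L2norm_lty.
have dF k : sqint mu (D k) -> sqint mu (fun x => F k x - f x).
  move=> [_ iD]; apply: (sqint_le (g := fun x => D k x ^+ 2)) => //.
  by apply: measurable_funB => //; case: (sF k).
have sf : sqint mu f.
  have [k hk] : exists k, sqint mu (D k).
    by have [N _ hN] := fin; exists N; apply: hN => /=.
  have := sqintB (sF k) (dF k hk); congr (sqint mu _); apply/funext => x; ring.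
split => //.
have c1 : fine (L2norm (D k)) * fine (L2norm (D k)) @[k --> \oo] --> (0 * 0 : R).
  by have /fine_cvgP[_ h] := c0; apply: cvgM.
rewrite mulr0 in c1; apply: (squeeze_cvgr _ (cvg_cst 0) c1).
apply: filterS fin => k sD; apply/andP; split; first by apply: Rint_ge0 => x; exact: sqr_ge0.
rewrite L2norm_sqint//= -expr2 sqr_sqrtr; last by apply: Rint_ge0 => x; exact: sqr_ge0.
by apply: Rint_le => //; [case: (dF k sD)|case: sD].
Qed.

Lemma L2norm_cvg0 (D : nat -> 'rV[R]_d -> R) : (forall k, sqint mu (D k)) ->
  \int[mu]_x (D k x ^+ 2) @[k --> \oo] --> (0 : R) -> L2norm (D k) @[k --> \oo] --> 0%E.
Proof.
move=> sD c0; apply/fine_cvgP; split; first by apply: nearW => k; rewrite L2norm_sqint.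
rewrite [X in X @ _](_ : _ = fun k => Num.sqrt (\int[mu]_x (D k x ^+ 2))).
  rewrite -[X in _ --> X](@sqrtr0 R); apply: continuous_cvg c0; exact: sqrt_continuous.
by apply/funext => k /=; rewrite L2norm_sqint.
Qed.

End L2norm_lemmas.

Section H1link.
Context {R : realType} {d : nat}.
Local Notation mu := (@lebesgue_rV R d).
Variable V : 'rV[R]_d -> R.
Hypothesis cV : continuous V.
Hypothesis V0 : forall x, 0 <= V x.

Notation re u := (fun x => complex.Re (u x)).
Notation im u := (fun x => complex.Im (u x)).

Lemma test_functionP (u : 'rV[R]_d -> R[i]) : test_function u <-> ctest (re u) /\ ctest (im u).
Proof.
split.
  move=> [s1 s2 [r hr]]; split; split => //; apply/enorm_bsupp; exists r => x /hr -> //.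
move=> [[s1 /enorm_bsupp[r h1]] [s2 /enorm_bsupp[r' h2]]]; split => //.
exists (Num.max r r') => x; rewrite gt_max => /andP[/h1 e1 /h2 e2].
by move: e1 e2; case: (u x) => a b /= -> ->.
Qed.

(** Each of the three terms of the H^1 distance bounds pointwise the corresponding
    error on the real and on the imaginary part. *)
Lemma H1_gradient_rH1 u g : H1_gradient V u g ->
  rH1 V (re u) (fun i => re (g i)) /\ rH1 V (im u) (fun i => im (g i)).
Proof.
move=> [mu_ mg [phi [tphi c0]]].
have tr k : ctest (re (phi k)) by case: (test_functionP (phi k)) => /(_ (tphi k)) [].
have ti k : ctest (im (phi k)) by case: (test_functionP (phi k)) => /(_ (tphi k)) [].
pose A k := L2norm (grad_abs (fun i x => cgrad (phi k) i x - g i x)).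
pose B k := L2norm (fun x => Num.sqrt (V x) * cabs (phi k x - u x)).
pose C k := L2norm (fun x => cabs (phi k x - u x)).
have cA : A k @[k --> \oo] --> 0%E.
  apply: (squeeze_cvge _ (cvg_cst 0%E) c0); apply: nearW => k.
  by rewrite L2norm_ge0 /H1norm /= -addeA leeDl// adde_ge0// L2norm_ge0.
have cB : B k @[k --> \oo] --> 0%E.
  apply: (squeeze_cvge _ (cvg_cst 0%E) c0); apply: nearW => k.
  by rewrite L2norm_ge0 /H1norm /= addeAC leeDr// adde_ge0// L2norm_ge0.
have cC : C k @[k --> \oo] --> 0%E.
  apply: (squeeze_cvge _ (cvg_cst 0%E) c0); apply: nearW => k.
  by rewrite L2norm_ge0 /H1norm /= leeDr// adde_ge0// L2norm_ge0.
have mct f : ctest f -> measurable_fun setT (f : 'rV[R]_d -> R) by move=> /ctest_sqint [].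
have mD k : cmeasurable (fun x => phi k x - u x).
  case: mu_ => m1 m2; split.
    rewrite (_ : (fun _ => _) = fun x => complex.Re (phi k x) - complex.Re (u x)).
      by apply: measurable_funB => //; exact: mct.
    by apply/funext => x; case: (phi k x); case: (u x).
  rewrite (_ : (fun _ => _) = fun x => complex.Im (phi k x) - complex.Im (u x)).
    by apply: measurable_funB => //; exact: mct.
  by apply/funext => x; case: (phi k x); case: (u x).
have mG k i : cmeasurable (fun x => cgrad (phi k) i x - g i x).
  case: (mg i) => m1 m2; split.
    rewrite (_ : (fun _ => _) = fun x => partial i (re (phi k)) x - complex.Re (g i x)).
      apply: measurable_funB => //; exact: mct _ (ctest_partial i (tr k)).
    by apply/funext => x; rewrite /cgrad /cderive; case: (g i x).
  rewrite (_ : (fun _ => _) = fun x => partial i (im (phi k)) x - complex.Im (g i x)).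
    apply: measurable_funB => //; exact: mct _ (ctest_partial i (ti k)).
  by apply/funext => x; rewrite /cgrad /cderive; case: (g i x).
have msV : measurable_fun setT (fun x => Num.sqrt (V x)) by exact: (meas_sqrt (cont_meas cV)).
split.
- exists (fun k => re (phi k)); split => //.
  + apply: L2norm_cvg cC => [k||k|k x]; [exact: ctest_sqint|by case: mu_|exact: meas_cabs|].
    by rewrite cabs_sqr; case: (phi k x) => a b; case: (u x) => a' b' /=; rewrite lerDl sqr_ge0.
  + apply: L2norm_cvg cB => [k||k|k x].
    * exact: sV_test.
    * by apply: measurable_funM => //; case: mu_.
    * by apply: measurable_funM => //; exact: meas_cabs.
    * rewrite -mulrBr !exprMn ler_wpM2l ?sqr_ge0// cabs_sqr.
      by case: (phi k x) => a b; case: (u x) => a' b' /=; rewrite lerDl sqr_ge0.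
  + move=> i; apply: L2norm_cvg cA => [k||k|k x].
    * exact/ctest_sqint/ctest_partial.
    * by case: (mg i).
    * exact: meas_grad_abs.
    * rewrite grad_abs_sqr (bigD1 i)//= /cgrad /cderive; case: (g i x) => a b /=.
      rewrite -addrA lerDl addr_ge0 ?sqr_ge0// sumr_ge0// => j _.
      by rewrite addr_ge0 ?sqr_ge0.
- exists (fun k => im (phi k)); split => //.
  + apply: L2norm_cvg cC => [k||k|k x]; [exact: ctest_sqint|by case: mu_|exact: meas_cabs|].
    by rewrite cabs_sqr; case: (phi k x) => a b; case: (u x) => a' b' /=; rewrite lerDr sqr_ge0.
  + apply: L2norm_cvg cB => [k||k|k x].
    * exact: sV_test.
    * by apply: measurable_funM => //; case: mu_.
    * by apply: measurable_funM => //; exact: meas_cabs.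
    * rewrite -mulrBr !exprMn ler_wpM2l ?sqr_ge0// cabs_sqr.
      by case: (phi k x) => a b; case: (u x) => a' b' /=; rewrite lerDr sqr_ge0.
  + move=> i; apply: L2norm_cvg cA => [k||k|k x].
    * exact/ctest_sqint/ctest_partial.
    * by case: (mg i).
    * exact: meas_grad_abs.
    * rewrite grad_abs_sqr (bigD1 i)//= /cgrad /cderive; case: (g i x) => a b /=.
      rewrite addrAC lerDr addr_ge0 ?sqr_ge0// sumr_ge0// => j _.
      by rewrite addr_ge0 ?sqr_ge0.
Qed.

Lemma sum_cvg0 (I : Type) (s : seq I) (F : I -> nat -> R) :
  (forall j, F j k @[k --> \oo] --> (0 : R)) -> \sum_(j <- s) F j k @[k --> \oo] --> (0 : R).
Proof.
move=> h; elim: s => [|j s IH].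
  by apply: (eq_cvg_seq (u := fun=> 0)); [move=> k; rewrite big_nil|exact: cvg_cst].
apply: (eq_cvg_seq (u := fun k => F j k + \sum_(j <- s) F j k)); first by move=> k; rewrite big_cons.
exact: cvgD0.
Qed.

Lemma integ_sum (I : Type) (s : seq I) (F : I -> 'rV[R]_d -> R) : (forall j, integ mu (F j)) ->
  integ mu (fun x => \sum_(j <- s) F j x) /\
  \int[mu]_x (\sum_(j <- s) F j x) = \sum_(j <- s) \int[mu]_x F j x.
Proof.
move=> h; elim: s => [|j s [IH1 IH2]].
  split; first by under eq_fun do rewrite big_nil; exact: integrable0.
  by under eq_Rintegral do rewrite big_nil; rewrite big_nil Rintegral_cst// mul0r.
have E : (fun x => \sum_(k <- j :: s) F k x) = (fun x => F j x + \sum_(k <- s) F k x).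
  by apply/funext => x; rewrite big_cons.
rewrite E; split; first exact: integD.
by rewrite big_cons -IH2 RintD.
Qed.

(** The squared L^2 norm of a complex function is the sum of those of its two parts. *)
Lemma rH1_H1_gradient u g : rH1 V (re u) (fun i => re (g i)) -> rH1 V (im u) (fun i => im (g i)) ->
  H1_gradient V u g.
Proof.
move=> [f [tf fu fVu fp]] [h [th hu hVu hp]].
split; first by split; [case: fu => _ []|case: hu => _ []].
  by move=> i; split; [case: (fp i) => _ []|case: (hp i) => _ []].
pose phi k x := Complex (f k x) (h k x); exists phi; split.
  by move=> k; apply/test_functionP; split; [exact: tf|exact: th].
have sq2 F a G b : L2cvg mu F a -> L2cvg mu G b -> forall k,
  integ mu (fun x => (F k x - a x) ^+ 2 + (G k x - b x) ^+ 2).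
  by move=> [h1 h2 _] [h3 h4 _] k; apply: integD; [case: (sqintB (h1 k) h2)|case: (sqintB (h3 k) h4)].
have c2 F a G b : L2cvg mu F a -> L2cvg mu G b ->
  \int[mu]_x ((F k x - a x) ^+ 2 + (G k x - b x) ^+ 2) @[k --> \oo] --> (0 : R).
  move=> [h1 h2 c1] [h3 h4 c3].
  have E k : \int[mu]_x ((F k x - a x) ^+ 2) + \int[mu]_x ((G k x - b x) ^+ 2) =
      \int[mu]_x ((F k x - a x) ^+ 2 + (G k x - b x) ^+ 2).
    by rewrite RintD//; [case: (sqintB (h1 k) h2)|case: (sqintB (h3 k) h4)].
  by apply: (eq_cvg_seq E); apply: cvgD0.
have mm F (a : 'rV[R]_d -> R) G (b : 'rV[R]_d -> R) : L2cvg mu F a -> L2cvg mu G b -> forall k,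
    cmeasurable (fun x => Complex (F k x) (G k x) - Complex (a x) (b x)).
  move=> [h1 [h2 _] _] [h3 [h4 _] _] k; have [m1 _] := h1 k; have [m3 _] := h3 k.
  by split; apply: measurable_funB.
have eta (z : R[i]) : z = Complex (complex.Re z) (complex.Im z) by case: z.
have cab (a b a' b' : R) : cabs (Complex a b - Complex a' b') ^+ 2 = (a - a') ^+ 2 + (b - b') ^+ 2.
  by rewrite cabs_sqr.
have C1 : L2norm (fun x => cabs (phi k x - u x)) @[k --> \oo] --> 0%E.
  have E k : (fun x => cabs (phi k x - u x) ^+ 2) =
     fun x => (f k x - complex.Re (u x)) ^+ 2 + (h k x - complex.Im (u x)) ^+ 2.
    by apply/funext => x; rewrite [u x in LHS]eta cab.
  apply: L2norm_cvg0; last by apply: (eq_cvg_seq (fun k => congr1 (Rintegral mu setT) (esym (E k)))); exact: c2.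
  move=> k; split; last by rewrite E; exact: sq2.
  have := meas_cabs (mm _ _ _ _ fu hu k); congr measurable_fun.
  by apply/funext => x; rewrite /phi [u x in RHS]eta.
have C2 : L2norm (fun x => Num.sqrt (V x) * cabs (phi k x - u x)) @[k --> \oo] --> 0%E.
  have E k : (fun x => (Num.sqrt (V x) * cabs (phi k x - u x)) ^+ 2) =
     fun x => (Num.sqrt (V x) * f k x - Num.sqrt (V x) * complex.Re (u x)) ^+ 2 +
              (Num.sqrt (V x) * h k x - Num.sqrt (V x) * complex.Im (u x)) ^+ 2.
    by apply/funext => x; rewrite [u x in LHS]eta exprMn cab; ring.
  apply: L2norm_cvg0; last by apply: (eq_cvg_seq (fun k => congr1 (Rintegral mu setT) (esym (E k)))); exact: (c2 _ _ _ _ fVu hVu).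
  move=> k; split; last by rewrite E; exact: (sq2 _ _ _ _ fVu hVu).
  apply: measurable_funM; first exact: (meas_sqrt (cont_meas cV)).
  have := meas_cabs (mm _ _ _ _ fu hu k); congr measurable_fun.
  by apply/funext => x; rewrite /phi [u x in RHS]eta.
have C3 : L2norm (grad_abs (fun i x => cgrad (phi k) i x - g i x)) @[k --> \oo] --> 0%E.
  have E k : (fun x => (grad_abs (fun i x => cgrad (phi k) i x - g i x) x) ^+ 2) =
     fun x => \sum_i ((partial i (f k) x - complex.Re (g i x)) ^+ 2 +
              (partial i (h k) x - complex.Im (g i x)) ^+ 2).
    apply/funext => x; rewrite grad_abs_sqr; apply: eq_bigr => i _.
    by rewrite [g i x in LHS]eta.
  have S k := integ_sum (index_enum _) (fun i => sq2 _ _ _ _ (fp i) (hp i) k).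
  apply: L2norm_cvg0.
    move=> k; split; last by rewrite E; case: (S k).
    apply: meas_grad_abs => i.
    have := mm _ _ _ _ (fp i) (hp i) k; congr cmeasurable.
    by apply/funext => x; rewrite [g i x in RHS]eta.
  apply: (eq_cvg_seq (fun k => congr1 (Rintegral mu setT) (esym (E k)))).
  apply: (eq_cvg_seq (fun k => esym (S k).2)).
  by apply: sum_cvg0 => i; exact: c2.
by apply: cvgeD0 => //; apply: cvgeD0.
Qed.

Lemma gradP u : H1space V u -> H1_gradient V u (grad V u).
Proof. by move=> [g hg]; apply: (@xgetPex _ _ [set g | H1_gradient V u g]); exists g. Qed.

End H1link.

(** * Rotations and the integrality of eigenvalues *)

Section ode.
Context {R : realType}.

Lemma is_derive_cmul (c t : R) : is_derive t (1:R) (fun s : R => c * s) c.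
Proof.
apply/is_derive1P => e e0; exists 1 => // h _.
by rewrite (_ : _ - _ - _ = 0) ?normr0 ?mulr_ge0 ?(ltW e0)//; ring.
Qed.

Lemma is_derive_cosc (c t : R) : is_derive t (1:R) (fun s => cos (c * s)) (- c * sin (c * t)).
Proof.
have H := @is_derive1_comp R cos (fun s => c * s) t _ _ (is_derive_cos (c * t)) (is_derive_cmul c t).
by apply: is_derive_eq H _; ring.
Qed.

Lemma is_derive_sinc (c t : R) : is_derive t (1:R) (fun s => sin (c * s)) (c * cos (c * t)).
Proof.
have H := @is_derive1_comp R sin (fun s => c * s) t _ _ (is_derive_sin (c * t)) (is_derive_cmul c t).
by apply: is_derive_eq H _; ring.
Qed.

Lemma is_deriveM1 (f g : R -> R) (t f' g' : R) : is_derive t (1:R) f f' -> is_derive t (1:R) g g' ->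
  is_derive t (1:R) (fun s => f s * g s) (f t * g' + g t * f').
Proof. by move=> h1 h2; exact: is_deriveM. Qed.

Lemma is_deriveD1 (f g : R -> R) (t f' g' : R) : is_derive t (1:R) f f' -> is_derive t (1:R) g g' ->
  is_derive t (1:R) (fun s => f s + g s) (f' + g').
Proof. by move=> h1 h2; exact: is_deriveD. Qed.

Lemma is_deriveB1 (f g : R -> R) (t f' g' : R) : is_derive t (1:R) f f' -> is_derive t (1:R) g g' ->
  is_derive t (1:R) (fun s => f s - g s) (f' - g').
Proof. by move=> h1 h2; exact: is_deriveB. Qed.

Lemma derive0_cst (f : R -> R) : (forall t, is_derive t (1:R) f (0:R)) -> forall t, f t = f 0.
Proof.
move=> h t; have [c _ E] := MVT_pt t h.
by apply/eqP; rewrite -subr_eq0 E mulr0.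
Qed.

(** In a frame turning at speed c the vector (F, G) is constant. If it returns to its
    initial value at time T, the rotation by c T fixes a nonzero vector. *)
Lemma rotation_ode (F G : R -> R) (c T : R) :
  (forall t, is_derive t (1:R) F (c * G t)) -> (forall t, is_derive t (1:R) G (- (c * F t))) ->
  F T = F 0 -> G T = G 0 -> F 0 != 0 \/ G 0 != 0 -> cos (c * T) = 1.
Proof.
move=> dF dG FT GT nz.
have H1 t : is_derive t (1:R) (fun s => F s * cos (c * s) - G s * sin (c * s)) (0:R).
  have h := is_deriveB1 (is_deriveM1 (dF t) (is_derive_cosc c t)) (is_deriveM1 (dG t) (is_derive_sinc c t)).
  by apply: is_derive_eq h _; ring.
have H2 t : is_derive t (1:R) (fun s => F s * sin (c * s) + G s * cos (c * s)) (0:R).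
  have h := is_deriveD1 (is_deriveM1 (dF t) (is_derive_sinc c t)) (is_deriveM1 (dG t) (is_derive_cosc c t)).
  by apply: is_derive_eq h _; ring.
have := derive0_cst H1 T; have := derive0_cst H2 T.
rewrite mulr0 sin0 cos0 FT GT !mulr0 mulr1 subr0 add0r mulr1.
set C := cos _; set S := sin _ => E2 E1.
have D : (F 0 ^+ 2 + G 0 ^+ 2) * (C - 1) = 0.
  have -> : (F 0 ^+ 2 + G 0 ^+ 2) * (C - 1) =
    F 0 * (F 0 * C - G 0 * S) + G 0 * (F 0 * S + G 0 * C) - (F 0 ^+ 2 + G 0 ^+ 2) by ring.
  by rewrite E1 E2; ring.
have P : F 0 ^+ 2 + G 0 ^+ 2 != 0.
  by rewrite paddr_eq0 ?sqr_ge0// !sqrf_eq0; case: nz => /negbTE ->; rewrite ?andbF.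
by move/eqP: D; rewrite mulf_eq0 (negbTE P) /= subr_eq0 => /eqP.
Qed.

(** If y is the fractional part of c then cos (2 pi y) = 1 gives sin (pi y) = 0,
    which is impossible for 0 < y < 1. *)
Lemma cos_2pi_int (c : R) : 0 <= c -> cos (c * (pi *+ 2)) = 1 -> exists k : nat, c = k%:R.
Proof.
move=> c0 h; pose k := Num.truncn c; exists k.
have /andP[k1 k2] := truncn_itv c0; rewrite -/k in k1 k2.
pose y := c - k%:R.
have y0 : 0 <= y by rewrite subr_ge0.
have y1 : y < 1 by rewrite ltrBlDr -natr1 addrC in k2 *.
have E : cos (y * (pi *+ 2)) = 1.
  rewrite -h (_ : c * (pi *+ 2) = y * (pi *+ 2) + (pi *+ 2) *+ k); last first.
    by rewrite -mulr_natl /y; ring.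
  by rewrite (periodicn (@cosD2pi R)).
have s0 : sin (y * pi) = 0.
  move: E; rewrite (_ : y * (pi *+ 2) = (y * pi) *+ 2); last by rewrite mulrnAr.
  rewrite cos_mulr2n cos2sin2 => E.
  by apply/eqP; rewrite -sqrf_eq0; apply/eqP; move: E; rewrite mulr2n; lra.
apply/eqP; rewrite -subr_eq0 -/y; apply/negPn/negP => yn0.
have yp : 0 < y by rewrite lt_neqAle eq_sym yn0.
have : 0 < sin (y * pi).
  apply: sin_gt0_pi; rewrite mulr_gt0 ?pi_gt0//=.
  by rewrite -[X in _ < X]mul1r ltr_pM2r ?pi_gt0.
by rewrite s0 ltxx.
Qed.

End ode.

Section rotation.
Context {R : realType} {n : nat}.
Local Notation d := n.+2.
Local Notation mu := (@lebesgue_rV R d).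
Local Notation x1 x := (x ord0 (@axis1 n)).
Local Notation x2 x := (x ord0 (@axis2 n)).
Local Notation e1 := (basis_vector (@axis1 n) : 'rV[R]_d).
Local Notation e2 := (basis_vector (@axis2 n) : 'rV[R]_d).

(** Written as a displacement in the plane of the first two coordinates, the form to
    which [chain_rule2] applies. *)
Definition rot (t : R) (x : 'rV[R]_d) : 'rV[R]_d :=
  x + (x1 x * (cos t - 1) - x2 x * sin t) *: e1 + (x1 x * sin t + x2 x * (cos t - 1)) *: e2.

Lemma rot1 t x : x1 (rot t x) = x1 x * cos t - x2 x * sin t.
Proof. by rewrite !mxE /= ?eqxx /=; ring. Qed.

Lemma rot2 t x : x2 (rot t x) = x1 x * sin t + x2 x * cos t.
Proof. by rewrite !mxE /= ?eqxx /=; ring. Qed.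

Lemma rot_other t x i : i != @axis1 n -> i != @axis2 n -> rot t x ord0 i = x ord0 i.
Proof. by move=> h1 h2; rewrite !mxE /= (negbTE h1) (negbTE h2) /= !mulr0 !addr0. Qed.

Lemma rot_enorm t x : enorm (rot t x) = enorm x.
Proof.
rewrite /enorm; congr Num.sqrt.
rewrite (bigD1 (@axis1 n))//= (bigD1 (@axis2 n))//= [RHS](bigD1 (@axis1 n))//= [X in _ = _ + X](bigD1 (@axis2 n))//=.
rewrite !addrA; congr (_ + _); last by apply: eq_bigr => i /andP[h1 h2]; rewrite rot_other.
rewrite rot1 rot2; have := cos2Dsin2 t; set C := cos t; set S := sin t => h.
have -> : (x1 x * C - x2 x * S) ^+ 2 + (x1 x * S + x2 x * C) ^+ 2 =
  (x1 x ^+ 2 + x2 x ^+ 2) * (C ^+ 2 + S ^+ 2) by ring.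
by rewrite h mulr1.
Qed.

Lemma rot0 x : rot 0 x = x.
Proof. by rewrite /rot cos0 sin0 subrr !mulr0 subrr addr0 !scale0r !addr0. Qed.

Lemma rot2pi x : rot (pi *+ 2) x = x.
Proof. by rewrite /rot cos2pi sin2pi subrr !mulr0 subrr addr0 !scale0r !addr0. Qed.

Lemma rot_cont t : continuous (rot t).
Proof.
have cx (i : 'I_d) : continuous (fun x : 'rV[R]_d => x ord0 i) by exact: coord_cont.
have cl (a b : R) : continuous (fun x : 'rV[R]_d => x1 x * a + x2 x * b).
  by apply: rV_contD; apply: rV_contM => // x; exact: cst_continuous.
have H (a b a' b' : R) : continuous (fun x : 'rV[R]_d => x + (x1 x * a + x2 x * b) *: e1 + (x1 x * a' + x2 x * b') *: e2).
  move=> x; apply: (@cvgD _ _ _ (nbhs x)); last by apply: (@cvgZr_tmp _ _ _ (nbhs x)); exact: cl.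
  apply: (@cvgD _ _ _ (nbhs x)); first exact: cvg_id.
  by apply: (@cvgZr_tmp _ _ _ (nbhs x)); exact: cl.
have -> : rot t = fun x => x + (x1 x * (cos t - 1) + x2 x * - sin t) *: e1 + (x1 x * sin t + x2 x * (cos t - 1)) *: e2.
  by apply/funext => x; rewrite /rot mulrN.
exact: H.
Qed.

Lemma rot_line1 t x s : rot t (x + s *: e1) = rot t x + (s * cos t) *: e1 + (s * sin t) *: e2.
Proof.
apply/rowP => i; rewrite /rot !mxE /= ?eqxx /=.
by have [->|_] := eqVneq i (@axis1 n) => /=; [|have [->|_] := eqVneq i (@axis2 n) => /=]; ring.
Qed.

Lemma rot_line2 t x s : rot t (x + s *: e2) = rot t x + (s * - sin t) *: e1 + (s * cos t) *: e2.
Proof.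
apply/rowP => i; rewrite /rot !mxE /= ?eqxx /=.
by have [->|_] := eqVneq i (@axis1 n) => /=; [|have [->|_] := eqVneq i (@axis2 n) => /=]; ring.
Qed.

Variable f : 'rV[R]_d -> R.
Hypothesis tf : ctest f.
Let f1 := partial (@axis1 n) f.
Let f2 := partial (@axis2 n) f.
Let sf : smooth f. Proof. by case: tf. Qed.
Let df1 : hasD (@axis1 n) f f1. Proof. exact: smooth_hasD. Qed.
Let df2 : hasD (@axis2 n) f f2. Proof. exact: smooth_hasD. Qed.
Let cf1 : continuous f1. Proof. exact/smooth_cont/smooth_partial. Qed.
Let cf2 : continuous f2. Proof. exact/smooth_cont/smooth_partial. Qed.

Lemma rot_chain x (p q : R -> R) (t p' q' : R) :
  is_derive t (1:R) p p' -> is_derive t (1:R) q q' -> forall z, z = x + p t *: e1 + q t *: e2 ->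
  is_derive t (1:R) (fun s => f (x + p s *: e1 + q s *: e2)) (p' * f1 z + q' * f2 z).
Proof. by move=> dp dq z ->; exact: (chain_rule2 df1 df2 cf1 cf2 x dp dq). Qed.

Lemma rot_derive x t : is_derive t (1:R) (fun s => f (rot s x)) (ang (partial^~ f) (rot t x)).
Proof.
have dp : is_derive t (1:R) (fun s => x1 x * (cos s - 1) - x2 x * sin s) (- x1 x * sin t - x2 x * cos t).
  have h := is_deriveB1 (is_deriveM1 (is_derive_cst (x1 x) t (1:R))
     (is_deriveB1 (is_derive_cos t) (is_derive_cst (1:R) t (1:R))))
     (is_deriveM1 (is_derive_cst (x2 x) t (1:R)) (is_derive_sin t)).
  by apply: is_derive_eq h _; rewrite /cst; ring.
have dq : is_derive t (1:R) (fun s => x1 x * sin s + x2 x * (cos s - 1)) (x1 x * cos t - x2 x * sin t).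
  have h := is_deriveD1 (is_deriveM1 (is_derive_cst (x1 x) t (1:R)) (is_derive_sin t))
     (is_deriveM1 (is_derive_cst (x2 x) t (1:R))
     (is_deriveB1 (is_derive_cos t) (is_derive_cst (1:R) t (1:R)))).
  by apply: is_derive_eq h _; rewrite /cst; ring.
have h := rot_chain dp dq (erefl (rot t x)); apply: is_derive_eq h _.
by rewrite /ang rot1 rot2 /f1 /f2; ring.
Qed.

Lemma rot_hasD1 t : hasD (@axis1 n) (fun x => f (rot t x)) (fun x => cos t * f1 (rot t x) + sin t * f2 (rot t x)).
Proof.
move=> x; rewrite -[x in is_derive x]addr0 -[X in _ + X](scale0r e1); apply/is_derive_line.
have E : (fun s : R => f (rot t (x + s *: e1))) =
    fun s => f (rot t x + (s * cos t) *: e1 + (s * sin t) *: e2).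
  by apply/funext => s; rewrite rot_line1.
have dd c : is_derive (0:R) (1:R) (fun s : R => s * c) c.
  by have := is_derive_cmul c 0; congr is_derive; apply/funext => s; rewrite mulrC.
have zE : rot t x = rot t x + (0 * cos t) *: e1 + (0 * sin t) *: e2.
  by rewrite !mul0r !scale0r !addr0.
by rewrite E; exact: (rot_chain (dd _) (dd _) zE).
Qed.

Lemma rot_hasD2 t : hasD (@axis2 n) (fun x => f (rot t x)) (fun x => - sin t * f1 (rot t x) + cos t * f2 (rot t x)).
Proof.
move=> x; rewrite -[x in is_derive x]addr0 -[X in _ + X](scale0r e2); apply/is_derive_line.
have E : (fun s : R => f (rot t (x + s *: e2))) =
    fun s => f (rot t x + (s * - sin t) *: e1 + (s * cos t) *: e2).
  by apply/funext => s; rewrite rot_line2.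
have dd c : is_derive (0:R) (1:R) (fun s : R => s * c) c.
  by have := is_derive_cmul c 0; congr is_derive; apply/funext => s; rewrite mulrC.
have zE : rot t x = rot t x + (0 * - sin t) *: e1 + (0 * cos t) *: e2.
  by rewrite !mul0r !scale0r !addr0.
by rewrite E; exact: (rot_chain (dd _) (dd _) zE).
Qed.

Lemma rot_comp_cont t (g : 'rV[R]_d -> R) : continuous g -> continuous (fun x => g (rot t x)).
Proof.
by move=> cg x; apply: (continuous_comp (f := rot t)); [exact: rot_cont|exact: cg].
Qed.

Lemma rot_bsupp t (g : 'rV[R]_d -> R) : bsupp g -> bsupp (fun x => g (rot t x)).
Proof.
by move=> /enorm_bsupp[r hr]; apply/enorm_bsupp; exists r => x rx; apply: hr; rewrite rot_enorm.
Qed.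

Variable V : 'rV[R]_d -> R.

(** The rotation field commutes with rotations, so after integration by parts it acts
    on f before the rotation. *)
Lemma rot_ibp a p t : rH1 V a p ->
  \int[mu]_x (ang p x * f (rot t x)) = - \int[mu]_x (a x * ang (partial^~ f) (rot t x)).
Proof.
move=> H; pose f' (i : 'I_d) := if i == @axis1 n then (fun x => cos t * f1 (rot t x) + sin t * f2 (rot t x))
   else (fun x => - sin t * f1 (rot t x) + cos t * f2 (rot t x)).
have cc c : continuous (fun _ : 'rV[R]_d => c : R) by move=> x; exact: cst_continuous.
rewrite (ang_ibp H (f' := f')).
- congr (- Rintegral _ _ _); apply/funext => x; rewrite /ang /f' /= rot1 rot2 /f1 /f2; ring.
- exact: rot_hasD1.
- exact: rot_hasD2.
- exact/rot_comp_cont/smooth_cont.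
- by apply: rV_contD; apply: rV_contM; [exact: cc|exact: rot_comp_cont|exact: cc|exact: rot_comp_cont].
- by apply: rV_contD; apply: rV_contM; [exact: cc|exact: rot_comp_cont|exact: cc|exact: rot_comp_cont].
- by apply: rot_bsupp; case: tf.
Qed.

Lemma cube_sqint (r M : R) : sqint mu (fun x : 'rV[R]_d => M * \1_[set x : 'rV[R]_d | forall i, x ord0 i \in `[- r, r]] x).
Proof.
set Q := [set _ | _]; have mQ : measurable Q by exact: measurable_cube.
apply: sqintZ; split; first by apply: measurable_indic.
have -> : (fun x => (\1_Q x : R) ^+ 2) = \1_Q.
  by apply/funext => x; rewrite indicE; case: (_ \in _); rewrite ?expr1n ?expr0n.
apply: integ_lty => //.
by rewrite integral_indic// setIT; exact: leb_cube_lty.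
Qed.

(** Differentiation under the integral sign. Rotations preserve the norm, so for all
    angles the derivative is bounded by M |a| on one cube and vanishes outside. *)
Lemma rot_int_derive a t : sqint mu a ->
  is_derive t (1:R) (fun s => \int[mu]_x (a x * f (rot s x))) (\int[mu]_x (a x * ang (partial^~ f) (rot t x))).
Proof.
move=> sa; have [tA bA] := ang_test tf; have cA := smooth_cont tA.
have [M M0 hM] := cont_bsupp_bounded cA bA.
have [r hr] := (enorm_bsupp _).2 bA.
pose Q := [set x : 'rV[R]_d | forall i, x ord0 i \in `[- r, r]].
pose G (x : 'rV[R]_d) := `|a x * (M * \1_Q x)|.
have bound s x : `|a x * ang (partial^~ f) (rot s x)| <= G x.
  rewrite /G !normrM (ger0_norm M0) indicE ler_wpM2l//.
  case: (boolP (x \in Q)) => xQ /=; first by rewrite normr1 mulr1.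
  rewrite normr0 mulr0 hr ?normr0// rot_enorm ltNge; apply/negP => h.
  move/negP: xQ; apply; rewrite inE => i; rewrite in_itv /= -ler_norml.
  exact: le_trans (rV_coord_le _ _) (le_trans (enorm_ge _) h).
have iG : integ mu G.
  have h := sqintM sa (cube_sqint r M); apply: (integ_le _ h) => [|x]; last by rewrite normr_id.
  by apply: measurableT_comp => //; exact: integ_meas h.
have intf s : integ mu (fun x => a x * f (rot s x)).
  apply: sqintM => //; apply: cont_bsupp_sqint; first exact/rot_comp_cont/smooth_cont.
  by apply: rot_bsupp; case: tf.
have D x s : is_derive s (1:R) (fun s => a x * f (rot s x)) (a x * ang (partial^~ f) (rot s x)).
  have h := is_deriveM1 (is_derive_cst (a x) s (1:R)) (rot_derive x s).
  by apply: is_derive_eq h _; rewrite /cst; ring.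
have It : `]t - 1, t + 1[%classic t by rewrite /= in_itv /=; apply/andP; split; lra.
have D1 s x : derive1 (fun s => a x * f (rot s x)) s = a x * ang (partial^~ f) (rot s x).
  by rewrite derive1E; case: (D x s).
have B s x : `]t - 1, t + 1[%classic s -> setT x -> `|derive1 (fun s => a x * f (rot s x)) s| <= G x.
  by move=> _ _; rewrite D1; exact: bound.
have D2 s x : `]t - 1, t + 1[%classic s -> setT x -> derivable (fun s => a x * f (rot s x)) s 1.
  by move=> _ _; case: (D x s).
have K1 := derivable_under_integral (f := fun s x => a x * f (rot s x)) measurableT It
  (fun s _ => intf s) D2 (fun x => normr_ge0 _) iG B.
have K2 := differentiation_under_integral (f := fun s x => a x * f (rot s x)) measurableT It
  (fun s _ => intf s) D2 (fun x => normr_ge0 _) iG B.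
split => //; rewrite -derive1E K2; apply: eq_Rintegral => x _; exact: D1.
Qed.

End rotation.

Section integrality.
Context {R : realType} {n : nat}.
Local Notation d := n.+2.
Local Notation mu := (@lebesgue_rV R d).
Variable V : 'rV[R]_d -> R.

(** For a test function f, the integrals of a and b against f o rot t are the two
    components of a uniform rotation at speed c, and are 2 pi periodic; some f makes
    them nonzero. Rotating f rather than a and b spares a change of variables. *)
Lemma eigenvalue_natural a p b q (c : R) : rH1 V a p -> rH1 V b q -> 0 <= c ->
  {ae mu, forall x, ang q x = c * a x} -> {ae mu, forall x, ang p x = - c * b x} ->
  ~ ({ae mu, forall x, a x = 0} /\ {ae mu, forall x, b x = 0}) -> exists k : nat, c = k%:R.
Proof.
move=> Ha Hb c0 Eq Ep nz; apply: cos_2pi_int => //.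
have [sa _ sp] := rH1_sqint Ha; have [sb _ sq] := rH1_sqint Hb.
have cxm (f : 'rV[R]_d -> R) t : ctest f -> sqint mu (fun x => f (rot t x)).
  by move=> [sf bf]; apply: cont_bsupp_sqint; [exact/rot_comp_cont/smooth_cont|exact: rot_bsupp].
have key f : ctest f -> (\int[mu]_x (a x * f x) != 0 \/ \int[mu]_x (b x * f x) != 0) ->
    cos (c * (pi *+ 2)) = 1.
  move=> tf fnz.
  have mang p' (sp' : forall i, sqint mu (p' i)) : measurable_fun setT (@ang R n p').
    by apply: ang_meas => i; case: (sp' i).
  have E1 t : \int[mu]_x (a x * ang (partial^~ f) (rot t x)) = c * \int[mu]_x (b x * f (rot t x)).
    apply: oppr_inj; rewrite -(rot_ibp tf t Ha) -mulNr.
    have I0 := integZ (- c) (sqintM sb (cxm f t tf)).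
    have [||_ <-] := Rint_ae (g := fun x => ang p x * f (rot t x)) I0.
    - by apply: measurable_funM; [exact: mang|case: (cxm f t tf)].
    - by apply: filterS Ep => x ->; rewrite mulrA.
    - by rewrite RintZ//; exact: (sqintM sb (cxm f t tf)).
  have E2 t : \int[mu]_x (b x * ang (partial^~ f) (rot t x)) = - (c * \int[mu]_x (a x * f (rot t x))).
    apply: oppr_inj; rewrite opprK -(rot_ibp tf t Hb).
    have I0 := integZ c (sqintM sa (cxm f t tf)).
    have [||_ <-] := Rint_ae (g := fun x => ang q x * f (rot t x)) I0.
    - by apply: measurable_funM; [exact: mang|case: (cxm f t tf)].
    - by apply: filterS Eq => x ->; rewrite mulrA.
    - by rewrite RintZ//; exact: (sqintM sa (cxm f t tf)).
  apply: (rotation_ode (F := fun t => \int[mu]_x (a x * f (rot t x))) (G := fun t => \int[mu]_x (b x * f (rot t x)))).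
  - by move=> t; rewrite -E1; exact: rot_int_derive.
  - by move=> t; rewrite -E2; exact: rot_int_derive.
  - by apply: eq_Rintegral => x _; rewrite rot2pi rot0.
  - by apply: eq_Rintegral => x _; rewrite rot2pi rot0.
  - case: fnz => h; [left|right]; move: h; congr (_ != _);
      by apply: eq_Rintegral => x _; rewrite rot0.
apply: contrapT => ncos; apply: nz.
have Z (u : 'rV[R]_d -> R) r : rH1 V u r -> (forall f, ctest f -> \int[mu]_x (u x * f x) = 0) -> {ae mu, forall x, u x = 0}.
  move=> Hu Z; have [su _ _] := rH1_sqint Hu; have [f [tf fu _ _]] := Hu.
  apply: sqint_eq0 => //; apply: (seq_lim_eq (L2cvg_inner (L2cvg_cst su) fu) (cvg_cst 0)) => k.
  exact: Z.
split.
- apply: Z Ha _ => f tf; apply/eqP/negPn/negP => h; apply: ncos; apply: (key f tf); by left.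
- apply: Z Hb _ => f tf; apply/eqP/negPn/negP => h; apply: ncos; apply: (key f tf); by right.
Qed.

End integrality.

(** * Sobolev inequalities in dimensions two and three *)

Section C1c.
Context {R : realType}.
Local Notation leb n := (@lebesgue_rV R n).

Definition C1c n (f : 'rV[R]_n -> R) (f' : 'I_n -> 'rV[R]_n -> R) :=
  [/\ continuous f, bsupp f, forall i, hasD i f (f' i) & forall i, continuous (f' i)].

Lemma ctest_C1c n (f : 'rV[R]_n -> R) : ctest f -> C1c f (partial^~ f).
Proof.
move=> [sf bf]; split => //; first exact: smooth_cont.
- by move=> i; exact: smooth_hasD.
- by move=> i; exact/smooth_cont/smooth_partial.
Qed.

Lemma C1c_bsupp n (f : 'rV[R]_n -> R) f' i : C1c f f' -> bsupp (f' i).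
Proof. by move=> [_ bf hf _]; exact: hasD_bsupp bf. Qed.

Lemma rV_contX n (f : 'rV[R]_n -> R) k : continuous f -> continuous (fun x => f x ^+ k).
Proof.
move=> cf; elim: k => [|k IH].
  by rewrite (_ : (fun _ => _) = fun=> 1); [move=> x; exact: cst_continuous|apply/funext => x; rewrite expr0].
rewrite (_ : (fun _ => _) = fun x => f x * f x ^+ k); first exact: rV_contM.
by apply/funext => x; rewrite exprS.
Qed.

Lemma bsuppX n (f : 'rV[R]_n -> R) k : bsupp f -> bsupp (fun x => f x ^+ k.+1).
Proof. by move=> [r hr]; exists r => x /hr ->; rewrite expr0n. Qed.

Lemma rV_cont_norm n (f : 'rV[R]_n -> R) : continuous f -> continuous (fun x => `|f x|).
Proof.
by move=> cf x; apply: (continuous_comp (f := f)); [exact: cf|exact: norm_continuous].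
Qed.

Lemma C1c_pow n (f : 'rV[R]_n -> R) f' k : C1c f f' ->
  C1c (fun x => f x ^+ k.+1) (fun i x => k.+1%:R * (f x ^+ k * f' i x)).
Proof.
move=> [cf bf hf cf']; split; [exact: rV_contX|exact: bsuppX| |].
- move=> i; elim: k => [|k IH].
    by have := hf i; congr (hasD i _ _); apply/funext => x; rewrite ?expr1// expr0 !mul1r.
  have := hasDM (hf i) IH; congr (hasD i _ _); apply/funext => x.
  by rewrite -[in RHS]natr1 !exprS; ring.
- move=> i; apply: rV_contM; first by move=> x; exact: cst_continuous.
  by apply: rV_contM => //; exact: rV_contX.
Qed.

Lemma C1c_slice n (f : 'rV[R]_n.+1 -> R) f' t : C1c f f' ->
  C1c (fun y => f (consrv (t, y))) (fun j y => f' (lift ord0 j) (consrv (t, y))).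
Proof.
move=> [cf bf hf cf']; split; [exact: cont_sliceS|exact: bsupp_sliceS| |].
- by move=> i; exact: hasD_sliceS.
- by move=> i; exact: cont_sliceS.
Qed.

Lemma sup_bound_dim1 (f : 'rV[R]_1 -> R) f' y : C1c f f' ->
  (`|f y|%:E <= \int[leb 1]_x `|f' ord0 x|%:E)%E.
Proof.
move=> [cf bf hf cf'].
(* R^1 is R times the one-point space R^0, with its Dirac measure. *)
have Ey : y = consrv (y ord0 ord0, 0 : 'rV[R]_0).
  by apply: consrvP; [rewrite consrv0|case].
rewrite {1}Ey; apply: le_trans (slice_bound _ _ (hf ord0) (cf' ord0) bf) _.
rewrite (fubini_cons_ge0 (f := fun x => `|f' ord0 x|))//; last exact: (cont_meas (rV_cont_norm (cf' ord0))).
rewrite le_eqVlt; apply/orP; left; apply/eqP; apply: eq_integral => s _ /=.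
rewrite integral_dirac//; last first.
  by apply/measurable_EFinP; apply: (@cont_meas R 0 (fun x => `|f' ord0 (consrv (s, x))|)); apply: rV_cont_norm; exact: cont_sliceS (cf' ord0).
by rewrite diracE mem_set// mul1e.
Qed.

(** The value f (t, y) is at most an integral that depends on y alone, and at most one
    that depends on t alone; the integral of their product is a product of integrals. *)
Lemma sobolev_dim2 (f : 'rV[R]_2 -> R) f' : C1c f f' ->
  (\int[leb 2]_x (f x ^+ 2)%:E <=
   (\int[leb 2]_x `|f' ord0 x|%:E) * (\int[leb 2]_x `|f' (lift ord0 ord0) x|%:E))%E.
Proof.
move=> H; have [cf bf hf cf'] := H.
have mn i : measurable_fun setT (fun x => `|f' i x|) by exact: (cont_meas (rV_cont_norm (cf' i))).
have mc := @measurable_consrv R 1.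
pose A (y : 'rV[R]_1) := (\int[lebesgue_measure]_t `|f' ord0 (consrv (t, y))|%:E)%E.
pose B (t : measurableTypeR R) := (\int[leb 1]_y `|f' (lift ord0 ord0) (consrv (t, y))|%:E)%E.
have A0 y : (0 <= A y)%E by apply: integral_ge0 => x _; rewrite lee_fin.
have B0 t : (0 <= B t)%E by apply: integral_ge0 => x _; rewrite lee_fin.
have mA : measurable_fun setT A.
  apply: (measurable_fun_fubini_tonelli_G (fun z => `|f' ord0 (consrv z)|%:E)) => //.
  by apply/measurable_EFinP; exact: (measurableT_comp (mn ord0) mc).
have mB : measurable_fun setT B.
  apply: (measurable_fun_fubini_tonelli_F (fun z => `|f' (lift ord0 ord0) (consrv z)|%:E)) => //.
  by apply/measurable_EFinP; exact: (measurableT_comp (mn _) mc).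
have EA : (\int[leb 2]_x `|f' ord0 x|%:E = \int[leb 1]_y A y)%E by rewrite fubini_cons_ge0_swap.
have EB : (\int[leb 2]_x `|f' (lift ord0 ord0) x|%:E = \int[lebesgue_measure]_t B t)%E by rewrite fubini_cons_ge0.
have mf2 := @cont_meas R 2 (fun x => f x ^+ 2) (rV_contX (k := 2) cf).
rewrite EA EB fubini_cons_ge0//; last by move=> x; exact: sqr_ge0.
have pt t y : ((f (consrv (t, y)) ^+ 2)%:E <= B t * A y)%E.
  rewrite -real_normK ?num_real// expr2 EFinM lee_pmul// ?lee_fin//.
    exact: (sup_bound_dim1 _ (C1c_slice t H)).
  exact: (slice_bound _ _ (hf ord0) (cf' ord0) bf).
apply: (@le_trans _ _ (\int[lebesgue_measure]_t (B t * \int[leb 1]_y A y))%E).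
  apply: ge0_le_integral => //.
  - by move=> t _; apply: integral_ge0 => y _; rewrite lee_fin sqr_ge0.
  - apply: (measurable_fun_fubini_tonelli_F (fun z => (f (consrv z) ^+ 2)%:E)).
      by apply/measurable_EFinP; exact: (measurableT_comp mf2 mc).
    by move=> z; rewrite lee_fin sqr_ge0.
  - by apply: emeasurable_funM.
  - move=> t _; rewrite -ge0_integralZl//.
    apply: ge0_le_integral => //.
    + by move=> y _; rewrite lee_fin sqr_ge0.
    + apply/measurable_EFinP; apply: (@cont_meas R 1 (fun y => f (consrv (t, y)) ^+ 2)); apply: rV_contX; exact: cont_sliceS cf.
    + exact: measurable_funeM.
rewrite ge0_integralZr//; last by apply: integral_ge0.
by rewrite muleC.
Qed.

Lemma C1c_integ n (f : 'rV[R]_n -> R) f' i k : C1c f f' ->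
  [/\ integ (leb n) (fun x => f x ^+ k.+1), integ (leb n) (fun x => f' i x ^+ k.+1),
      sqint (leb n) (fun x => f x ^+ k.+1) & sqint (leb n) (f' i)].
Proof.
move=> H; have [cf bf hf cf'] := H; have bf' := C1c_bsupp i H.
split; [apply: cont_bsupp_integ|apply: cont_bsupp_integ|apply: cont_bsupp_sqint|apply: cont_bsupp_sqint] => //;
  by [exact: rV_contX|exact: bsuppX].
Qed.

Lemma Cauchy_Schwarz_abs n (u v : 'rV[R]_n -> R) : sqint (leb n) u -> sqint (leb n) v ->
  (\int[leb n]_x `|u x * v x|) ^+ 2 <= \int[leb n]_x (u x ^+ 2) * \int[leb n]_x (v x ^+ 2).
Proof.
move=> su sv.
have sn (w : 'rV[R]_n -> R) : sqint (leb n) w -> sqint (leb n) (fun x => `|w x|).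
  move=> [mw iw]; split; first exact: measurableT_comp.
  by move: iw; congr (integ _ _); apply/funext => x; rewrite real_normK ?num_real.
have := Cauchy_Schwarz (sn _ su) (sn _ sv).
under eq_Rintegral do rewrite -normrM.
under [X in _ <= X * _ -> _]eq_Rintegral do rewrite real_normK ?num_real//.
by under [X in _ <= _ * X -> _]eq_Rintegral do rewrite real_normK ?num_real//.
Qed.

(** The planar inequality for v^(k+2), with Cauchy-Schwarz applied to each factor. *)
Lemma power_raise_dim2 (v : 'rV[R]_2 -> R) v' k : C1c v v' ->
  \int[leb 2]_x (v x ^+ (2 * k.+2)) <= k.+2%:R ^+ 2 *
    (\int[leb 2]_x (v x ^+ (2 * k.+1)) *
     (\int[leb 2]_x (v' ord0 x ^+ 2) + \int[leb 2]_x (v' (lift ord0 ord0) x ^+ 2))).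
Proof.
move=> H; have Hk := C1c_pow k.+1 H.
have [_ _ svk _] := C1c_integ ord0 k H.
have sv' i : sqint (leb 2) (v' i) by case: (C1c_integ i 0 H).
have E2 (w : 'rV[R]_2 -> R) j : (fun x => w x ^+ (2 * j)) = (fun x => (w x ^+ j) ^+ 2).
  by apply/funext => x; rewrite mulnC exprM.
have absE i : (\int[leb 2]_x `|k.+2%:R * (v x ^+ k.+1 * v' i x)|%:E)%E =
   (k.+2%:R * \int[leb 2]_x `|v x ^+ k.+1 * v' i x|)%:E.
  have Iabs : integ (leb 2) (fun x => `|v x ^+ k.+1 * v' i x|).
    have h := sqintM svk (sv' i); apply: (integ_le _ h) => [|x]; last by rewrite normr_id.
    by apply: measurableT_comp => //; exact: integ_meas h.
  rewrite -RintZ// -Rint_fin; last exact: integZ.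
  by apply: eq_integral => x _; rewrite normrM ger0_norm.
have := sobolev_dim2 Hk; rewrite !absE Rint_fin; last by case: (C1c_integ ord0 1 Hk).
rewrite -EFinM lee_fin E2 => h; apply: le_trans h _.
have cs i := Cauchy_Schwarz_abs svk (sv' i).
have h0 i : 0 <= \int[leb 2]_x `|v x ^+ k.+1 * v' i x| by exact: Rint_ge0.
move: (cs ord0) (cs (lift ord0 ord0)) (h0 ord0) (h0 (lift ord0 ord0)); rewrite [in X in _ -> _ -> _ -> _ -> X]E2.
set a := \int[leb 2]_x `|_|; set b := \int[leb 2]_x `|_|.
set I := \int[leb 2]_x _; set K0 := \int[leb 2]_x (v' ord0 x ^+ 2); set K1 := \int[leb 2]_x _.
move=> ha hb a0 b0.
have -> : k.+2%:R * a * (k.+2%:R * b) = k.+2%:R ^+ 2 * (a * b) by ring.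
rewrite ler_wpM2l ?sqr_ge0//; have := sqr_ge0 (a - b); nra.
Qed.

(** In each plane orthogonal to the first axis, the planar inequality bounds the
    integral of v^6 by that of v^4 times the squared norm of the gradient; the former
    is at most N = int |d_1 (v^4)| whatever the plane. By Cauchy-Schwarz, N is at most the square root of int v^6 up to a
    constant, and that power is small enough to be absorbed. *)
Lemma sobolev_dim3 (v : 'rV[R]_3 -> R) v' (B : R) : C1c v v' -> 0 <= B ->
  (forall i, \int[leb 3]_x (v' i x ^+ 2) <= B) ->
  \int[leb 3]_x (v x ^+ 6) <= 18 ^+ 2 * 16 * (B ^+ 2 * (B + 1)).
Proof.
move=> H B0 hB; have [cv bv hv cv'] := H.
pose i1 : 'I_3 := lift ord0 ord0; pose i2 : 'I_3 := lift ord0 (lift ord0 ord0).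
have [I6 _ _ _] := C1c_integ ord0 5 H; have [I4 _ _ _] := C1c_integ ord0 3 H.
have [_ _ sv3 _] := C1c_integ ord0 2 H.
have sv' i : sqint (leb 3) (v' i) by case: (C1c_integ i 0 H).
have Iv' i : integ (leb 3) (fun x => v' i x ^+ 2) by case: (sv' i).
pose D x := v' i1 x ^+ 2 + v' i2 x ^+ 2.
have ID : integ (leb 3) D by exact: integD.
have D0 x : 0 <= D x by rewrite addr_ge0 ?sqr_ge0.
pose N := \int[leb 3]_x `|4 * (v x ^+ 3 * v' ord0 x)|.
have IN : integ (leb 3) (fun x => `|4 * (v x ^+ 3 * v' ord0 x)|).
  have h := integZ 4 (sqintM sv3 (sv' ord0)); apply: (integ_le _ h) => [|x]; last by rewrite normr_id.
  by apply: measurableT_comp => //; exact: integ_meas h.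
have N0 : 0 <= N by exact: Rint_ge0.
have J t : \int[leb 2]_y (v (consrv (t, y)) ^+ 4) <= N.
  have [Is4 _ _ _] := C1c_integ ord0 3 (C1c_slice t H).
  rewrite -lee_fin -Rint_fin// -Rint_fin// [in leRHS]fubini_cons_ge0_swap//; last exact: integ_meas IN.
  have H4 := C1c_pow 3 H; have [_ b4 h4 c4] := H4.
  apply: ge0_le_integral => //.
  - by move=> y _; rewrite lee_fin exprn_even_ge0.
  - by apply/measurable_EFinP; exact: integ_meas Is4.
  - apply: (measurable_fun_fubini_tonelli_G (fun z => `|4 * (v (consrv z) ^+ 3 * v' ord0 (consrv z))|%:E)) => //.
    by apply/measurable_EFinP; exact: (measurableT_comp (integ_meas IN) (@measurable_consrv R 2)).
  - move=> y _; apply: le_trans (slice_bound t y (h4 ord0) (c4 ord0) b4).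
    by rewrite lee_fin ler_norm.
have slice t : \int[leb 2]_y (v (consrv (t, y)) ^+ 6) <= 9 * N * \int[leb 2]_y D (consrv (t, y)).
  have Hs := C1c_slice t H.
  have := power_raise_dim2 1 Hs; rewrite -/i1 -/i2.
  have [[_ Is1] [_ Is2]] : sqint (leb 2) (fun y => v' i1 (consrv (t, y))) /\ sqint (leb 2) (fun y => v' i2 (consrv (t, y))).
    by split; [case: (C1c_integ ord0 0 Hs)|case: (C1c_integ (lift ord0 ord0) 0 Hs)].
  rewrite -RintD// => h; apply: le_trans h _; rewrite -/(D _).
  have -> : 3%:R ^+ 2 = 9 :> R by ring.
  rewrite -mulrA ler_wpM2l// ler_wpM2r//.
  by apply: Rint_ge0 => y; exact: D0.
have main : \int[leb 3]_x (v x ^+ 6) <= 9 * N * \int[leb 3]_x D x.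
  rewrite -lee_fin EFinM -!Rint_fin// fubini_cons_ge0//; last 2 first.
  - exact: integ_meas I6.
  - by move=> x; rewrite exprn_even_ge0.
  rewrite [in leRHS]fubini_cons_ge0//; last exact: integ_meas ID.
  have mDF : measurable_fun setT (fun t : measurableTypeR R => \int[leb 2]_y (D (consrv (t, y)))%:E)%E.
    apply: (measurable_fun_fubini_tonelli_F (fun z => (D (consrv z))%:E)) => //.
      by apply/measurable_EFinP; exact: (measurableT_comp (integ_meas ID) (@measurable_consrv R 2)).
    by move=> z; rewrite lee_fin.
  rewrite -ge0_integralZl//; [| |by rewrite lee_fin mulr_ge0]; last first.
    by move=> t _; apply: integral_ge0 => y _; rewrite lee_fin.
  apply: ge0_le_integral => //.
  - by move=> t _; apply: integral_ge0 => y _; rewrite lee_fin exprn_even_ge0.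
  - apply: (measurable_fun_fubini_tonelli_F (fun z => (v (consrv z) ^+ 6)%:E)) => //.
      by apply/measurable_EFinP; exact: (measurableT_comp (integ_meas I6) (@measurable_consrv R 2)).
    by move=> z; rewrite lee_fin exprn_even_ge0.
  - exact: measurable_funeM.
  - move=> t _; have Hs := C1c_slice t H.
    have [Is6 _ _ _] := C1c_integ ord0 5 Hs.
    have IsD : integ (leb 2) (fun y => D (consrv (t, y))).
      by apply: integD; [case: (C1c_integ ord0 1 Hs)|case: (C1c_integ (lift ord0 ord0) 1 Hs)].
    by rewrite !Rint_fin// -EFinM lee_fin; exact: slice.
set I := \int[leb 3]_x (v x ^+ 6) in main *.
have I0 : 0 <= I by apply: Rint_ge0 => x; rewrite exprn_even_ge0.
have hD : \int[leb 3]_x D x <= 2 * B.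
  by rewrite /D RintD// mulr_natl mulr2n lerD.
have hN : N ^+ 2 <= 16 * (I * B).
  have Iabs : integ (leb 3) (fun x => `|v x ^+ 3 * v' ord0 x|).
    have h := sqintM sv3 (sv' ord0); apply: (integ_le _ h) => [|x]; last by rewrite normr_id.
    by apply: measurableT_comp => //; exact: integ_meas h.
  have -> : N = 4 * \int[leb 3]_x `|v x ^+ 3 * v' ord0 x|.
    by rewrite -RintZ//; apply: eq_Rintegral => x _; rewrite normrM ger0_norm.
  rewrite exprMn (_ : 4 ^+ 2 = 16 :> R); last by ring.
  rewrite ler_wpM2l//; apply: le_trans (Cauchy_Schwarz_abs sv3 (sv' ord0)) _.
  have -> : \int[leb 3]_x ((v x ^+ 3) ^+ 2) = I by apply: eq_Rintegral => x _; rewrite -exprM.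
  by rewrite ler_wpM2l.
have IB : I <= 18 * (N * B).
  apply: le_trans main _; rewrite -mulrA (_ : 18 * _ = 9 * (N * (2 * B))); last by ring.
  by rewrite ler_wpM2l// ler_wpM2l.
(* The constant is abstracted so that the remaining algebra stays symbolic. *)
have [k k0 kE] : exists2 k : R, 0 <= k & 18 ^+ 2 * 16 = k.
  by exists (18 ^+ 2 * 16) => //; rewrite mulr_ge0.
have I2 : I ^+ 2 <= k * (I * B ^+ 3).
  apply: (@le_trans _ _ ((18 * (N * B)) ^+ 2)).
    by rewrite ler_sqr ?nnegrE// mulr_ge0// mulr_ge0.
  have -> : (18 * (N * B)) ^+ 2 = 18 ^+ 2 * (N ^+ 2 * B ^+ 2) by ring.
  have -> : k * (I * B ^+ 3) = 18 ^+ 2 * (16 * (I * B) * B ^+ 2) by rewrite -kE; ring.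
  by apply: ler_wpM2l; [exact: sqr_ge0|apply: ler_wpM2r; [exact: sqr_ge0|]].
rewrite kE; have B3 : B ^+ 3 <= B ^+ 2 * (B + 1).
  by rewrite exprSr ler_wpM2l ?sqr_ge0// lerDl.
have B30 : 0 <= B ^+ 2 * (B + 1) by rewrite mulr_ge0 ?sqr_ge0 ?addr_ge0.
have [I00|Ip] := eqVneq I 0; first by rewrite I00 mulr_ge0.
have Ipos : 0 < I by rewrite lt_neqAle eq_sym Ip.
rewrite -(ler_pM2l Ipos) -expr2; apply: le_trans I2 _.
have -> : I * (k * (B ^+ 2 * (B + 1))) = k * (I * (B ^+ 2 * (B + 1))) by ring.
by rewrite ler_wpM2l// ler_wpM2l.
Qed.

(** Stated for test functions, where the Sobolev inequalities are proved;
    [rH1_power_integ] carries it over to the energy space. *)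
Definition H1_controls_power n (j : nat) := forall B : R, exists C : R,
  forall v : 'rV[R]_n -> R, ctest v -> \int[leb n]_x (v x ^+ 2) <= B ->
  (forall i, \int[leb n]_x (partial i v x ^+ 2) <= B) -> \int[leb n]_x (v x ^+ (2 * j)) <= C.

Lemma H1_controls_power_dim2 k : H1_controls_power 2 k.+1.
Proof.
elim: k => [|k IH] B.
  by exists B => v tv h _; rewrite muln1.
have [C hC] := IH B; exists (k.+2%:R ^+ 2 * (`|C| * (B + B))) => v tv hv hp.
apply: le_trans (power_raise_dim2 k (ctest_C1c tv)) _.
rewrite ler_wpM2l ?sqr_ge0//; apply: ler_pM.
- by apply: Rint_ge0 => x; rewrite exprn_even_ge0// oddM.
- by apply: addr_ge0; apply: Rint_ge0 => x; exact: sqr_ge0.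
- exact: le_trans (hC v tv hv hp) (ler_norm _).
- exact: lerD.
Qed.

Lemma H1_controls_power_dim3 : H1_controls_power 3 3.
Proof.
move=> B; exists (18 ^+ 2 * 16 * (B ^+ 2 * (B + 1))) => v tv hv hp; apply: (sobolev_dim3 (ctest_C1c tv)) => //.
by apply: le_trans hv; apply: Rint_ge0 => x; exact: sqr_ge0.
Qed.

(** In the plane every even power is controlled. In space the sixth is, and
    subcriticality says that 2 sigma + 2 < 6. *)
Lemma subcritical_power n (sigma : R) : n.+2 = 2%N \/ n.+2 = 3%N -> 
  (sigma%:E < critical_exponent R n.+2)%E ->
  exists j : nat, 2 * sigma + 2 <= (2 * j.+1)%:R /\ H1_controls_power n.+2 j.+1.
Proof.
move=> [[->] _|[->]].
  pose k := Num.truncn `|sigma|; exists k.+2; split; last exact: H1_controls_power_dim2.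
  have /andP[_] := truncn_itv (normr_ge0 sigma); rewrite -/k.
  have -> : (2 * k.+3)%:R = 2 * (k.+1%:R + 2) :> R by rewrite natrM -[k.+3]addn2 natrD.
  by have := ler_norm sigma; lra.
rewrite /critical_exponent /= lte_fin => h; exists 2; split; last exact: H1_controls_power_dim3.
have -> : (2 * 3)%:R = 6 :> R by [].
move: h; have -> : (2 / (3 - 2) : R) = 2 by field.
lra.
Qed.

End C1c.

Section power_limit.
Context {R : realType} {n : nat}.
Local Notation mu := (@lebesgue_rV R n).
Variable V : 'rV[R]_n -> R.

Lemma cvg_real_bounded (u : nat -> R) (l : R) : u k @[k --> \oo] --> l -> exists B, forall k, u k <= B.
Proof.
move=> cu; have : cvg (u @ \oo) by apply/cvg_ex; exists l.
move=> /cvg_seq_bounded [M [_ hM]]; exists (M + 1) => k.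
by apply: le_trans (ler_norm _) _; apply: hM => //; rewrite ltrDl.
Qed.

Lemma pow_lip (x y K : R) j : 0 <= y -> y <= x -> x <= K ->
  x ^+ j - y ^+ j <= j%:R * K ^+ j.-1 * (x - y).
Proof.
move=> y0 yx xK; elim: j => [|j IH]; first by rewrite !expr0 subrr !mul0r.
have x0 := le_trans y0 yx; have K0 := le_trans x0 xK.
have h1 : x ^+ j * (x - y) <= K ^+ j * (x - y).
  by rewrite ler_wpM2r ?subr_ge0// lerXn2r.
have h2 : y * (x ^+ j - y ^+ j) <= K * (x ^+ j - y ^+ j).
  by rewrite ler_wpM2r ?(le_trans yx)// subr_ge0 lerXn2r ?nnegrE.
have h3 : K * (x ^+ j - y ^+ j) <= K * (j%:R * K ^+ j.-1 * (x - y)) by rewrite ler_wpM2l.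
have h4 : K * (j%:R * K ^+ j.-1 * (x - y)) = j%:R * K ^+ j * (x - y).
  by case: j {IH h1 h2 h3} => [|j]; rewrite ?mul0r ?mulr0// exprS /=; ring.
rewrite -natr1 !exprS /=.
have -> : x * x ^+ j - y * y ^+ j = x ^+ j * (x - y) + y * (x ^+ j - y ^+ j) by ring.
lra.
Qed.

(** Truncating |a| at height K makes the power Lipschitz, so that L^2 convergence alone
    bounds the truncated integrals, uniformly in K. This is Fatou's lemma without an
    almost everywhere convergent subsequence. *)
Lemma rH1_power_integ a p j : @H1_controls_power R n j.+1 -> rH1 V a p ->
  integ mu (fun x => a x ^+ (2 * j.+1)).
Proof.
move=> ctrl H; have [sa _ sp] := rH1_sqint H; have [f [tf fa _ fp]] := H.
have bnd F u : L2cvg mu F u -> exists B, forall k, \int[mu]_x (F k x ^+ 2) <= B.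
  by move=> c; have := cvg_real_bounded (L2cvg_inner c c).
have [B0 hB0] := bnd _ _ fa.
have /choice[Bi hBi] i := bnd _ _ (fp i).
(* The approximants are bounded in H^1, so their powers have bounded integrals. *)
pose B := `|B0| + \sum_i `|Bi i|.
have [C hC] := ctrl B.
have fC k : \int[mu]_x (f k x ^+ (2 * j.+1)) <= C.
  apply: hC => //.
    by apply: le_trans (hB0 k) _; rewrite (le_trans (ler_norm _))// lerDl sumr_ge0.
  move=> i; apply: le_trans (hBi i k) _; rewrite (le_trans (ler_norm _))// /B (bigD1 i)//=.
  by rewrite addrCA lerDl addr_ge0// sumr_ge0.
have ma : measurable_fun setT a by case: sa.
have E (z : R) : z ^+ (2 * j.+1) = (`|z| ^+ j.+1) ^+ 2.
  by rewrite exprM -(real_normK (num_real z)) -!exprM mulnC.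
pose g (K : nat) x := Num.min `|a x| K%:R.
have mg K : measurable_fun setT (g K).
  by apply: measurable_minr => //; exact: measurableT_comp.
have g0 K x : 0 <= g K x by rewrite le_min normr_ge0 ler0n.
have If k : integ mu (fun x => f k x ^+ (2 * j.+1)).
  have [sfk bfk] := tf k; rewrite mulnS; apply: cont_bsupp_integ; last exact: bsuppX.
  exact: rV_contX (smooth_cont sfk).
have step K : (\int[mu]_x (g K x ^+ (2 * j.+1))%:E <= (2 * C + 1)%:E)%E.
  pose L : R := j.+1%:R * K%:R ^+ j.
  have pt k x : g K x ^+ (2 * j.+1) <= 2 * f k x ^+ (2 * j.+1) + 2 * L ^+ 2 * (f k x - a x) ^+ 2.
    have h : g K x ^+ j.+1 <= `|f k x| ^+ j.+1 + L * `|f k x - a x|.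
      have L0 : 0 <= L by rewrite mulr_ge0// exprn_ge0.
      case: (lerP (g K x) `|f k x|) => hfg.
        by apply: (@le_trans _ _ (`|f k x| ^+ j.+1)); [rewrite lerXn2r ?nnegrE|rewrite lerDl mulr_ge0].
      have gK : g K x <= K%:R by rewrite ge_min lexx orbT.
      have := pow_lip j.+1 (normr_ge0 (f k x)) (ltW hfg) gK; rewrite /= -/L => h1.
      rewrite addrC -lerBlDr; apply: le_trans h1 _; rewrite ler_wpM2l//.
      have ga : g K x <= `|a x| by rewrite ge_min lexx.
      have := lerB_dist (a x) (f k x); rewrite distrC; lra.
    rewrite !E (ger0_norm (g0 K x)) -(real_normK (num_real (f k x - a x))).
    have p0 : 0 <= g K x ^+ j.+1 by rewrite exprn_ge0.
    move: h p0; set u := _ ^+ j.+1; set w := `|f k x| ^+ j.+1; set z := `|_ - _| => h p0.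
    have h2 : u ^+ 2 <= (w + L * z) ^+ 2 by rewrite ler_sqr ?nnegrE// (le_trans p0).
    have := sqr_ge0 (w - L * z); nra.
  have [_ _ c0] := fa.
  have [k hk] : exists k, 2 * L ^+ 2 * \int[mu]_x ((f k x - a x) ^+ 2) <= 1.
    have c1 : 2 * L ^+ 2 * \int[mu]_x ((f k x - a x) ^+ 2) @[k --> \oo] --> 2 * L ^+ 2 * 0.
      exact: cvgMr.
    rewrite mulr0 in c1; have [N _ hN] := (cvgr_le _ c1 1 ltr01).
    by exists N; apply: hN => /=.
  have [_ Id] : sqint mu (fun x => f k x - a x) by apply: sqintB => //; exact: ctest_sqint.
  have I1 := integZ 2 (If k); have I2 := integZ (2 * L ^+ 2) Id.
  apply: (@le_trans _ _ (\int[mu]_x (2 * f k x ^+ (2 * j.+1) + 2 * L ^+ 2 * (f k x - a x) ^+ 2)%:E)%E).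
    apply: ge0_le_integral => //.
    - by move=> x _; rewrite lee_fin exprn_ge0.
    - by apply/measurable_EFinP; exact: measurable_funX.
    - by apply/measurable_EFinP; exact: integ_meas (integD I1 I2).
    - by move=> x _; rewrite lee_fin.
  rewrite Rint_fin; last exact: integD.
  by rewrite lee_fin RintD// RintZ// RintZ//; apply: lerD => //; rewrite ler_wpM2l.
apply: integ_lty.
- exact: measurable_funX.
- by move=> x; rewrite E sqr_ge0.
have lim_g x : limn (fun K => (g K x ^+ (2 * j.+1))%:E) = (a x ^+ (2 * j.+1))%:E.
  apply: cvg_lim => //; apply: cvg_near_cst.
  exists (Num.truncn `|a x|).+1 => // K /= hK; congr EFin.
  rewrite [RHS]E /g min_l; first by rewrite exprM exprAC.
  have /andP[_ h] := truncn_itv (normr_ge0 (a x)).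
  by apply/ltW/(lt_le_trans h); rewrite ler_nat.
have nd x : {homo (fun K => (g K x ^+ (2 * j.+1))%:E) : m1 m2 / (m1 <= m2)%N >-> (m1 <= m2)%E}.
  move=> m1 m2 m12; rewrite lee_fin lerXn2r ?nnegrE// /g le_min !ge_min lexx /=.
  by rewrite ler_nat m12 orbT.
have -> : (\int[mu]_x (a x ^+ (2 * j.+1))%:E = \int[mu]_x limn (fun K => (g K x ^+ (2 * j.+1))%:E))%E.
  by apply: eq_integral => x _; rewrite lim_g.
rewrite monotone_convergence//; last first.
- by move=> K x _; rewrite lee_fin exprn_ge0.
- by move=> K; apply/measurable_EFinP; exact: measurable_funX.
apply: (@le_lt_trans _ _ (2 * C + 1)%:E); last by rewrite ltry.
apply: lime_le; last by apply: nearW => K; exact: step.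
apply: ereal_nondecreasing_is_cvgn => m1 m2 m12; apply: ge0_le_integral => //.
- by move=> x _; rewrite lee_fin exprn_ge0.
- by apply/measurable_EFinP; exact: measurable_funX.
- by apply/measurable_EFinP; exact: measurable_funX.
- by move=> x _; exact: nd.
Qed.

End power_limit.

(** * The quadratic forms and the constraints *)

Section potential.
Context {R : realType} {n : nat}.
Variable V : 'rV[R]_n -> R.
Hypothesis hV : admissible_potential V.

Lemma potential_cont : continuous V.
Proof. exact: smooth_cont (potential_smooth hV). Qed.

(** Outside a ball this is the growth condition with k > 2; inside, |x|^2 is bounded. *)
Lemma potential_dominates_sqr : exists2 C, 0 <= C & forall (x : 'rV[R]_n) i, (x ord0 i) ^+ 2 <= C * (1 + V x).
Proof.
have [k [r [c0 [k2 r0 c00 growth _]]]] := potential_growth hV.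
exists (r ^+ 2 + c0^-1); first by rewrite addr_ge0 ?sqr_ge0// invr_ge0 ltW.
move=> x i; have V0 := potential_ge0 hV x.
have h1 : x ord0 i ^+ 2 <= enorm x ^+ 2.
  by rewrite enorm_sqr (bigD1 i)//= lerDl sumr_ge0// => j _; exact: sqr_ge0.
apply: le_trans h1 _; have ic0 : 0 <= c0^-1 by rewrite invr_ge0 ltW.
case: (lerP (enorm x) r) => h.
  apply: (@le_trans _ _ (r ^+ 2)); first by rewrite ler_sqr ?nnegrE ?sqrtr_ge0// ltW.
  have := sqr_ge0 r; have := mulr_ge0 ic0 V0; have := mulr_ge0 (sqr_ge0 r) V0; nra.
have g := growth x h.
have j1 : 1 <= japanese x by rewrite -[1]sqrtr1 ler_wsqrtr// lerDl sqr_ge0.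
have jE : japanese x ^+ 2 = 1 + enorm x ^+ 2 by rewrite sqr_sqrtr// addr_ge0// sqr_ge0.
have h2 : japanese x ^+ 2 <= japanese x `^ k.
  by rewrite -powR_mulrn ?(le_trans _ j1)// ler_powR// ltW.
have h3 : japanese x `^ k <= c0^-1 * V x by rewrite mulrC ler_pdivlMr// mulrC.
have := mulr_ge0 (sqr_ge0 r) V0; have := sqr_ge0 r; nra.
Qed.

End potential.

Section forms.
Context {R : realType} {n : nat}.
Local Notation d := n.+2.
Local Notation mu := (@lebesgue_rV R d).
Variable V : 'rV[R]_d -> R.
Hypothesis hV : admissible_potential V.
Let cV := potential_cont hV.
Let V0 := potential_ge0 hV.
Let Vg := potential_dominates_sqr hV.

(** A complex function together with a gradient, in real and imaginary parts. Since the
    gradient is carried along, the forms below are exactly bilinear, whereas grad is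
    determined only almost everywhere. *)
Record cfun := CFun { fre : 'rV[R]_d -> R; gre : 'I_d -> 'rV[R]_d -> R;
                      fim : 'rV[R]_d -> R; gim : 'I_d -> 'rV[R]_d -> R }.

Definition in_H1 X := rH1 V (fre X) (gre X) /\ rH1 V (fim X) (gim X).
Definition lin (s : R) X (t : R) Y :=
  CFun (fun x => s * fre X x + t * fre Y x) (fun i x => s * gre X i x + t * gre Y i x)
       (fun x => s * fim X x + t * fim Y x) (fun i x => s * gim X i x + t * gim Y i x).
(** The real part is spelled as a linear combination, so that [rH1_lin] applies to it. *)
Definition mul_i X := CFun (fun x => -1 * fim X x + 0 * fim X x) (fun i x => -1 * gim X i x + 0 * gim X i x)
  (fre X) (gre X).

Lemma in_H1_lin s X t Y : in_H1 X -> in_H1 Y -> in_H1 (lin s X t Y).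
Proof. by move=> [h1 h2] [h3 h4]; split; exact: rH1_lin. Qed.
Lemma in_H1_mul_i X : in_H1 X -> in_H1 (mul_i X).
Proof. by move=> [h1 h2]; split => //; exact: rH1_lin. Qed.

(** Here mass_d, ham_d and angmom_d are the densities of the real parts of <u, v>,
    <(- Delta / 2 + V) u, v> and <L_z u, v>. *)
Definition mass_d X Y x := fre X x * fre Y x + fim X x * fim Y x.
Definition ham_d X Y x := 2^-1 * (\sum_i (gre X i x * gre Y i x + gim X i x * gim Y i x)) + V x * mass_d X Y x.
Definition angmom_d X Y x := ang (gim X) x * fre Y x - ang (gre X) x * fim Y x.
Definition mass X Y := \int[mu]_x mass_d X Y x.
Definition ham X Y := \int[mu]_x ham_d X Y x.
Definition angmom X Y := \int[mu]_x angmom_d X Y x.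

Lemma mass_integ X Y : in_H1 X -> in_H1 Y -> integ mu (mass_d X Y).
Proof.
move=> [/rH1_sqint[h1 _ _] /rH1_sqint[h2 _ _]] [/rH1_sqint[h3 _ _] /rH1_sqint[h4 _ _]].
by apply: integD; exact: sqintM.
Qed.

Lemma ham_integ X Y : in_H1 X -> in_H1 Y -> integ mu (ham_d X Y).
Proof.
move=> [/rH1_sqint[_ h1 p1] /rH1_sqint[_ h2 p2]] [/rH1_sqint[_ h3 p3] /rH1_sqint[_ h4 p4]].
apply: integD.
  apply: integZ; apply: (integ_sum _ _).1 => i.
  by apply: integD; exact: sqintM.
have := integD (sqintM h1 h3) (sqintM h2 h4); congr (integ mu _); apply/funext => x.
have := sqr_sqrtr (V0 x); set s := Num.sqrt _ => <-; rewrite /mass_d; ring.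
Qed.

Lemma angmom_integ X Y : in_H1 X -> in_H1 Y -> integ mu (angmom_d X Y).
Proof.
by move=> [h1 h2] [h3 h4]; apply: integB; [exact: (ang_integ V0 Vg h2 h3)|exact: (ang_integ V0 Vg h1 h4)].
Qed.

Lemma mass_lin s X t Y Z : in_H1 X -> in_H1 Y -> in_H1 Z -> mass (lin s X t Y) Z = s * mass X Z + t * mass Y Z.
Proof.
move=> hX hY hZ; have i1 := mass_integ hX hZ; have i2 := mass_integ hY hZ.
rewrite /mass -!RintZ// -RintD; [|exact: integZ|exact: integZ].
by congr Rintegral; apply/funext => x; rewrite /mass_d /=; ring.
Qed.

Lemma ham_lin s X t Y Z : in_H1 X -> in_H1 Y -> in_H1 Z -> ham (lin s X t Y) Z = s * ham X Z + t * ham Y Z.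
Proof.
move=> hX hY hZ; have i1 := ham_integ hX hZ; have i2 := ham_integ hY hZ.
rewrite /ham -!RintZ// -RintD; [|exact: integZ|exact: integZ].
congr Rintegral; apply/funext => x; rewrite /ham_d /=.
have -> : \sum_i ((s * gre X i x + t * gre Y i x) * gre Z i x + (s * gim X i x + t * gim Y i x) * gim Z i x) =
  s * (\sum_i (gre X i x * gre Z i x + gim X i x * gim Z i x)) + t * (\sum_i (gre Y i x * gre Z i x + gim Y i x * gim Z i x)).
  by rewrite !mulr_sumr -big_split /=; apply: eq_bigr => i _; ring.
by rewrite /mass_d /=; ring.
Qed.

Lemma angmom_lin s X t Y Z : in_H1 X -> in_H1 Y -> in_H1 Z -> angmom (lin s X t Y) Z = s * angmom X Z + t * angmom Y Z.
Proof.
move=> hX hY hZ; have i1 := angmom_integ hX hZ; have i2 := angmom_integ hY hZ.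
rewrite /angmom -!RintZ// -RintD; [|exact: integZ|exact: integZ].
by congr Rintegral; apply/funext => x; rewrite /angmom_d /ang /=; ring.
Qed.

Lemma mass_sym X Y : mass X Y = mass Y X.
Proof. by congr Rintegral; apply/funext => x; rewrite /mass_d; ring. Qed.

Lemma ham_sym X Y : ham X Y = ham Y X.
Proof.
congr Rintegral; apply/funext => x; rewrite /ham_d /mass_d; congr (_ * _ + _); last by ring.
by apply: eq_bigr => i _; ring.
Qed.

Lemma angmom_sym X Y : in_H1 X -> in_H1 Y -> angmom X Y = angmom Y X.
Proof.
move=> [h1 h2] [h3 h4].
have E U W : in_H1 U -> in_H1 W -> angmom U W = \int[mu]_x (ang (gim U) x * fre W x) - \int[mu]_x (ang (gre U) x * fim W x).
  by move=> [k1 k2] [k3 k4]; rewrite /angmom RintB//; [exact: (ang_integ V0 Vg k2 k3)|exact: (ang_integ V0 Vg k1 k4)].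
rewrite !E//.
rewrite (ang_antisym cV V0 Vg h2 h3) (ang_antisym cV V0 Vg h1 h4) opprK addrC //.
Qed.

Lemma sym_expand (f : cfun -> cfun -> R) :
  (forall s X t Y Z, in_H1 X -> in_H1 Y -> in_H1 Z -> f (lin s X t Y) Z = s * f X Z + t * f Y Z) ->
  (forall X Y, in_H1 X -> in_H1 Y -> f X Y = f Y X) ->
  forall s X t Y, in_H1 X -> in_H1 Y ->
  f (lin s X t Y) (lin s X t Y) = s ^+ 2 * f X X + 2 * s * t * f X Y + t ^+ 2 * f Y Y.
Proof.
move=> fl fs s X t Y hX hY; have hL := in_H1_lin s t hX hY.
rewrite fl// (fs X (lin _ _ _ _))// (fs Y (lin _ _ _ _))// !fl// (fs Y X)//; ring.
Qed.

Definition toC X : 'rV[R]_d -> R[i] := fun x => Complex (fre X x) (fim X x).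
Definition gC X : 'I_d -> 'rV[R]_d -> R[i] := fun i x => Complex (gre X i x) (gim X i x).
Definition ofC (u : 'rV[R]_d -> R[i]) := CFun (fun x => complex.Re (u x))
  (fun i x => complex.Re (grad V u i x)) (fun x => complex.Im (u x)) (fun i x => complex.Im (grad V u i x)).

Lemma toC_ofC u : toC (ofC u) = u.
Proof. by apply/funext => x; rewrite /toC /=; case: (u x). Qed.

Lemma in_H1_ofC u : H1space V u -> in_H1 (ofC u).
Proof. by move=> /gradP /(H1_gradient_rH1 cV). Qed.

Lemma toC_grad X : in_H1 X -> H1_gradient V (toC X) (gC X).
Proof. by move=> [h1 h2]; exact: (rH1_H1_gradient cV). Qed.

Lemma toC_H1 X : in_H1 X -> H1space V (toC X).
Proof. by move=> h; exists (gC X); exact: toC_grad. Qed.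

Definition same_fun X Y := fre X = fre Y /\ fim X = fim Y.

(** Two gradients of one function agree almost everywhere, so the forms depend on the
    functions alone. *)
Lemma same_grad X Y : in_H1 X -> in_H1 Y -> same_fun X Y ->
  {ae mu, forall x, forall i, gre X i x = gre Y i x /\ gim X i x = gim Y i x}.
Proof.
move=> [h1 h2] [h3 h4] [ea eb]; apply: filter_forall => i.
have H1 := rH1_grad_unique i h1 h3 (aeW _ (fun x => congr1 (fun f => f x) ea)).
have H2 := rH1_grad_unique i h2 h4 (aeW _ (fun x => congr1 (fun f => f x) eb)).
by apply: filterS2 H1 H2 => x -> ->.
Qed.

Lemma ham_ext X Y Z : in_H1 X -> in_H1 Y -> in_H1 Z -> same_fun X Y -> ham X Z = ham Y Z.
Proof.
move=> hX hY hZ s; have i1 := ham_integ hX hZ; have i2 := ham_integ hY hZ.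
have [|_ E] := Rint_ae i1 (integ_meas i2); last exact: E.
apply: filterS (same_grad hX hY s) => x h; case: s => sa sb.
rewrite /ham_d /mass_d sa sb; congr (_ * _ + _).
by apply: eq_bigr => i _; case: (h i) => -> ->.
Qed.

Lemma angmom_ext X Y Z : in_H1 X -> in_H1 Y -> in_H1 Z -> same_fun X Y -> angmom X Z = angmom Y Z.
Proof.
move=> hX hY hZ s; have i1 := angmom_integ hX hZ; have i2 := angmom_integ hY hZ.
have [|_ E] := Rint_ae i1 (integ_meas i2); last exact: E.
apply: filterS (same_grad hX hY s) => x h.
by rewrite /angmom_d /ang; case: (h (@axis1 n)) => -> ->; case: (h (@axis2 n)) => -> ->.
Qed.

Lemma same_refl X : in_H1 X -> same_fun (ofC (toC X)) X. Proof. by []. Qed.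

Lemma ham_ext2 X Y : in_H1 X -> in_H1 Y -> same_fun X Y -> ham X X = ham Y Y.
Proof.
by move=> hX hY s; rewrite (ham_ext hX hY hX s) ham_sym (ham_ext hX hY hY s).
Qed.

Lemma angmom_ext2 X Y : in_H1 X -> in_H1 Y -> same_fun X Y -> angmom X X = angmom Y Y.
Proof.
by move=> hX hY s; rewrite (angmom_ext hX hY hX s) angmom_sym// (angmom_ext hX hY hY s).
Qed.

Lemma LzE u x : Lz V u x = Complex (ang (gim (ofC u)) x) (- ang (gre (ofC u)) x).
Proof.
rewrite /Lz /ang /= -complexiE.
case: (grad V u axis2 x) => a b; case: (grad V u axis1 x) => a' b' /=.
by congr Complex; ring.
Qed.

Lemma cmulE (a b c e : R) : Complex a b * Complex c e = Complex (a * c - b * e) (a * e + b * c).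
Proof. by []. Qed.

Lemma conjE (z : R[i]) : z^* = Complex (complex.Re z) (- complex.Im z).
Proof. by case: z. Qed.

Lemma Lz_conj u x : Lz V u x * (u x)^* = Complex (angmom_d (ofC u) (ofC u) x)
  (- (ang (gre (ofC u)) x * complex.Re (u x) + ang (gim (ofC u)) x * complex.Im (u x))).
Proof.
rewrite LzE conjE /angmom_d /=; case: (u x) => a b /=.
by rewrite cmulE; congr Complex; ring.
Qed.

Lemma G1E (m : R) X : G1 m (toC X) = mass X X - m.
Proof.
rewrite /G1; congr (_ - _); congr Rintegral; apply/funext => x.
by rewrite cabs_sqr /mass_d /=; ring.
Qed.

(** The imaginary part is the integral of an angular derivative against the function
    itself, which vanishes by antisymmetry. *)
Lemma G2E (l : R) X : in_H1 X -> G2 V l (toC X) = Complex (angmom X X - l) 0.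
Proof.
move=> hX; have hX' := in_H1_ofC (toC_H1 hX); have [h1 h2] := hX'.
rewrite /G2 /cintegral.
have E1 : \int[mu]_x complex.Re (Lz V (toC X) x * (toC X x)^*) = angmom X X.
  rewrite -(angmom_ext2 hX' hX (same_refl hX)); congr Rintegral; apply/funext => x.
  by rewrite Lz_conj.
have E2 : \int[mu]_x complex.Im (Lz V (toC X) x * (toC X x)^*) = 0.
  have i1 := ang_integ V0 Vg h1 h1; have i2 := ang_integ V0 Vg h2 h2.
  transitivity (- (\int[mu]_x (ang (gre (ofC (toC X))) x * fre X x) + \int[mu]_x (ang (gim (ofC (toC X))) x * fim X x))).
    rewrite -RintD// -mulN1r -RintZ; last exact: integD.
    by congr Rintegral; apply/funext => x; rewrite Lz_conj mulN1r.
  have a1 := ang_antisym cV V0 Vg h1 h1; have a2 := ang_antisym cV V0 Vg h2 h2.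
  by move: a1 a2; rewrite /=; lra.
rewrite E1 E2; apply/eqP; rewrite eq_complex /=; apply/andP; split; apply/eqP; ring.
Qed.

Lemma constraintE (m l : R) X : in_H1 X ->
  constraint_set V m l (toC X) <-> mass X X = m /\ angmom X X = l.
Proof.
move=> hX; split.
  move=> [_]; rewrite G1E (G2E l hX) => /eqP; rewrite subr_eq0 => /eqP -> [] /eqP.
  by rewrite subr_eq0 => /eqP.
move=> [e1 e2]; split; first exact: toC_H1.
  by rewrite G1E e1 subrr.
by rewrite (G2E l hX) e2 subrr.
Qed.

Lemma toC_lin s X t Y : toC (lin s X t Y) = fun x => s%:C%C * toC X x + t%:C%C * toC Y x.
Proof.
apply/funext => x; apply/eqP; rewrite eq_complex /=; apply/andP; split; apply/eqP; ring.
Qed.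

Lemma quad_is_derive (a b c : R) : is_derive (0:R) (1:R) (fun t : R => a + t * b + t ^+ 2 * c) b.
Proof.
apply/is_derive1P => e e0; exists (e / (`|c| + 1)); first by rewrite divr_gt0// ltr_wpDl.
move=> h hh; rewrite add0r.
rewrite (_ : _ - _ - _ = h * (h * c)); last by ring.
rewrite normrM mulrC ler_wpM2r// normrM.
rewrite ltr_pdivlMr in hh; last by rewrite ltr_wpDl.
have := normr_ge0 h; lra.
Qed.

Lemma dG1E (m : R) X Y : in_H1 X -> in_H1 Y -> dG1 m (toC X) (toC Y) = 2 * mass X Y.
Proof.
move=> hX hY; rewrite /dG1.
have E : (fun t : R => G1 m (fun x => toC X x + t%:C%C * toC Y x)) =
   fun t => (mass X X - m) + t * (2 * mass X Y) + t ^+ 2 * mass Y Y.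
  apply/funext => t; rewrite (_ : (fun x => _) = toC (lin 1 X t Y)); last first.
    by rewrite toC_lin; apply/funext => x; rewrite mul1r.
  by rewrite G1E (sym_expand mass_lin (fun _ _ _ _ => mass_sym _ _))//; ring.
by rewrite E; case: (quad_is_derive (mass X X - m) (2 * mass X Y) (mass Y Y)).
Qed.

Lemma dG2E (l : R) X Y : in_H1 X -> in_H1 Y -> dG2 V l (toC X) (toC Y) = Complex (2 * angmom X Y) 0.
Proof.
move=> hX hY; rewrite /dG2 /cderive.
have E : (fun t : R => G2 V l (fun x => toC X x + t%:C%C * toC Y x)) =
   fun t => Complex ((angmom X X - l) + t * (2 * angmom X Y) + t ^+ 2 * angmom Y Y) 0.
  apply/funext => t; rewrite (_ : (fun x => _) = toC (lin 1 X t Y)); last first.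
    by rewrite toC_lin; apply/funext => x; rewrite mul1r.
  rewrite G2E; last exact: in_H1_lin.
  by rewrite (sym_expand angmom_lin angmom_sym)//; congr Complex; ring.
congr Complex.
  rewrite (_ : (fun w : R^o => _) = fun t : R => (angmom X X - l) + t * (2 * angmom X Y) + t ^+ 2 * angmom Y Y).
    by case: (quad_is_derive (angmom X X - l) (2 * angmom X Y) (angmom Y Y)).
  by apply/funext => t; rewrite [X in complex.Re X](congr1 (fun F => F t) E).
rewrite (_ : (fun w : R^o => _) = cst (0:R)); first exact: derive_cst.
by apply/funext => t; rewrite [X in complex.Im X](congr1 (fun F => F t) E).
Qed.

Definition ofR (f : 'rV[R]_d -> R) := CFun f (partial^~ f) (fun=> 0) (fun i => partial i (fun=> 0)).
Definition ofI (f : 'rV[R]_d -> R) := CFun (fun=> 0) (fun i => partial i (fun=> 0)) f (partial^~ f).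

Lemma in_H1_ofR f : ctest f -> in_H1 (ofR f).
Proof. by move=> tf; split; apply: (rH1_test cV) => //; exact: ctest0. Qed.
Lemma in_H1_ofI f : ctest f -> in_H1 (ofI f).
Proof. by move=> tf; split; apply: (rH1_test cV) => //; exact: ctest0. Qed.

Lemma nonzero_mass X : in_H1 X -> mass X X != 0 ->
  ~ ({ae mu, forall x, fre X x = 0} /\ {ae mu, forall x, fim X x = 0}).
Proof.
move=> hX nz [a0 b0]; move/eqP: nz; apply.
have I0 : integ mu (fun x => 0 * mass_d X X x) by exact: integZ (mass_integ hX hX).
have [|_ E] := Rint_ae I0 (integ_meas (mass_integ hX hX)).
  by apply: filterS2 a0 b0 => x e1 e2; rewrite /mass_d e1 e2 !mul0r addr0.
by rewrite /mass -E RintZ ?mul0r//; exact: mass_integ.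
Qed.

Lemma Lz_eigenE X (c : R) : in_H1 X -> mass X X != 0 ->
  {ae mu, forall x, ang (gim X) x = c * fre X x} -> {ae mu, forall x, ang (gre X) x = - c * fim X x} ->
  Lz_eigenfunction V (toC X) c.
Proof.
move=> hX nz e1 e2; split; first exact: toC_H1.
  move=> z; apply: (nonzero_mass hX nz); split; apply: filterS z => x; rewrite /toC => -[] //.
have sg := same_grad (in_H1_ofC (toC_H1 hX)) hX (same_refl hX).
apply: filterS3 e1 e2 sg => x h1 h2 h3; rewrite LzE.
rewrite (_ : ang (gim (ofC (toC X))) x = ang (gim X) x); last first.
  by rewrite /ang (h3 (@axis1 n)).2 (h3 (@axis2 n)).2.
rewrite (_ : ang (gre (ofC (toC X))) x = ang (gre X) x); last first.
  by rewrite /ang (h3 (@axis1 n)).1 (h3 (@axis2 n)).1.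
by rewrite h1 h2 /toC; apply/eqP; rewrite eq_complex /=; apply/andP; split; apply/eqP; ring.
Qed.

Lemma Lz_eigen_ae u (c : R) : Lz_eigenfunction V u c ->
  {ae mu, forall x, ang (gim (ofC u)) x = c * fre (ofC u) x} /\
  {ae mu, forall x, ang (gre (ofC u)) x = - c * fim (ofC u) x}.
Proof.
move=> [_ _ h]; split; apply: filterS h => x; rewrite LzE /=; case: (u x) => a b;
  rewrite cmulE => -[e1 e2] /=.
  by rewrite e1; ring.
by apply: oppr_inj; rewrite e2; ring.
Qed.

Lemma eigen_angmom U (c : R) Y : in_H1 U -> in_H1 Y ->
  {ae mu, forall x, ang (gim U) x = c * fre U x} -> {ae mu, forall x, ang (gre U) x = - c * fim U x} ->
  angmom U Y = c * mass U Y.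
Proof.
move=> hU hY e1 e2; rewrite /mass -RintZ; last exact: mass_integ.
have [|_ E] := Rint_ae (angmom_integ hU hY) (integ_meas (integZ c (mass_integ hU hY))); last exact: E.
by apply: filterS2 e1 e2 => x h1 h2; rewrite /angmom_d /mass_d h1 h2; ring.
Qed.

Lemma Lz_eigenvalue_natural u (c : R) : Lz_eigenfunction V u c -> 0 <= c -> exists k : nat, c = k%:R.
Proof.
move=> h c0; have [hu nz _] := h; have [e1 e2] := Lz_eigen_ae h.
have [h1 h2] := in_H1_ofC hu.
apply: (eigenvalue_natural h1 h2 c0 e1 e2) => -[z1 z2]; apply: nz.
apply: filterS2 z1 z2 => x /=; case: (u x) => a b /= -> ->; reflexivity.
Qed.

(** Against real and imaginary test functions a dependence reads a u + b L_z u = 0.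
    Since u is nonzero so is b, and pairing with u identifies - a / b with l / m. *)
Lemma not_regular_eigen (m l : R) u : 0 < m -> constraint_set V m l u -> ~ regular V m l u ->
  Lz_eigenfunction V u (l / m).
Proof.
move=> m0 hu nreg; have [hu1 _ _] := hu; have hU := in_H1_ofC hu1; set U := ofC u in hU.
have uE : u = toC U by rewrite toC_ofC.
move: hu; rewrite uE => /(constraintE m l hU)[Em El].
have [a [b [hab nz]]] : exists a b : R, (forall Y, in_H1 Y -> a * mass U Y + b * angmom U Y = 0) /\ ((a != 0) || (b != 0)).
  apply: contrapT => H; apply: nreg => a b hab.
  have hab' Y : in_H1 Y -> a * mass U Y + b * angmom U Y = 0.
    move=> hY; have := hab (toC Y) (toC_H1 hY).
    rewrite uE (dG1E _ hU hY) (dG2E _ hU hY) cmulE => -[]; set p := mass _ _; set q := angmom _ _ => h _.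
    by move: h; clear; lra.
  apply: contrapT => nab; apply: H; exists a, b; split => //.
  by apply: contrapT => /negP; rewrite negb_or !negbK => /andP[/eqP a0 /eqP b0]; apply: nab.
have [hU1 hU2] := hU.
have Z1 : {ae mu, forall x, a * fre U x + b * ang (gim U) x = 0}.
  have key := ang_fundamental (s := a) (t := b) hU1 hU2; apply: key => f tf.
  have hf := in_H1_ofR tf; rewrite -[RHS](hab _ hf) /mass /angmom.
  have i1 := mass_integ hU hf; have i2 := angmom_integ hU hf; rewrite -!RintZ// -RintD.
  - by congr Rintegral; apply/funext => x; rewrite /mass_d /angmom_d /=; ring.
  - exact/integZ/mass_integ.
  - exact/integZ/angmom_integ.
have Z2 : {ae mu, forall x, a * fim U x + - b * ang (gre U) x = 0}.
  have key := ang_fundamental (s := a) (t := - b) hU2 hU1; apply: key => f tf.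
  have hf := in_H1_ofI tf; rewrite -[RHS](hab _ hf) /mass /angmom.
  have i1 := mass_integ hU hf; have i2 := angmom_integ hU hf; rewrite -!RintZ// -RintD.
  - by congr Rintegral; apply/funext => x; rewrite /mass_d /angmom_d /=; ring.
  - exact/integZ/mass_integ.
  - exact/integZ/angmom_integ.
have mnz : mass U U != 0 by rewrite Em gt_eqF.
have bnz : b != 0.
  apply/eqP => b0; rewrite b0 eqxx orbF in nz; apply: (nonzero_mass hU mnz); split.
    by apply: filterS Z1 => x; rewrite b0 mul0r addr0 => /eqP; rewrite mulf_eq0 (negbTE nz) => /eqP.
  by apply: filterS Z2 => x; rewrite b0 oppr0 mul0r addr0 => /eqP; rewrite mulf_eq0 (negbTE nz) => /eqP.
have e1 : {ae mu, forall x, ang (gim U) x = (- a / b) * fre U x}.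
  apply: filterS Z1 => x h; apply: (mulfI bnz).
  have -> : b * (- a / b * fre U x) = - (a * fre U x) by field.
  by apply/eqP; rewrite -addr_eq0 addrC h.
have e2 : {ae mu, forall x, ang (gre U) x = - (- a / b) * fim U x}.
  apply: filterS Z2 => x h; apply: (mulfI bnz).
  have -> : b * (- (- a / b) * fim U x) = a * fim U x by field.
  by apply/eqP; rewrite eq_sym -subr_eq0 -mulNr h.
have cE : - a / b = l / m.
  by have := eigen_angmom hU hU e1 e2; rewrite El Em => ->; rewrite mulfK// gt_eqF.
by rewrite -cE; exact: Lz_eigenE.
Qed.

End forms.

(** * Minimality and the null cone *)

Section power.
Context {R : realType}.

(** Young's inequality. It says that s^P lies above its tangent at r:
    r^P + P r^(P-1) (s - r) <= s^P. *)
Lemma power_tangent (P r s : R) : 1 < P -> 0 <= r -> 0 <= s ->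
  P * (r `^ (P - 1) * s) <= (P - 1) * r `^ P + s `^ P.
Proof.
move=> P1 r0 s0; have P0 : 0 < P by apply: lt_trans P1.
have P10 : 0 < P - 1 by rewrite subr_gt0.
have q0 : 0 < P / (P - 1) by rewrite divr_gt0.
have := @conjugate_powR R (r `^ (P - 1)) s (P / (P - 1)) P (powR_ge0 _ _) s0 q0 P0.
rewrite -powRrM (_ : (P - 1) * _ = P); last by field; rewrite gt_eqF.
move=> h.
have /h {}h : (P / (P - 1))^-1 + P^-1 = 1 by field; rewrite gt_eqF//= gt_eqF.
rewrite -(ler_pM2l P0) in h; apply: le_trans h _; rewrite le_eqVlt; apply/orP; left; apply/eqP.
by field; rewrite gt_eqF//= gt_eqF.
Qed.

Lemma power_sandwich (P r : R) j : 0 <= r -> 2 <= P -> P <= (2 * j.+1)%:R ->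
  r `^ P <= r ^+ 2 + r ^+ (2 * j.+1).
Proof.
move=> r0 P2 Pj; have [->|rn] := eqVneq r 0.
  by rewrite powR0 ?gt_eqF ?(lt_le_trans _ P2)// addr_ge0 ?exprn_ge0.
have rp : 0 < r by rewrite lt_def rn.
case: (lerP r 1) => h.
  apply: (@le_trans _ _ (r ^+ 2)); last by rewrite lerDl exprn_ge0.
  by rewrite -powR_mulrn//; apply: ger_powR => //; rewrite rp h.
apply: (@le_trans _ _ (r ^+ (2 * j.+1))); last by rewrite lerDr exprn_ge0.
by rewrite -powR_mulrn//; apply: ler_powR => //; exact: ltW.
Qed.

Lemma pow_sqr_sum_le (a b : R) j : (a ^+ 2 + b ^+ 2) ^+ j <= 2 ^+ j * (a ^+ (2 * j) + b ^+ (2 * j)).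
Proof.
have H x y : x ^+ 2 <= y ^+ 2 -> (x ^+ 2 + y ^+ 2) ^+ j <= 2 ^+ j * (x ^+ (2 * j) + y ^+ (2 * j)) :> R.
  move=> h; apply: (@le_trans _ _ ((2 * y ^+ 2) ^+ j)).
    have x0 := sqr_ge0 x; have y0 := sqr_ge0 y.
    by apply: lerXn2r; rewrite ?nnegrE; move: h x0 y0; set p := x ^+ 2; set q := y ^+ 2; lra.
  by rewrite exprMn ler_wpM2l ?exprn_ge0// -exprM lerDr exprM exprn_ge0 ?sqr_ge0.
case: (lerP (a ^+ 2) (b ^+ 2)) => h; first exact: H.
by rewrite addrC [X in _ * X]addrC; apply: H; exact: ltW.
Qed.

Lemma no_slope (D K : R) : 0 <= K -> (forall t, `|t| <= 1 -> 0 <= 2 * t * D + K * t ^+ 2) -> D = 0.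
Proof.
move=> K0 h.
(* The parabola is negative at - D / M unless D = 0. *)
set M := `|D| + K + 1.
have M0 : 0 < M by rewrite /M ltr_wpDl// addr_ge0.
have hM : K <= M by rewrite /M; have := normr_ge0 D; lra.
have : `|- D / M| <= 1.
  by rewrite normrM normrN normfV (gtr0_norm M0) ler_pdivrMr// mul1r /M -addrA lerDl addr_ge0.
move=> /h; set i := M^-1; have i0 : 0 < i by rewrite invr_gt0.
have Mi : M * i = 1 by rewrite mulfV// gt_eqF.
rewrite (_ : _ + _ = - (i * D ^+ 2) * (2 - K * i)); last by rewrite -/i; ring.
move=> h2; have : K * i <= 1 by rewrite -Mi ler_wpM2r// ltW.
move=> h3; have : i * D ^+ 2 <= 0.
  have := mulr_ge0 (ltW i0) (sqr_ge0 D); move: h2 h3; set z := i * _; set y := K * i; nra.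
by rewrite pmulr_rle0// => h4; apply/eqP; rewrite -sqrf_eq0 eq_le h4 sqr_ge0.
Qed.

Lemma quadratic_two_roots (a b c : R) : a * c < 0 ->
  exists t1 t2, [/\ t1 != t2, a + 2 * t1 * b + t1 ^+ 2 * c = 0 & a + 2 * t2 * b + t2 ^+ 2 * c = 0].
Proof.
move=> ac; have c0 : c != 0 by apply: contraTneq ac => ->; rewrite mulr0 ltxx.
have D0 : 0 < b ^+ 2 - a * c by have := sqr_ge0 b; lra.
set s := Num.sqrt (b ^+ 2 - a * c); have s0 : 0 < s by rewrite sqrtr_gt0.
have sE : s ^+ 2 = b ^+ 2 - a * c by rewrite sqr_sqrtr// ltW.
have E e : e ^+ 2 = s ^+ 2 -> a + 2 * ((- b + e) / c) * b + ((- b + e) / c) ^+ 2 * c = 0.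
  move=> he; have -> : a + 2 * ((- b + e) / c) * b + ((- b + e) / c) ^+ 2 * c = (a * c - b ^+ 2 + e ^+ 2) / c by field.
  by rewrite he sE addrA subrK subrr mul0r.
exists ((- b + s) / c), ((- b + - s) / c); split; [|exact: E|by apply: E; rewrite sqrrN].
apply/eqP => /(congr1 ( *%R^~ c)); rewrite !divfK// => /addrI h.
by move: s0; lra.
Qed.

End power.

Section energy.
Context {R : realType} {n : nat}.
Local Notation d := n.+2.
Local Notation mu := (@lebesgue_rV R d).
Variable V : 'rV[R]_d -> R.
Hypothesis hV : admissible_potential V.
Let cV := potential_cont hV.
Let V0 := potential_ge0 hV.
Let Vg := potential_dominates_sqr hV.
Local Notation in_H1 := (in_H1 V).

Lemma mass_expand s X t Y : in_H1 X -> in_H1 Y -> mass (lin s X t Y) (lin s X t Y) =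
  s ^+ 2 * mass X X + 2 * s * t * mass X Y + t ^+ 2 * mass Y Y.
Proof. exact: (sym_expand (@mass_lin _ _ V) (fun X Y _ _ => mass_sym X Y)). Qed.

Lemma ham_expand s X t Y : in_H1 X -> in_H1 Y -> ham V (lin s X t Y) (lin s X t Y) =
  s ^+ 2 * ham V X X + 2 * s * t * ham V X Y + t ^+ 2 * ham V Y Y.
Proof. exact: (sym_expand (ham_lin hV) (fun X Y _ _ => ham_sym V X Y)). Qed.

Lemma angmom_expand s X t Y : in_H1 X -> in_H1 Y -> angmom (lin s X t Y) (lin s X t Y) =
  s ^+ 2 * angmom X X + 2 * s * t * angmom X Y + t ^+ 2 * angmom Y Y.
Proof. exact: (sym_expand (angmom_lin hV) (angmom_sym hV)). Qed.

Variables (lam sigma : R) (j : nat).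
Hypotheses (lam0 : 0 < lam) (sigma0 : 0 < sigma) (hj : 2 * sigma + 2 <= (2 * j.+1)%:R)
  (ctrl : @H1_controls_power R d j.+1).
Local Notation P := (2 * sigma + 2).

Definition rho (X : @cfun R n) x := cabs (toC X x).
Definition nlin_d X x := rho X x `^ P.
Definition nlpair_d U Y x := rho U x `^ (2 * sigma) * mass_d U Y x.
Definition nlin X := \int[mu]_x nlin_d X x.
Definition nlpair U Y := \int[mu]_x nlpair_d U Y x.

Lemma rho_sqr X x : rho X x ^+ 2 = fre X x ^+ 2 + fim X x ^+ 2.
Proof. by rewrite /rho cabs_sqr. Qed.

Lemma rho_ge0 X x : 0 <= rho X x. Proof. exact: cabs_ge0. Qed.

Lemma in_H1_meas X : in_H1 X -> measurable_fun setT (fre X) /\ measurable_fun setT (fim X).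
Proof. by move=> [/rH1_sqint[[h1 _] _ _] /rH1_sqint[[h2 _] _ _]]. Qed.

Lemma rho_meas X : in_H1 X -> measurable_fun setT (rho X).
Proof. by move=> /in_H1_meas[h1 h2]; apply: meas_cabs. Qed.

Lemma nlin_integ X : in_H1 X -> integ mu (nlin_d X).
Proof.
move=> hX; have [h1 h2] := hX; have [m1 m2] := in_H1_meas hX.
have i1 := integZ (2 ^+ j.+1) (integD (rH1_power_integ ctrl h1) (rH1_power_integ ctrl h2)).
apply: (integ_le _ (integD (mass_integ hX hX) i1)).
  exact: (measurableT_comp (f := fun r => r `^ P) (measurable_powR _) (rho_meas hX)).
move=> x; rewrite ger0_norm ?powR_ge0//; apply: (@le_trans _ _ (rho X x ^+ 2 + rho X x ^+ (2 * j.+1))).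
  by apply: power_sandwich => //; [exact: rho_ge0|move: sigma0; lra].
apply: le_trans (ler_norm _); rewrite exprM rho_sqr; apply: lerD; last exact: pow_sqr_sum_le.
by rewrite /mass_d -!expr2.
Qed.

Lemma mass_le_rho U W x : `|mass_d U W x| <= rho U x * rho W x.
Proof.
rewrite -(@ler_sqr _ `|_|) ?nnegrE ?mulr_ge0 ?rho_ge0// -normrX ger0_norm ?sqr_ge0//.
rewrite exprMn !rho_sqr /mass_d -subr_ge0.
rewrite (_ : _ - _ = (fre U x * fim W x - fim U x * fre W x) ^+ 2) ?sqr_ge0//; ring.
Qed.

(** One bound, used for the integrability of the pairing and for convexity. *)
Lemma nlpair_le U W x : P * `|nlpair_d U W x| <= (P - 1) * nlin_d U x + nlin_d W x.
Proof.
have P1 : 1 < P by move: sigma0; lra.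
apply: le_trans (power_tangent P1 (rho_ge0 U x) (rho_ge0 W x)).
rewrite ler_pM2l; last by move: sigma0; lra.
rewrite /nlpair_d normrM (ger0_norm (powR_ge0 _ _)).
apply: le_trans (ler_wpM2l (powR_ge0 _ _) (mass_le_rho U W x)) _.
rewrite mulrA ler_wpM2r ?rho_ge0// (_ : P - 1 = 2 * sigma + 1); last by ring.
rewrite powRD ?powRr1 ?rho_ge0//.
by apply/implyP; move: sigma0 => s0 /eqP h; exfalso; move: s0 h; lra.
Qed.

Lemma nlpair_integ U W : in_H1 U -> in_H1 W -> integ mu (nlpair_d U W).
Proof.
move=> hU hW; have i := integD (integZ (P - 1) (nlin_integ hU)) (nlin_integ hW).
apply: (integ_le _ i).
  apply: (measurable_funM (f := fun x => rho U x `^ (2 * sigma)) (g := mass_d U W)); last exact: integ_meas (mass_integ hU hW).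
  exact: (measurableT_comp (f := fun r => r `^ (2 * sigma)) (measurable_powR _) (rho_meas hU)).
move=> x; apply: le_trans (le_trans (nlpair_le U W x) (ler_norm _)).
by rewrite ler_peMl// ; move: sigma0; lra.
Qed.

Lemma nlpair_self U : nlpair U U = nlin U.
Proof.
congr Rintegral; apply/funext => x; rewrite /nlpair_d /nlin_d powRD; last first.
  by apply/implyP => /eqP h; exfalso; move: sigma0 h; lra.
by rewrite powR_mulrn ?rho_ge0// rho_sqr /mass_d -!expr2.
Qed.

Lemma nlpair_linr U s X t Y : in_H1 U -> in_H1 X -> in_H1 Y -> nlpair U (lin s X t Y) = s * nlpair U X + t * nlpair U Y.
Proof.
move=> hU hX hY; have i1 := nlpair_integ hU hX; have i2 := nlpair_integ hU hY.
rewrite /nlpair -!RintZ// -RintD; [|exact: integZ|exact: integZ].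
by congr Rintegral; apply/funext => x; rewrite /nlpair_d /mass_d /=; ring.
Qed.

(** This takes the place of differentiating the nonlinear term. *)
Lemma nlin_convex U W : in_H1 U -> in_H1 W -> nlin U + P * (nlpair U W - nlpair U U) <= nlin W.
Proof.
move=> hU hW; have i1 := nlpair_integ hU hW; have iU := nlin_integ hU; have iW := nlin_integ hW.
rewrite nlpair_self; have : P * nlpair U W <= (P - 1) * nlin U + nlin W.
  rewrite /nlpair /nlin -!RintZ// -RintD//; last exact: integZ.
  apply: Rint_le; [exact: integZ|by apply: integD => //; exact: integZ|] => x.
  apply: le_trans (nlpair_le U W x); rewrite ler_wpM2l ?ler_norm//; by move: sigma0; lra.
by move=> h; move: h; set p := nlin U; set q := nlpair U W; set w := nlin W; lra.
Qed.

Lemma energyE X : in_H1 X ->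
  energy V lam sigma (toC X) = (ham V X X - lam / (sigma + 1) * nlin X)%:E.
Proof.
move=> hX; have hX' := in_H1_ofC hV (toC_H1 hV hX).
have e : same_fun (ofC V (toC X)) X by [].
rewrite -(ham_ext2 hV hX' hX e).
have i1 := ham_integ hV hX' hX'; have i2 := nlin_integ hX.
rewrite /nlin -RintZ// /ham -RintB//; last exact: integZ.
rewrite -Rint_fin; last by apply: integB => //; exact: integZ.
congr (integral _ _ _); apply/funext => x; congr EFin.
rewrite grad_abs_sqr cabs_sqr /ham_d /mass_d /nlin_d /rho /=; congr (_ * _ + _ * _ - _).
Qed.

Section minimizer.
Variables (m l kap : R) (U : @cfun R n).
Hypotheses (m0 : 0 < m) (hU : in_H1 U) (Um : mass U U = m) (Ul : angmom U U = l).
Hypothesis Umin : energy V lam sigma (toC U) = inf_energy V lam sigma m l.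
Hypothesis Ueig : forall Y, in_H1 Y -> angmom U Y = kap * mass U Y.

(** Convexity replaces the nonlinear part of the energy difference by a term that is
    linear in W. *)
Lemma min_ineq W : in_H1 W -> mass W W = m -> angmom W W = l ->
  2 * lam * (nlpair U W - nlpair U U) <= ham V W W - ham V U U.
Proof.
move=> hW e1 e2; have : (energy V lam sigma (toC U) <= energy V lam sigma (toC W))%E.
  rewrite Umin; apply: ereal_inf_lbound; exists (toC W) => //.
  exact/(constraintE hV m l hW).
rewrite !energyE// lee_fin; have := nlin_convex hU hW.
have s1 : 0 < sigma + 1 by move: sigma0; lra.
set k := lam / (sigma + 1); have k0 : 0 < k by rewrite divr_gt0.
have -> : 2 * lam = k * P by rewrite /k; field; rewrite gt_eqF.
set a := nlin U; set b := nlin W; set q := nlpair U W - _ => h1 h2.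
have := ler_wpM2l (ltW k0) h1; rewrite mulrDr mulrA; move: h2; lra.
Qed.

(** As U is in the kernel of angmom - kap mass, the conditions on Y make the whole
    curve s (U + t Y), with s a normalizing factor, satisfy both constraints. *)
Lemma variation Y : in_H1 Y -> mass U Y = 0 -> angmom Y Y = kap * mass Y Y ->
  ham V U Y = lam * nlpair U Y.
Proof.
move=> hY o eY; set c := mass Y Y / m.
have c0 : 0 <= c.
  by rewrite divr_ge0 ?(ltW m0)//; apply: Rint_ge0 => x; rewrite /mass_d -!expr2 addr_ge0 ?sqr_ge0.
have cE : mass Y Y = c * m by rewrite divfK// gt_eqF.
have lE : l = kap * m by rewrite -Ul Ueig// Um.
set A := ham V U U; set B := ham V U Y; set C := ham V Y Y; set T := nlpair U Y; set S := nlpair U U.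
apply/eqP; rewrite -subr_eq0; apply/eqP.
(* The constant collects the terms of second order in t, estimated in b1, ..., b5. *)
apply: (@no_slope _ _ (2 * `|B| * c + 2 * lam * `|T| * c + `|A| * c + `|C| + 2 * lam * `|S| * c)).
  have b0 (x : R) : 0 <= `|x| * c by rewrite mulr_ge0.
  have := b0 B; have := mulr_ge0 (ltW lam0) (b0 T); have := b0 A; have := normr_ge0 C.
  by have := mulr_ge0 (ltW lam0) (b0 S); rewrite -!mulrA; lra.
(* The factor s = q^(-1/2) restores the mass, and 1 - s <= 1 - s^2 <= c t^2 is of
   second order. *)
move=> t t1; pose q := 1 + c * t ^+ 2; have q0 : 1 <= q by rewrite lerDl mulr_ge0// sqr_ge0.
pose s := (Num.sqrt q)^-1.
have sq1 : 1 <= Num.sqrt q by rewrite -[1]sqrtr1 ler_wsqrtr.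
have s0 : 0 < s by rewrite invr_gt0 (lt_le_trans _ sq1).
have s1 : s <= 1 by rewrite invf_le1// (lt_le_trans _ sq1).
have sE : s ^+ 2 * q = 1 by rewrite exprVn sqr_sqrtr ?(le_trans _ q0)// mulVf// gt_eqF// (lt_le_trans _ q0).
have hW := in_H1_lin s (s * t) hU hY.
have lU : angmom U Y = 0 by rewrite Ueig// o mulr0.
have eW1 : mass (lin s U (s * t) Y) (lin s U (s * t) Y) = m.
  rewrite mass_expand// o Um cE.
  rewrite -[RHS]mul1r -sE /q; ring.
have eW2 : angmom (lin s U (s * t) Y) (lin s U (s * t) Y) = l.
  rewrite angmom_expand// lU Ul eY cE lE.
  rewrite -[RHS]mul1r -sE /q; ring.
have := min_ineq hW eW1 eW2.
rewrite ham_expand// nlpair_linr//.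
rewrite -/A -/B -/C -/T -/S => h.
pose e := 1 - s ^+ 2; pose g := 1 - s.
have ss1 : s ^+ 2 <= 1 by rewrite expr_le1// ltW.
have ec : e <= c * t ^+ 2.
  have -> : e = s ^+ 2 * (c * t ^+ 2) by rewrite /e -sE /q; ring.
  by rewrite ler_piMl// mulr_ge0// sqr_ge0.
have g0 : 0 <= g by rewrite subr_ge0.
have ge : g <= e.
  have -> : e = g * (1 + s) by rewrite /e /g; ring.
  by rewrite ler_peMr// lerDl ltW.
have e0 : 0 <= e := le_trans g0 ge.
have gc := le_trans ge ec.
have b1 : - (t * B * e) <= `|B| * (c * t ^+ 2).
  apply: le_trans (ler_norm _) _; rewrite normrN !normrM (ger0_norm e0).
  apply: ler_pM => //; rewrite ?mulr_ge0//.
  exact: ler_piMl.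
have b2 : t * T * g <= `|T| * (c * t ^+ 2).
  apply: le_trans (ler_norm _) _; rewrite !normrM (ger0_norm g0).
  apply: ler_pM => //; rewrite ?mulr_ge0//.
  exact: ler_piMl.
have b3 : - (A * e) <= `|A| * (c * t ^+ 2).
  by apply: le_trans (ler_norm _) _; rewrite normrN normrM (ger0_norm e0) ler_wpM2l.
have b4 : s ^+ 2 * t ^+ 2 * C <= `|C| * t ^+ 2.
  rewrite mulrC; apply: le_trans (ler_norm _) _; rewrite normrM ler_wpM2l//.
  have st0 : 0 <= s ^+ 2 * t ^+ 2 by apply: mulr_ge0; exact: sqr_ge0.
  by rewrite (ger0_norm st0); apply: ler_piMl => //; exact: sqr_ge0.
have b5 : S * g <= `|S| * (c * t ^+ 2).
  by apply: le_trans (ler_norm _) _; rewrite normrM (ger0_norm g0) ler_wpM2l.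
have b2' := ler_wpM2l (ltW lam0) b2; have b5' := ler_wpM2l (ltW lam0) b5.
clear b2 b5 ec gc.
rewrite (_ : s ^+ 2 * A + 2 * s * (s * t) * B + (s * t) ^+ 2 * C - A =
  - (A * e) + 2 * (t * B) + 2 * - (t * B * e) + s ^+ 2 * t ^+ 2 * C) in h; last by rewrite /e; ring.
rewrite (_ : 2 * lam * (s * S + s * t * T - S) =
  2 * lam * (t * T) - 2 * (lam * (t * T * g)) - 2 * (lam * (S * g))) in h; last by rewrite /g; ring.
rewrite (_ : 2 * t * (B - lam * T) + _ * t ^+ 2 = 2 * (t * B) - 2 * lam * (t * T)
  + 2 * (`|B| * (c * t ^+ 2)) + 2 * (lam * (`|T| * (c * t ^+ 2))) + `|A| * (c * t ^+ 2) + `|C| * t ^+ 2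
  + 2 * (lam * (`|S| * (c * t ^+ 2)))); last by ring.
by move: h b1 b2' b3 b4 b5'; lra.
Qed.

Let om := (ham V U U - lam * nlpair U U) / m.
(** The Euler-Lagrange residual; the multiplier is the one that makes it vanish at U. *)
Definition EL Y := ham V U Y - lam * nlpair U Y - om * mass U Y.

Lemma EL_lin s X t Y : in_H1 X -> in_H1 Y -> EL (lin s X t Y) = s * EL X + t * EL Y.
Proof.
move=> hX hY; have hL := in_H1_lin s t hX hY.
rewrite /EL ham_sym (ham_lin hV)// mass_sym (@mass_lin _ _ V)// nlpair_linr//.
rewrite (ham_sym _ X) (ham_sym _ Y) (mass_sym X) (mass_sym Y); ring.
Qed.

Lemma EL_U : EL U = 0.
Proof. by rewrite /EL /om Um divfK ?gt_eqF// subrr. Qed.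

(** The quadratic form of L_z - kap. *)
Definition cone_form (X : @cfun R n) := angmom X X - kap * mass X X.

(** Removing from Y its component along U makes it orthogonal to U and changes neither
    cone_form Y nor EL Y. *)
Lemma EL_null Y : in_H1 Y -> cone_form Y = 0 -> EL Y = 0.
Proof.
move=> hY o; set c := mass U Y / m; set Z := lin 1 Y (- c) U.
have hZ : in_H1 Z by exact: in_H1_lin.
have oZ : mass U Z = 0.
  rewrite mass_sym (@mass_lin _ _ V)// (mass_sym Y) Um /c mul1r mulNr divfK ?subrr// gt_eqF//.
have eZ : angmom Z Z = kap * mass Z Z.
  rewrite angmom_expand// mass_expand//.
  rewrite (angmom_sym hV hY hU)// !Ueig// (mass_sym Y U).
  move: o; rewrite /cone_form; set p := angmom Y Y; set q := mass Y Y => o; have -> : p = kap * q by move: o; lra.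
  by ring.
have v := variation hZ oZ eZ; have : EL Z = 0 by rewrite /EL v oZ subrr mulr0 subrr.
by rewrite EL_lin// EL_U mulr0 addr0 mul1r.
Qed.

(** On a line X + t Y along which the quadratic form has the signs of X and Y opposite,
    it has two real roots. EL is affine on the line and vanishes at both, hence
    identically. So EL vanishes wherever the form is nonzero, and on its cone. *)
Lemma EL_zero P' M' : in_H1 P' -> in_H1 M' -> 0 < cone_form P' -> cone_form M' < 0 ->
  forall Y, in_H1 Y -> EL Y = 0.
Proof.
move=> hP hM oP oM.
have key X Y : in_H1 X -> in_H1 Y -> cone_form X * cone_form Y < 0 -> EL X = 0.
  move=> hX hY neg; set b := angmom X Y - kap * mass X Y.
  have [t1 [t2 [t12 r1 r2]]] := quadratic_two_roots b neg.
  have E t : cone_form (lin 1 X t Y) = cone_form X + 2 * t * b + t ^+ 2 * cone_form Y.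
    rewrite /cone_form angmom_expand// mass_expand//.
    by rewrite /b; ring.
  have Z t : cone_form X + 2 * t * b + t ^+ 2 * cone_form Y = 0 -> EL X + t * EL Y = 0.
    by rewrite -E => /(EL_null (in_H1_lin 1 t hX hY)); rewrite EL_lin// mul1r.
  have z1 := Z _ r1; have z2 := Z _ r2.
  have : (t1 - t2) * EL Y = 0.
    have : (EL X + t1 * EL Y) - (EL X + t2 * EL Y) = 0 by rewrite z1 z2 subrr.
    by move=> <-; ring.
  move=> /eqP; rewrite mulf_eq0 subr_eq0 (negbTE t12) => /eqP e; move: z1; by rewrite e mulr0 addr0.
move=> Y hY; case: (ltgtP (cone_form Y) 0) => h.
- by apply: (key Y P') => //; rewrite nmulr_rlt0.
- by apply: (key Y M') => //; rewrite pmulr_rlt0.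
- exact: EL_null.
Qed.

End minimizer.
End energy.

(** * Directions of both signs, and the weak equation *)

Section harmonics.
Context {R : realType} {n : nat}.
Local Notation d := n.+2.
Local Notation mu := (@lebesgue_rV R d).
Local Notation x1 := (fun x : 'rV[R]_d => x ord0 (@axis1 n)).
Local Notation x2 := (fun x : 'rV[R]_d => x ord0 (@axis2 n)).
Local Notation D f := (ang (partial^~ f)).

(** Carries smoothness along, so that angular derivatives of explicit functions are
    found by combining the lemmas below. *)
Definition has_ang (f f' : 'rV[R]_d -> R) := smooth f /\ forall x, D f x = f' x.

Lemma has_angM f f' g g' : has_ang f f' -> has_ang g g' ->
  has_ang (fun x => f x * g x) (fun x => f' x * g x + f x * g' x).
Proof.
move=> [sf ef] [sg eg]; split; first exact: smoothM.
move=> x; rewrite -ef -eg /ang.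
have E i := hasD_partial (hasDM (smooth_hasD i sf) (smooth_hasD i sg)).
by rewrite !E; ring.
Qed.

Lemma has_angD f f' g g' : has_ang f f' -> has_ang g g' ->
  has_ang (fun x => f x + g x) (fun x => f' x + g' x).
Proof.
move=> [sf ef] [sg eg]; split; first exact: smoothD.
move=> x; rewrite -ef -eg /ang.
have E i := hasD_partial (hasDD (smooth_hasD i sf) (smooth_hasD i sg)).
by rewrite !E; ring.
Qed.

Lemma has_ang_cst (c : R) : has_ang (fun=> c) (fun=> 0).
Proof.
split; first exact: smooth_cst.
have E i := hasD_partial (@hasD_cst R d c i).
by move=> x; rewrite /ang !E; ring.
Qed.

Lemma has_ang_x1 : has_ang x1 (fun x => - x2 x).
Proof.
split; first exact: smooth_coord.
have E i := hasD_partial (@hasD_coord R d i (@axis1 n)).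
by move=> x; rewrite /ang !E /=; ring.
Qed.

Lemma has_ang_x2 : has_ang x2 x1.
Proof.
split; first exact: smooth_coord.
have E i := hasD_partial (@hasD_coord R d i (@axis2 n)).
by move=> x; rewrite /ang !E /=; ring.
Qed.

(** Real and imaginary parts of (x1 + i x2)^k. *)
Fixpoint zpow (k : nat) (x : 'rV[R]_d) : R * R :=
  if k is k'.+1 then
    (x1 x * (zpow k' x).1 + -1 * (x2 x * (zpow k' x).2), x1 x * (zpow k' x).2 + x2 x * (zpow k' x).1)
  else (1, 0).

Lemma zpow_sqr k x : (zpow k x).1 ^+ 2 + (zpow k x).2 ^+ 2 = (x1 x ^+ 2 + x2 x ^+ 2) ^+ k.
Proof.
elim: k => [|k IH] /=; first by rewrite expr0n expr1n addr0.
by rewrite [RHS]exprS -[X in _ = _ * X]IH; ring.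
Qed.

Lemma zpow_ang k : has_ang (fun x => (zpow k x).1) (fun x => - k%:R * (zpow k x).2) /\
  has_ang (fun x => (zpow k x).2) (fun x => k%:R * (zpow k x).1).
Proof.
have conv f f' g' : has_ang f f' -> (forall x, f' x = g' x) -> has_ang f g'.
  by move=> [sf e] h; split => // x; rewrite e h.
elim: k => [|k [h1 h2]].
  by split; apply: (conv _ _ _ (has_ang_cst _)) => x; ring.
split.
  apply: (conv _ _ _ (has_angD (has_angM has_ang_x1 h1) (has_angM (has_ang_cst (-1)) (has_angM has_ang_x2 h2)))) => x.
  by rewrite -natr1 /=; ring.
apply: (conv _ _ _ (has_angD (has_angM has_ang_x1 h2) (has_angM has_ang_x2 h1))) => x.
by rewrite -natr1 /=; ring.
Qed.

Definition ofRI (a b : 'rV[R]_d -> R) := CFun a (partial^~ a) b (partial^~ b).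

(** The function f (x1 + i x2)^k. *)
Definition spun f k := ofRI (fun x => f x * (zpow k x).1) (fun x => f x * (zpow k x).2).

Variable V : 'rV[R]_d -> R.
Hypothesis hV : admissible_potential V.
Let cV := potential_cont hV.
Local Notation in_H1 := (in_H1 V).

Lemma in_H1_spun f k : ctest f -> in_H1 (spun f k).
Proof.
move=> tf; have [[s1 _] [s2 _]] := zpow_ang k.
by split; apply: (rH1_test cV); exact: ctestM.
Qed.

(** The real factor f contributes nothing to the real part of <L_z h, h>, and
    (x1 + i x2)^k is an eigenfunction with eigenvalue k. *)
Lemma spun_angmom f k : ctest f -> angmom (spun f k) (spun f k) = k%:R * mass (spun f k) (spun f k).
Proof.
move=> tf; rewrite /mass -RintZ; last by apply: mass_integ; exact: in_H1_spun.
have [sf _] := tf; have hf : has_ang f (D f) by split.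
have [h1 h2] := zpow_ang k; have [_ E1] := has_angM hf h1; have [_ E2] := has_angM hf h2.
congr Rintegral; apply/funext => x; rewrite /angmom_d /mass_d E1 E2 /=; ring.
Qed.

Lemma coord_null : mu.-negligible [set x : 'rV[R]_d | x1 x = 0].
Proof.
pose A (i : 'I_d) : set (measurableTypeR R) := if i == ord0 then [set (0:R)] else setT.
have mA i : measurable (A i) by rewrite /A; case: ifP.
apply/negligibleP; last first.
  have E : [set x : 'rV[R]_d | x ord0 (@axis1 n) = 0] = [set x | forall i, A i (x ord0 i)].
    apply/seteqP; split => x /=.
      by move=> h i; rewrite /A; case: eqP => [->|//].
    by move=> /(_ ord0); rewrite /A eqxx.
  apply: etrans (congr1 (lebesgue_rV d) E) _; apply: etrans (lebesgue_rV_box mA) _.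
  rewrite big_ord_recl {1}/A eqxx lebesgue_measure_set1 mul0e//.
rewrite (_ : [set _ | _] = x1 @^-1` [set 0])//.
by rewrite -[X in measurable X]setTI; apply: measurable_rV_coord.
Qed.

(** The modulus of (x1 + i x2)^k vanishes only on a null set. *)
Lemma spun_mass f k : ctest f -> \int[mu]_x (f x * f x) != 0 -> 0 < mass (spun f k) (spun f k).
Proof.
move=> tf nz; have hS := in_H1_spun k tf.
rewrite lt_def; apply/andP; split; last first.
  by apply: Rint_ge0 => x; rewrite /mass_d -!expr2 addr_ge0 ?sqr_ge0.
apply/eqP => z; move/eqP: nz; apply.
have pos x : 0 <= mass_d (spun f k) (spun f k) x by rewrite /mass_d -!expr2 addr_ge0 ?sqr_ge0.
have z1 := Rint_eq0 (mass_integ hS hS) pos z.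
have i0 : integ mu (fun x => 0 * mass_d (spun f k) (spun f k) x) by exact: (integZ 0 (mass_integ hS hS)).
have sf := ctest_sqint tf.
have [|_ E] := Rint_ae i0 (integ_meas (sqintM sf sf)); last first.
  by rewrite -E (RintZ 0 (mass_integ hS hS)) mul0r.
have c0 : {ae mu, forall x, x1 x != 0}.
  by apply: (negligibleS _ coord_null) => x /= /negP; rewrite negbK => /eqP.
apply: filterS2 z1 c0 => x; rewrite /mass_d /= => e x10.
have : f x ^+ 2 * (x1 x ^+ 2 + x2 x ^+ 2) ^+ k = 0.
  by rewrite -zpow_sqr -[RHS]e; ring.
move=> /eqP; rewrite mulf_eq0 => /orP[|].
  by rewrite expf_eq0 /= => /eqP ->; rewrite !mul0r.
rewrite expf_eq0 => /andP[_]; rewrite paddr_eq0 ?sqr_ge0// sqrf_eq0 (negbTE x10) //.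
Qed.

(** Otherwise the test functions approximating U would all be zero in L^2. *)
Lemma test_nonzero U : in_H1 U -> mass U U != 0 -> exists2 f, ctest f & \int[mu]_x (f x * f x) != 0.
Proof.
move=> hU nz; apply: contrapT => H.
have Z f : ctest f -> \int[mu]_x (f x * f x) = 0.
  by move=> tf; apply/eqP; apply: contrapT => /negP h; apply: H; exists f.
have K a p : rH1 V a p -> \int[mu]_x (a x * a x) = 0.
  move=> [f [tf fre _ _]]; have := L2cvg_inner fre fre.
  have -> : (fun k => \int[mu]_x (f k x * f k x)) = fun=> (0:R) by apply/funext => k; exact: Z.
  by move=> /cvg_lim <-//; rewrite lim_cst.
have [h1 h2] := hU; have [s1 _ _] := rH1_sqint h1; have [s2 _ _] := rH1_sqint h2.
move/eqP: nz; apply; rewrite /mass RintD; [|exact: sqintM|exact: sqintM].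
by rewrite (K _ _ h1) (K _ _ h2) addr0.
Qed.

Lemma ofR_angmom (f : 'rV[R]_d -> R) : angmom (ofR f) (ofR f) = 0.
Proof.
rewrite /angmom (_ : angmom_d _ _ = fun=> 0); first by rewrite Rintegral_cst// mul0r.
by apply/funext => x; rewrite /angmom_d (has_ang_cst 0).2 /=; ring.
Qed.

End harmonics.

Section final.
Context {R : realType} {n : nat}.
Local Notation d := n.+2.
Local Notation mu := (@lebesgue_rV R d).
Variable V : 'rV[R]_d -> R.
Hypothesis hV : admissible_potential V.

(** Tested with phi, the equation has as real part the residual at phi and as imaginary
    part the residual at i phi. *)
Lemma weak_solutionP (lam sigma om : R) u : H1space V u ->
  (forall Y, in_H1 V Y -> ham V (ofC V u) Y - lam * nlpair sigma (ofC V u) Y - om * mass (ofC V u) Y = 0) ->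
  (forall Y, in_H1 V Y -> integ mu (nlpair_d sigma (ofC V u) Y)) ->
  weak_solution V lam sigma om u.
Proof.
move=> hu EL ipair phi hphi; set U := ofC V u in EL ipair *.
have hU : in_H1 V U := in_H1_ofC hV hu.
have hF := in_H1_ofC hV hphi; set F := ofC V phi in hF.
have hJ := in_H1_mul_i hF.
have sumC (G H : 'I_d -> R) : \sum_i Complex (G i) (H i) = Complex (\sum_i G i) (\sum_i H i).
  by elim/big_rec3: _ => // i x y z _ ->.
have half : (2^-1 : R[i]) = Complex 2^-1 0.
  have two : Complex 2 0 = 2 :> R[i] by rewrite -(rmorph_nat (real_complex R) 2).
  have nz : (2 : R[i]) != 0 by rewrite pnatr_eq0.
  apply: (mulfI nz); rewrite mulfV// -two cmulE; apply/eqP; rewrite eq_complex /=.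
  by apply/andP; split; apply/eqP; field.
have L x : 2^-1 * (\sum_i (grad V u i x * (grad V phi i x)^*)) + (V x)%:C%C * u x * (phi x)^*
    - om%:C%C * u x * (phi x)^* =
  Complex (ham_d V U F x - om * mass_d U F x) (ham_d V U (mul_i F) x - om * mass_d U (mul_i F) x).
  have -> : \sum_i (grad V u i x * (grad V phi i x)^*) =
    Complex (\sum_i (gre U i x * gre F i x + gim U i x * gim F i x))
            (\sum_i (gre U i x * gre (mul_i F) i x + gim U i x * gim (mul_i F) i x)).
    rewrite -sumC; apply: eq_bigr => i _; rewrite conjE /=.
    case: (grad V u i x) => a b; rewrite cmulE /=; congr Complex; ring.
  rewrite half conjE /ham_d /mass_d /=; case: (u x) => a b; rewrite !cmulE /=.
  by apply/eqP; rewrite eq_complex /=; apply/andP; split; apply/eqP; ring.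
have Rr x : (lam * cabs (u x) `^ (2 * sigma))%:C%C * u x * (phi x)^* =
  Complex (lam * nlpair_d sigma U F x) (lam * nlpair_d sigma U (mul_i F) x).
  have -> : cabs (u x) = rho U x by rewrite /rho toC_ofC.
  rewrite conjE /nlpair_d /mass_d /=; case: (u x) => a b; rewrite !cmulE /=.
  by congr Complex; ring.
have I Y : in_H1 V Y -> \int[mu]_x (ham_d V U Y x - om * mass_d U Y x) = \int[mu]_x (lam * nlpair_d sigma U Y x).
  move=> hY; have i1 := ham_integ hV hU hY; have i2 := mass_integ hU hY; have i3 := ipair _ hY.
  rewrite RintB//; last exact: integZ.
  rewrite !RintZ//; have := EL _ hY; rewrite /ham /mass /nlpair.
  by set a := \int[mu]_x _; set b := \int[mu]_x _; set c := \int[mu]_x _; lra.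
rewrite /cintegral; congr Complex.
  transitivity (\int[mu]_x (ham_d V U F x - om * mass_d U F x)); first by congr Rintegral; apply/funext => x; rewrite L.
  by rewrite I//; congr Rintegral; apply/funext => x; rewrite Rr.
transitivity (\int[mu]_x (ham_d V U (mul_i F) x - om * mass_d U (mul_i F) x)); first by congr Rintegral; apply/funext => x; rewrite L.
by rewrite I//; congr Rintegral; apply/funext => x; rewrite Rr.
Qed.

End final.

Theorem proposition4p1 (R : realType) (n : nat)
    (hd : n.+2 = 2%N \/ n.+2 = 3%N)
    (lam sigma m l : R) (hlam : 0 < lam) (hsigma : 0 < sigma)
    (hsigma' : (sigma%:E < critical_exponent R n.+2)%E)
    (hm : 0 < m) (hl : 0 < l)
    (V : 'rV[R]_n.+2 -> R) (hV : admissible_potential V)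
    (u : 'rV[R]_n.+2 -> R[i]) (hu : constraint_set V m l u)
    (hmin : energy V lam sigma u = inf_energy V lam sigma m l) :
  (l / m \isn't a Num.int -> regular V m l u) /\
  (forall k : int, l / m = k%:~R -> ~ Lz_eigenfunction V u k%:~R ->
     regular V m l u) /\
  (forall k : int, Lz_eigenfunction V u k%:~R ->
     exists omega : R, weak_solution V lam sigma omega u).
Proof.
have lm0 : 0 < l / m by rewrite divr_gt0.
split; [|split].
- move=> nint; apply: contrapT => nreg; move/negP: nint; apply.
  have [k ->] := Lz_eigenvalue_natural hV (not_regular_eigen hV hm hu nreg) (ltW lm0).
  exact: intr_nat.
- move=> k <- neig; apply: contrapT => nreg; apply: neig; exact: (not_regular_eigen hV hm hu nreg).
move=> k; set kap := k%:~R => eig; have [hu1 _ _] := hu.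
have hU := in_H1_ofC hV hu1; set U := ofC V u in hU.
have uE : u = toC U by rewrite toC_ofC.
have [Um Ul] : mass U U = m /\ angmom U U = l by apply/(constraintE hV m l hU); rewrite -uE.
have [e1 e2] := Lz_eigen_ae eig.
have Ueig Y : in_H1 V Y -> angmom U Y = kap * mass U Y by move=> hY; exact: (eigen_angmom hV hU hY e1 e2).
have kap0 : 0 < kap.
  by have := Ueig _ hU; rewrite Um Ul => lE; rewrite -(pmulr_lgt0 _ hm) -lE.
have [k' kE] := Lz_eigenvalue_natural hV eig (ltW kap0).
have [j [hj ctrl]] := subcritical_power hd hsigma'.
have Unz : mass U U != 0 by rewrite Um gt_eqF.
have [f tf fnz] := test_nonzero hU Unz.
have Umin : energy V lam sigma (toC U) = inf_energy V lam sigma m l by rewrite -uE.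
(* The two directions: f (x1 + i x2)^(k' + 1), on which the form of L_z - k' is
   positive, and f itself, on which it is negative. *)
have h1 := in_H1_spun hV k'.+1 tf; have h2 := in_H1_ofR hV tf.
exists ((ham V U U - lam * nlpair sigma U U) / m); apply: weak_solutionP => //.
  apply: (EL_zero hV hlam hsigma hj ctrl hm hU Um Ul Umin Ueig h1 h2).
    rewrite /cone_form (spun_angmom hV)// kE -mulrBl mulr_gt0 ?(spun_mass hV)//.
    by rewrite -natr1 addrAC subrr add0r.
  rewrite /cone_form ofR_angmom sub0r oppr_lt0 mulr_gt0// lt_def; apply/andP; split; last first.
    by apply: Rint_ge0 => x; rewrite /mass_d -!expr2 addr_ge0 ?sqr_ge0.
  move: fnz; congr (_ != _); congr Rintegral; apply/funext => x.
  by rewrite /mass_d /= mulr0 addr0.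
by move=> Y hY; exact: (nlpair_integ hsigma hj ctrl hU hY).
Qed.
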